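(* Let $n\in\{2,3\}$, let $\Omega\subset\mathbb{R}^n$ be a Lipschitz domain with boundary $\Gamma=\partial\Omega$, let $T>0$, $I=(0,T)$, and $\Sigma=I\times\Gamma$. Let $\mu,\nu\in(0,1)$ and let $\mathcal{P}$ be a prismatic mesh of $\Sigma$, with mesh constants $C_{\rm nei},C_{\rm dist},C_{\rm lqu}\ge1$ as in the context. Then there exist constants $C_{\rm eff}',C_{\rm rel}'>0$ such that for all $v\in H^{\mu,\nu}(\Sigma)$, with the abbreviation $$ S_{\mathcal P}(v):=\sum_{J\times K\in\mathcal{P}}\Bigg(\sum_{\substack{\tilde J\times\tilde K\in\mathcal{P}\\ |J\cap\tilde J|>0\\ K\cap\tilde K\neq\emptyset}}|v|_{L_2(J\cap\tilde J;H^\mu(K\cup\tilde K))}^2+\sum_{\substack{\tilde J\times\tilde K\in\mathcal{P}\\ J\cap\tilde J\neq\emptyset\\ |K\cap\tilde K|>0}}|v|_{H^\nu(J\cup\tilde J;L_2(K\cap\tilde K))}^2\Bigg), $$ there holds that $$ S_{\mathcal P}(v)\le (C_{\rm eff}')^2\,\|v\|_{H^{\mu,\nu}(\Sigma)}^2 $$ as well as $$ (C_{\rm rel}')^{-2}\,\|v\|_{H^{\mu,\nu}(\Sigma)}^2\le S_{\mathcal P}(v)+\sum_{J\times K\in\mathcal{P}}\big(\operatorname{diam}(K)^{-2\mu}+|J|^{-2\nu}\big)\|v\|_{L_2(J\times K)}^2 . $$ The constant $C_{\rm eff}'$ is given as $C_{\rm eff}'=\max(2(C_{\rm nei}+1)^2,32)$,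 and $C_{\rm rel}'$ depends only on $n$, $\mu$, $\nu$, $\Gamma$, $|I|$, $C_{\rm dist}$, and $C_{\rm lqu}$.
   Context: Notation: $|\cdot|$ denotes absolute value, Euclidean norm, or the measure of a set (length of an interval, $(n-1)$-dimensional surface measure on $\Gamma$); $\overline I=[0,T]$. Anisotropic Sobolev spaces. For an $(n-1)$-dimensional $\omega\subseteq\Gamma$ and $\mu\in(0,1)$, set $|w|_{H^\mu(\omega)}^2:=\int_\omega\int_\omega\frac{|w(x)-w(y)|^2}{|x-y|^{n-1+2\mu}}\,dy\,dx$, $\|w\|_{H^\mu(\omega)}^2:=\|w\|_{L_2(\omega)}^2+|w|_{H^\mu(\omega)}^2$, and let $H^\mu(\omega)$ be the space of $w\in L_2(\omega)$ with finite norm. For a subinterval $J\subseteq\overline I$, $\nu\in(0,1)$, and a Banach space $X$, set $|v|_{H^\nu(J;X)}^2:=\int_J\int_J\frac{\|v(t)-v(s)\|_X^2}{|t-s|^{1+2\nu}}\,ds\,dt$, $\|v\|_{H^\nu(J;X)}^2:=\|v\|_{L_2(J;X)}^2+|v|_{H^\nu(J;X)}^2$, and let $H^\nu(J;X)$ be the space of $v\in L_2(J;X)$ with finite norm. Define $H^{\mu,\nu}(J\times\omega):=L_2(J;H^\mu(\omega))\cap H^\nu(J;L_2(\omega))$ with norm $\|v\|_{H^{\mu,\nu}(J\times\omega)}^2:=\|v\|_{L_2(J;H^\mu(\omega))}^2+\|v\|_{H^\nu(J;L_2(\omega))}^2$; in particular $H^{\mu,\nu}(\Sigma)=H^{\mu,\nu}(I\times\Gamma)$.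 Abbreviate $|v|_{L_2(J;H^\mu(\omega))}^2:=\int_J|v(t,\cdot)|_{H^\mu(\omega)}^2\,dt$. Prismatic mesh. A prismatic mesh $\mathcal{P}$ of $\Sigma$ is a finite set of prisms $P=J\times K$, where $J\subseteq\overline I$ is a non-empty compact interval and $K\subseteq\Gamma$ is the image of a compact Lipschitz domain $\hat K\subset\mathbb{R}^{n-1}$ (the closure of a bounded Lipschitz domain; for $n=2$, a compact interval with non-empty interior) under a bi-Lipschitz mapping, such that distinct $P,\tilde P\in\mathcal{P}$ intersect in a set of measure zero on $\Sigma$, and $\mathcal{P}$ is a partition of $\Sigma$, i.e. $\Sigma=\bigcup_{P\in\mathcal{P}}P$ (up to the endpoints of the time interval). For $t\in\overline I$ and $x\in\Gamma$, put $\mathcal{P}|_t:=\{K\subseteq\Gamma:(\{t\}\times\Gamma)\cap(J\times K)\ne\emptyset\text{ for some }J\times K\in\mathcal{P}\}$ and $\mathcal{P}|_x:=\{J\subseteq\overline I:(\overline I\times\{x\})\cap(J\times K)\neq\emptyset\text{ for some }J\times K\in\mathcal{P}\}$. Mesh constants. $C_{\rm nei},C_{\rm dist},C_{\rm lqu}\ge1$ are constants (which exist for each fixed prismatic mesh) such that: for almost all $t\in\overline I$, $\#\{\tilde K\in\mathcal{P}|_t:K\cap\tilde K\ne\emptyset\}\le C_{\rm nei}$ for all $K\in\mathcal{P}|_t$; for almost all $t\in\overline I$, $\operatorname{diam}(K)\le C_{\rm dist}\operatorname{dist}(K,\tilde K)$ for all $K,\tilde K\in\mathcal{P}|_t$ with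 $K\cap\tilde K=\emptyset$; for almost all $x\in\Gamma$, $|J|\le C_{\rm lqu}|\tilde J|$ for all $J,\tilde J\in\mathcal{P}|_x$ with $J\cap\tilde J\neq\emptyset$. *)

(* Defs.v *)
From HB Require Import structures.
From mathcomp Require Import all_boot all_order all_algebra.
From mathcomp Require Import finmap.
From mathcomp Require Import all_classical all_reals all_analysis.

Set Implicit Arguments.
Unset Strict Implicit.
Unset Printing Implicit Defensive.

Import Order.TTheory GRing.Theory Num.Theory.
Import numFieldNormedType.Exports.

Local Open Scope classical_set_scope.
Local Open Scope ring_scope.

Section Euclidean.
Context {R : realType}.

(* The library norm on ['rV[R]_n] is the sup norm; the topology is the
   Euclidean one. *)
Definition enorm n (x : 'rV[R]_n) : R := Num.sqrt (\sum_i x ord0 i ^+ 2).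

(* The added 0 only matters for the empty set, whose diameter is 0. *)
Definition ediam n (A : set 'rV[R]_n) : \bar R :=
  ereal_sup ([set 0%E] `|`
             [set (enorm (xy.1 - xy.2))%:E | xy in A `*` A]).

Definition diam n (A : set 'rV[R]_n) : R := fine (ediam A).

Definition set_dist n (A B : set 'rV[R]_n) : R :=
  inf [set enorm (xy.1 - xy.2) | xy in A `*` B].

Definition boundary n (D : set 'rV[R]_n) : set 'rV[R]_n :=
  closure D `\` interior D.

Definition lipschitz_fun n (f : 'rV[R]_n -> R) : Prop :=
  exists L : R, forall x y, `|f x - f y| <= L * enorm (x - y).

(* Near each boundary point, [D] is, after the rigid motion y |-> y Q + b, the
   part below the graph of a Lipschitz function, the graph direction being the
   [j]-th coordinate and [col' j z] the other n - 1 coordinates.  No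
   boundedness is required. *)
Definition lipschitz_domain n (D : set 'rV[R]_n) : Prop :=
  [/\ open D, connected D, D !=set0 &
      forall x, boundary D x ->
        exists (W : set 'rV[R]_n) (Q : 'M[R]_n) (b : 'rV[R]_n) (j : 'I_n)
               (zeta : 'rV[R]_n.-1 -> R),
          [/\ open W, W x, Q *m Q^T = 1%:M, lipschitz_fun zeta &
              W `&` D =
              W `&` [set y | let z := y *m Q + b in
                             z ord0 j < zeta (col' j z)]]].

(* In dimension 1: the compact intervals with non-empty interior. *)
Definition compact_lipschitz_domain d (K : set 'rV[R]_d) : Prop :=
  if d == 1%N then
    exists a b : R, a < b /\ K = [set x | forall i, a <= x ord0 i <= b]
  else
    exists D : set 'rV[R]_d,
      [/\ lipschitz_domain D, bounded_set D & K = closure D].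

Definition bilipschitz_on m n (A : set 'rV[R]_m) (f : 'rV[R]_m -> 'rV[R]_n) :
    Prop :=
  exists c C : R, [/\ 0 < c, 0 < C & forall x y, A x -> A y ->
    c * enorm (x - y) <= enorm (f x - f y) <= C * enorm (x - y)].

End Euclidean.

Section SurfaceMeasure.
Context {R : realType}.

Definition borel_rV n := g_sigma_algebraType (@open 'rV[R]_n).

(* Volume of the unit ball of R^s. *)
Fixpoint unit_ball_volume (s : nat) : R :=
  match s with
  | 0%N => 1
  | 1%N => 2
  | (s'.+2)%N => 2 * pi / s'.+2%:R * unit_ball_volume s'
  end.

Definition hausdorff_content n (s : nat) (delta : R) (A : set 'rV[R]_n) :
    \bar R :=
  ereal_inf [set (\sum_(k <oo) ediam (F k) ^+ s)%E |
             F in [set F : (set 'rV[R]_n)^nat |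
                   A `<=` \bigcup_k F k /\
                   forall k, (ediam (F k) <= delta%:E)%E]].

(* [s]-dimensional Hausdorff measure, for 0 < s, normalised so that it is the
   Lebesgue measure for s = n and the surface measure on (n-1)-dimensional
   Lipschitz surfaces for s = n - 1.  As a set function it is the Hausdorff
   outer measure; it is a measure on the Borel sets, by Caratheodory's
   criterion for metric outer measures. *)
Definition hausdorff_measure n (s : nat) (A : set (borel_rV n)) : \bar R :=
  ((unit_ball_volume s / 2 ^+ s)%:E *
   ereal_sup [set hausdorff_content s delta A |
              delta in [set delta : R | (0 < delta)%R]])%E.

Definition surface_measure n : set (borel_rV n) -> \bar R :=
  @hausdorff_measure n n.-1.

End SurfaceMeasure.

Arguments borel_rV : clear implicits.
Arguments surface_measure {R} n.

Section AnisotropicSobolev.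
Context {R : realType} {n : nat}.

Local Notation lambda := (@lebesgue_measure R).
Local Notation sigma := (@surface_measure R n).

(* All norms and seminorms below are squared and [\bar R]-valued, +oo
   encoding non-membership. *)

Definition L2_norm2 (omega : set (borel_rV R n)) (w : borel_rV R n -> R) :
    \bar R :=
  (\int[sigma]_(x in omega) (w x ^+ 2)%:E)%E.

Definition Hmu_seminorm2 (mu : R) (omega : set (borel_rV R n))
    (w : borel_rV R n -> R) : \bar R :=
  (\int[sigma]_(x in omega) \int[sigma]_(y in omega)
     ((w x - w y) ^+ 2 / (enorm (x - y) `^ (n.-1%:R + 2 * mu)))%:E)%E.

Definition Hmu_norm2 (mu : R) (omega : set (borel_rV R n))
    (w : borel_rV R n -> R) : \bar R :=
  (L2_norm2 omega w + Hmu_seminorm2 mu omega w)%E.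

(* For a space X of functions on R^n with squared (semi)norm [X2], the spaces
   L_2(J;X) and H^nu(J;X). *)

Definition L2J_norm2 (J : set R) (X2 : (borel_rV R n -> R) -> \bar R)
    (v : R -> borel_rV R n -> R) : \bar R :=
  (\int[lambda]_(t in J) X2 (v t))%E.

Definition HnuJ_seminorm2 (nu : R) (J : set R)
    (X2 : (borel_rV R n -> R) -> \bar R) (v : R -> borel_rV R n -> R) :
    \bar R :=
  (\int[lambda]_(t in J) \int[lambda]_(s in J)
     (X2 (fun x => (v t x - v s x)%R) *
      (`|t - s| `^ (1 + 2 * nu))^-1%:E))%E.

Definition HnuJ_norm2 (nu : R) (J : set R)
    (X2 : (borel_rV R n -> R) -> \bar R) (v : R -> borel_rV R n -> R) :
    \bar R :=
  (L2J_norm2 J X2 v + HnuJ_seminorm2 nu J X2 v)%E.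

Definition Hmunu_norm2 (mu nu : R) (J : set R) (omega : set (borel_rV R n))
    (v : R -> borel_rV R n -> R) : \bar R :=
  (L2J_norm2 J (Hmu_norm2 mu omega) v +
   HnuJ_norm2 nu J (L2_norm2 omega) v)%E.

(* L_2(J;L_2(omega)) is identified with L_2(J x omega): elements are
   represented by jointly measurable functions of (t, x). *)
Definition in_Hmunu (mu nu : R) (J : set R) (omega : set (borel_rV R n))
    (v : R -> borel_rV R n -> R) : Prop :=
  measurable_fun (J `*` omega) (fun z : R * borel_rV R n => v z.1 z.2) /\
  (Hmunu_norm2 mu nu J omega v < +oo)%E.

End AnisotropicSobolev.

Section PrismaticMesh.
Context {R : realType} {n : nat}.

Local Notation lambda := (@lebesgue_measure R).
Local Notation sigma := (@surface_measure R n).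

(* A prism J x K is given by its factors; since J and K are non-empty, they
   are determined by the product. *)
Definition prism : Type := (set R * set (borel_rV R n))%type.

Implicit Types (p q : prism) (P : set prism) (Gamma K : set (borel_rV R n)).

Definition prism_set p : set (R * borel_rV R n) := p.1 `*` p.2.

Definition prism_of (T : R) Gamma p : Prop :=
  (exists a b : R, [/\ 0 <= a, a <= b, b <= T & p.1 = `[a, b]%classic]) /\
  (exists (Khat : set 'rV[R]_n.-1) (phi : 'rV[R]_n.-1 -> 'rV[R]_n),
     [/\ compact_lipschitz_domain Khat, bilipschitz_on Khat phi,
         p.2 = phi @` Khat & p.2 `<=` Gamma]).

(* The last clause is Sigma = \bigcup P up to the endpoints of the time
   interval. *)
Definition prismatic_mesh (T : R) Gamma P : Prop :=
  [/\ finite_set P,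
      forall p, P p -> prism_of T Gamma p,
      forall p q, P p -> P q -> p <> q ->
        (lambda \x sigma)%E (prism_set p `&` prism_set q) = 0%E &
      (\bigcup_(p in P) prism_set p) `&` (`]0, T[%classic `*` setT) =
        `]0, T[%classic `*` Gamma].

Definition time_slice Gamma P (t : R) : set (set (borel_rV R n)) :=
  [set K | exists J, P (J, K) /\ ([set t] `*` Gamma) `&` (J `*` K) !=set0].

Definition space_slice (T : R) P (x : borel_rV R n) : set (set R) :=
  [set J | exists K,
     P (J, K) /\ (`[0, T]%classic `*` [set x]) `&` (J `*` K) !=set0].

Definition mesh_nei (T : R) Gamma P (Cnei : R) : Prop :=
  {ae lambda, forall t, `[0, T]%classic t ->
    forall K, time_slice Gamma P t K ->
      #|` fset_set [set K' | time_slice Gamma P t K' /\ K `&` K' !=set0]|%:R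
        <= Cnei}.

Definition mesh_dist (T : R) Gamma P (Cdist : R) : Prop :=
  {ae lambda, forall t, `[0, T]%classic t ->
    forall K K', time_slice Gamma P t K -> time_slice Gamma P t K' ->
      K `&` K' = set0 -> diam K <= Cdist * set_dist K K'}.

Definition mesh_lqu (T : R) Gamma P (Clqu : R) : Prop :=
  {ae sigma, forall x, Gamma x ->
    forall J J', space_slice T P x J -> space_slice T P x J' ->
      J `&` J' !=set0 -> (lambda J <= Clqu%:E * lambda J')%E}.

Definition mesh_seminorms (mu nu : R) P (v : R -> borel_rV R n -> R) :
    \bar R :=
  (\sum_(p \in P)
    (\sum_(q \in [set q | [/\ P q, 0 < lambda (p.1 `&` q.1) &
                              p.2 `&` q.2 !=set0]])
       L2J_norm2 (p.1 `&` q.1) (Hmu_seminorm2 mu (p.2 `|` q.2)) v +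
     \sum_(q \in [set q | [/\ P q, p.1 `&` q.1 !=set0 &
                              0 < sigma (p.2 `&` q.2)]])
       HnuJ_seminorm2 nu (p.1 `|` q.1) (L2_norm2 (p.2 `&` q.2)) v))%E.

Definition mesh_weighted_L2 (mu nu : R) P (v : R -> borel_rV R n -> R) :
    \bar R :=
  (\sum_(p \in P)
    ((diam p.2 `^ (- (2 * mu)) + fine (lambda p.1) `^ (- (2 * nu)))%:E *
     L2J_norm2 p.1 (L2_norm2 p.2) v))%E.

End PrismaticMesh.

Arguments prism : clear implicits.

(* Main.v *)
(* Both parts are proved by slicing: for almost every time t the cells of the
   mesh at time t decompose the boundary Gamma, and for almost every point x
   the time intervals at x decompose (0,T); Tonelli's theorem reduces
   everything to one Gagliardo seminorm on one measure space whose balls of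
   radius r have measure at most C r^s.
   The upper bound counts the pairs of touching pieces that see a given point:
   one of the two is the piece containing the point, so there are at most
   2 Cnei (in space) or 2 * 3 (in time) of them.
   For the lower bound, pairs (x, y) in touching pieces are covered by the local
   seminorms.  For x, y in non-touching pieces the distance is bounded below by
   a multiple of the size h of either piece, so |w x - w y|^2 <= 2 |w x|^2 +
   2 |w y|^2 and a dyadic decomposition of the kernel tail give
   h^(-2 mu) ||w||^2 on the piece.
   In time, non-touching intervals are separated by a neighbour of each of them,
   which is not much shorter by local quasi-uniformity.  The growth bound for
   the surface measure follows from the bi-Lipschitz parametrisations of the
   cells of any one mesh. *)

Require Import Defs.
From HB Require Import structures.
From mathcomp Require Import all_boot all_order all_algebra finmap.
From mathcomp Require Import all_classical all_reals all_analysis.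
From mathcomp Require Import measurable_realfun.
From mathcomp Require Import ring lra.

Import Order.TTheory GRing.Theory Num.Theory.
Import numFieldNormedType.Exports.

Set Implicit Arguments.
Unset Strict Implicit.
Unset Printing Implicit Defensive.

Local Open Scope classical_set_scope.
Local Open Scope ring_scope.

(** * Gagliardo seminorms and their localization *)

(** The surface measure is given as a Hausdorff set function on all of R^n, where it is not
    sigma-finite, while every step rests on Tonelli. So it is shown to be a Borel measure by
    Caratheodory's criterion and then restricted to Gamma, where it is finite. Time is restricted to
    (0,T) likewise, and v, measurable only on (0,T) x Gamma, is extended by zero. The lower
    Lipschitz bound of the parametrisations gives every cell positive surface measure, by comparison
    with Lebesgue measure in dimension 1 or 2. This is needed because [mesh_nei] counts cells,
    whereas the sums run over prisms: two prisms over one cell, active at the same generic time, are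
    excluded only if the cell is not null. In a slice, touching concerns one factor only; the sums
    of the theorem also ask the other factors to overlap in positive measure. The two relations
    differ on null sets of slices. The seminorms do not see constants, so the L_2 part of the lower
    bound comes from the weights alone, through |J| <= T. *)

Section real_tail.
Context {R : realType}.

Lemma sum_geometric_le (z : R) N : 0 <= z < 1 -> \sum_(0 <= k < N) z ^+ k <= (1 - z)^-1.
Proof.
move=> /andP[z0 z1]; have z1' : 0 < 1 - z by rewrite subr_gt0.
rewrite -[leRHS]div1r ler_pdivlMr// big_mkord.
have := subrX1 z N; have := exprn_ge0 N z0; lra.
Qed.

Lemma dyadic_bracket (delta rho : R) : 0 < delta -> delta <= rho ->
  exists k : nat, 2 ^+ k * delta <= rho <= 2 ^+ k.+1 * delta.
Proof.
move=> d0 drho.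
have ex : exists k, rho <= 2 ^+ k.+1 * delta.
  (* Some exponent is large enough because [k < 2 ^ k]; the least one gives the bracket. *)
  exists (Num.truncn (rho / delta)); rewrite -ler_pdivrMr//.
  apply/ltW/(lt_le_trans (truncnS_gt _)); rewrite -natrX ler_nat.
  exact/ltnW/ltn_expl.
case: (ex_minnP ex) => -[|k] rk kmin; first by exists 0%N; rewrite expr0 mul1r drho.
exists k.+1; rewrite rk andbT leNgt; apply/negP => /ltW/kmin.
by rewrite ltnn.
Qed.

Lemma powRN_nincr (a b q : R) : 0 < a -> a <= b -> 0 <= q -> b `^ (- q) <= a `^ (- q).
Proof.
move=> a0 ab q0; rewrite !powRN lef_pV2 ?posrE ?powR_gt0// ?(lt_le_trans a0)//.
by apply: ge0_ler_powR => //; rewrite nnegrE ltW// (lt_le_trans a0).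
Qed.

End real_tail.

(** * Iterated integrals of nonnegative functions on a square *)

Section double_integral.
Local Open Scope ereal_scope.
Context d (T : measurableType d) (R : realType).
Variable m : {sigma_finite_measure set T -> \bar R}.
Implicit Types f g : T * T -> R.

Definition dint f : \bar R := \int[m]_x \int[m]_y (f (x, y))%:E.

Lemma measurable_dint_inner f : measurable_fun setT f -> (forall z, 0 <= f z)%R ->
  measurable_fun setT (fun x => \int[m]_y (f (x, y))%:E).
Proof.
move=> mf f0; apply: (measurable_fun_fubini_tonelli_F (EFin \o f)).
  exact/measurable_EFinP.
by move=> z; rewrite lee_fin.
Qed.

Lemma measurable_slice f x : measurable_fun setT f -> measurable_fun setT (fun y => (f (x, y))%:E).
Proof. by move=> mf; apply/measurable_EFinP; apply: (measurableT_comp mf). Qed.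

Lemma dint_inner_ge0 f x : (forall z, 0 <= f z)%R -> 0 <= \int[m]_y (f (x, y))%:E.
Proof. by move=> f0; apply: integral_ge0 => y _; rewrite lee_fin. Qed.

(** The exceptional sets are nested, one in x and then one in y for each x, because the localization
    applies its covering hypothesis to x and to y separately. *)
Lemma le_dint f g : measurable_fun setT f -> measurable_fun setT g ->
  (forall z, 0 <= f z)%R -> (forall z, 0 <= g z)%R ->
  {ae m, forall x, {ae m, forall y, f (x, y) <= g (x, y)}%R} ->
  dint f <= dint g.
Proof.
move=> mf mg f0 g0 fg.
apply: ae_ge0_le_integral => //.
- by move=> x _; exact: dint_inner_ge0.
- exact: measurable_dint_inner.
- by move=> x _; exact: dint_inner_ge0.
- exact: measurable_dint_inner.
apply: filterS fg => x fgx _; apply: ae_ge0_le_integral => //.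
- by move=> y _; rewrite lee_fin.
- exact: measurable_slice.
- by move=> y _; rewrite lee_fin.
- exact: measurable_slice.
by apply: filterS fgx => y fgy _; rewrite lee_fin.
Qed.

Lemma dintD f g : measurable_fun setT f -> measurable_fun setT g ->
  (forall z, 0 <= f z)%R -> (forall z, 0 <= g z)%R ->
  dint (fun z => f z + g z)%R = dint f + dint g.
Proof.
move=> mf mg f0 g0; rewrite /dint -ge0_integralD//; last 4 first.
- by move=> x _; exact: dint_inner_ge0.
- exact: measurable_dint_inner.
- by move=> x _; exact: dint_inner_ge0.
- exact: measurable_dint_inner.
apply: eq_integral => x _; rewrite -ge0_integralD//.
- by move=> y _; rewrite lee_fin.
- exact: measurable_slice.
- by move=> y _; rewrite lee_fin.
- exact: measurable_slice.
Qed.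

Lemma dint_sum (I : Type) (r : seq I) (f : I -> T * T -> R) :
  (forall i, measurable_fun setT (f i)) -> (forall i z, 0 <= f i z)%R ->
  dint (fun z => \sum_(i <- r) f i z)%R = \sum_(i <- r) dint (f i).
Proof.
move=> mf f0; elim: r => [|i r IH].
  rewrite big_nil; apply: integral0_eq => x _; apply: integral0_eq => y _.
  by rewrite big_nil.
have msum : measurable_fun setT (fun z => \sum_(j <- r) f j z)%R by exact: measurable_sum.
have sum0 z : (0 <= \sum_(j <- r) f j z)%R by apply: sumr_ge0 => j _; exact: f0.
rewrite big_cons -IH -(dintD (mf i) msum (f0 i) sum0).
by apply: eq_integral => x _; apply: eq_integral => y _; rewrite big_cons.
Qed.

Lemma dint_swap f : measurable_fun setT f -> (forall z, 0 <= f z)%R ->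
  dint (fun z => f (z.2, z.1)) = dint f.
Proof.
move=> mf f0; rewrite /dint.
rewrite (fubini_tonelli (m1 := m) (m2 := m) (fun z => (f z)%:E))//.
exact/measurable_EFinP.
Qed.

End double_integral.

(** * Gagliardo seminorms for a measure whose balls of radius r have mass at most Cb r^s *)

Section gagliardo.
Local Open Scope ereal_scope.
Context d (T : measurableType d) (R : realType).
Variable m : {sigma_finite_measure set T -> \bar R}.
Variables (dist : T -> T -> R) (s : nat) (mu Cb : R).
Hypothesis mdist : measurable_fun setT (fun z : T * T => dist z.1 z.2).
Hypothesis distC : forall x y, dist x y = dist y x.
Hypothesis mu0 : (0 < mu)%R.
Hypothesis Cb0 : (0 <= Cb)%R.
Hypothesis ball_bound : forall x r, (0 < r)%R ->
  m [set y | dist x y <= r]%R <= (Cb * r ^+ s)%:E.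

(** With [s = n - 1] this is the exponent of the kernel on the boundary, with [s = 1] that of the
    kernel in time; [s] is the growth exponent of [ball_bound]. *)
Definition kernel_exponent : R := (s%:R + 2 * mu)%R.
Local Notation q := kernel_exponent.

Definition difference_quotient (w : T -> R) (z : T * T) : R :=
  ((w z.1 - w z.2) ^+ 2 / (dist z.1 z.2 `^ q))%R.

Definition seminorm2 (A : set T) (w : T -> R) : \bar R :=
  \int[m]_(x in A) \int[m]_(y in A) (difference_quotient w (x, y))%:E.

(** Value of a geometric series: the k-th dyadic shell beyond delta has mass at most
    [Cb (2^(k+1) delta)^s] and kernel at most [(2^k delta)^(-s - 2 mu)], with product
    [Cb 2^s delta^(-2 mu) (2^(-2 mu))^k]. *)
Definition tail_const : R := (Cb * 2 ^+ s / (1 - 2 `^ (- (2 * mu))))%R.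

Lemma kernel_exponent_ge0 : (0 <= q)%R.
Proof. by rewrite /q addr_ge0// mulr_ge0// ltW. Qed.

Lemma tail_ratio : (0 <= (2 : R) `^ (- (2 * mu)) < 1)%R.
Proof.
rewrite powR_ge0/= powRN invf_lt1 ?powR_gt0//.
have mu2 : (0 < 2 * mu)%R by rewrite mulr_gt0.
have := @gt0_ltr_powR R _ mu2 1%R 2%R; rewrite powR1 !nnegrE; apply => //.
by rewrite ltr1n.
Qed.

Lemma tail_const_ge0 : (0 <= tail_const)%R.
Proof.
have /andP[_ z1] := tail_ratio.
by rewrite divr_ge0 ?mulr_ge0 ?exprn_ge0// subr_ge0 ltW.
Qed.

Lemma measurable_dist_slice x : measurable_fun setT (dist x).
Proof. exact: (measurableT_comp mdist (pair1_measurable x)). Qed.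

Lemma measurable_kernel : measurable_fun setT (fun z : T * T => (dist z.1 z.2 `^ q)^-1)%R.
Proof.
under eq_fun do rewrite -powRN.
exact: (measurableT_comp (measurable_powR _)).
Qed.

Lemma measurable_difference_quotient w : measurable_fun setT w ->
  measurable_fun setT (difference_quotient w).
Proof.
move=> mw; apply: measurable_funM; last exact: measurable_kernel.
apply: measurable_funX; apply: measurable_funB; exact: (measurableT_comp mw).
Qed.

Lemma difference_quotient_ge0 w z : (0 <= difference_quotient w z)%R.
Proof. by rewrite divr_ge0 ?sqr_ge0// powR_ge0. Qed.

Definition far (delta : R) (z : T * T) : R := ((delta <= dist z.1 z.2)%R : nat)%:R.

Lemma measurable_far delta : measurable_fun setT (far delta).
Proof.
rewrite (_ : far delta = \1_[set z | (delta <= dist z.1 z.2)%R]); last first.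
  by apply/funext => z; rewrite /far indicE mem_setE.
apply: measurable_indic; rewrite -[X in measurable X]setTI.
exact: (measurable_fun_ler (measurable_cst delta) mdist).
Qed.

Lemma kernel_tail x (delta : R) : (0 < delta)%R ->
  \int[m]_y (far delta (x, y) * (dist x y `^ q)^-1)%:E <=
    (tail_const * delta `^ (- (2 * mu)))%:E.
Proof.
move=> d0.
have q0 := kernel_exponent_ge0.
have mB r : measurable [set y | (dist x y <= r)%R].
  rewrite -[X in measurable X]setTI.
  exact: (measurable_fun_ler (measurable_dist_slice x) (measurable_cst r)).
(* [u k] bounds the kernel on the k-th dyadic shell; the shell itself is enlarged to the ball [B k],
   whose mass [ball_bound] controls. *)
pose u k : R := ((2 ^+ k * delta) `^ (- q))%R.
have u0 k : (0 <= u k)%R by exact: powR_ge0.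
pose B k := [set y | (dist x y <= 2 ^+ k.+1 * delta)%R].
pose h k y : \bar R := (u k * \1_(B k) y)%:E.
have h0 k y : 0 <= h k y by rewrite lee_fin mulr_ge0.
have mh k : measurable_fun setT (h k).
  apply/measurable_EFinP; apply: measurable_funM => //.
  by apply: measurable_indic; exact: mB.
apply: (@le_trans _ _ (\int[m]_y \sum_(k <oo) h k y)).
  apply: ge0_le_integral => //.
  - by move=> y _; rewrite lee_fin mulr_ge0 ?invr_ge0 ?powR_ge0.
  - apply/measurable_EFinP; apply: measurable_funM.
      exact: (measurableT_comp (measurable_far delta)).
    exact: (measurableT_comp measurable_kernel (pair1_measurable x)).
  - by apply: ge0_emeasurable_sum.
  move=> y _; rewrite /far/=; have [dy|_] := leP delta (dist x y); last first.
    by rewrite mul0r; apply: nneseries_ge0.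
  have [k /andP[k1 k2]] := dyadic_bracket d0 dy.
  apply: (@le_trans _ _ (h k y)).
    rewrite /h indicE mem_set// mulr1 mul1r lee_fin -powRN.
    by apply: powRN_nincr => //; rewrite mulr_gt0// exprn_gt0.
  apply: le_trans (nneseries_lim_ge k.+1 _) => //.
  by rewrite big_nat_recr//= leeDr// sume_ge0.
rewrite integral_nneseries//.
apply: lime_le.
  by apply: is_cvg_nneseries => k _ _; exact: integral_ge0.
apply: nearW => N.
pose z : R := (2 `^ (- (2 * mu)))%R.
apply: (@le_trans _ _ (\sum_(0 <= k < N) (Cb * 2 ^+ s * delta `^ (- (2 * mu)) * z ^+ k)%:E)).
  apply: lee_sum => k _.
  rewrite /h; under eq_integral do rewrite EFinM.
  rewrite ge0_integralZl_EFin//; last first.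
    by apply/measurable_EFinP; apply: measurable_indic; exact: mB.
  rewrite integral_indic// ?setIT; last exact: mB.
  have k0 : (0 < 2 ^+ k * delta)%R by rewrite mulr_gt0// exprn_gt0.
  apply: (@le_trans _ _ ((u k)%:E * (Cb * (2 ^+ k.+1 * delta) ^+ s)%:E)).
    apply: lee_wpmul2l; first by rewrite lee_fin.
    by apply: ball_bound; rewrite mulr_gt0// exprn_gt0.
  rewrite -EFinM lee_fin /u exprS -mulrA (exprMn s 2%R).
  have powq (X : R) : (0 < X)%R -> (X `^ (- q) = (X ^+ s)^-1 * X `^ (- (2 * mu)))%R.
    move=> X0; rewrite /q opprD powRD; last by rewrite (gt_eqF X0) implybT.
    by congr (_ * _)%R; rewrite powRN powR_mulrn// ltW.
  have powz : ((2 ^+ k * delta) `^ (- (2 * mu)) = z ^+ k * delta `^ (- (2 * mu)))%R.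
    rewrite powRM ?exprn_ge0 ?ltW//; congr (_ * _)%R.
    rewrite /z -(powR_mulrn k (powR_ge0 _ _)) -(powR_mulrn k (ler0n R 2)).
    by rewrite -!powRrM mulrC.
  rewrite powq// powz le_eqVlt; apply/orP; left; apply/eqP.
  have : ((2 ^+ k * delta) ^+ s != 0)%R by rewrite gt_eqF// exprn_gt0.
  set a := ((2 ^+ k * delta) ^+ s)%R; set b := (2 ^+ s)%R; set c := (z ^+ k)%R; move=> a0.
  by field.
rewrite sumEFin lee_fin -mulr_sumr /tail_const -/z.
rewrite -!mulrA ler_wpM2l// ler_wpM2l ?exprn_ge0// mulrC ler_wpM2r ?powR_ge0//.
exact/sum_geometric_le/tail_ratio.
Qed.

Lemma seminorm2_dint A w : seminorm2 A w =
  dint m (fun z => \1_A z.1 * \1_A z.2 * difference_quotient w z)%R.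
Proof.
rewrite /seminorm2 /dint integral_mkcond; apply: eq_integral => x _.
rewrite patchE; case: ifPn => xA; last first.
  rewrite integral0_eq// => y _.
  by rewrite indicE (negbTE xA) !mul0r.
rewrite integral_mkcond; apply: eq_integral => y _.
rewrite patchE !indicE xA mul1r/=; case: ifPn => yA; first by rewrite mul1r.
by rewrite mul0r.
Qed.

Lemma seminorm2_ge0 A w : 0 <= seminorm2 A w.
Proof.
by apply: integral_ge0 => x _; apply: integral_ge0 => y _; rewrite lee_fin difference_quotient_ge0.
Qed.

(** * Local seminorms over pairs of touching pieces against the global seminorm *)

Section localization.
Context (I : eqType) (r : seq I) (c : rel I) (A : I -> set T) (w : T -> R).
Hypothesis mA : forall i, measurable (A i).
Hypothesis mw : measurable_fun setT w.

Let pair_term i j (z : T * T) : R :=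
  (\1_(A i `|` A j) z.1 * \1_(A i `|` A j) z.2 * difference_quotient w z)%R.

Let pair_term_ge0 i j z : (0 <= pair_term i j z)%R.
Proof. by apply: mulr_ge0; [rewrite mulr_ge0|exact: difference_quotient_ge0]. Qed.

Let mpair_term i j : measurable_fun setT (pair_term i j).
Proof.
have mI : measurable_fun setT (\1_(A i `|` A j) : T -> R).
  by apply: measurable_indic; exact: measurableU.
apply: measurable_funM; last exact: measurable_difference_quotient.
by apply: measurable_funM; exact: (measurableT_comp mI).
Qed.

Let local_sum (z : T * T) : R :=
  (\sum_(i <- r) \sum_(j <- r | c i j) pair_term i j z)%R.

Let mlocal_sum : measurable_fun setT local_sum.
Proof.
apply: measurable_sum => i; under eq_fun do rewrite -big_filter.
exact: measurable_sum.
Qed.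

Let local_sum_ge0 z : (0 <= local_sum z)%R.
Proof. by apply: sumr_ge0 => i _; apply: sumr_ge0. Qed.

Let sum_seminorm2_dint :
  \sum_(i <- r) \sum_(j <- r | c i j) seminorm2 (A i `|` A j) w = dint m local_sum.
Proof.
rewrite dint_sum => [|i|i z].
- apply: eq_bigr => i _; rewrite -big_filter.
  transitivity (dint m (fun z => \sum_(j <- [seq j <- r | c i j]) pair_term i j z)%R).
    rewrite (dint_sum m _ (mpair_term i) (pair_term_ge0 i)).
    by apply: eq_bigr => j _; rewrite seminorm2_dint.
  by congr (dint m _); apply/funext => z; rewrite big_filter.
- by under eq_fun do rewrite -big_filter; exact: measurable_sum.
- exact: sumr_ge0.
Qed.

(** Of the two indicators in each local term the one at y is dropped, so that overlaps are counted
    at x alone. *)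
Lemma sum_seminorm2_le (N : R) : (0 <= N)%R ->
  {ae m, forall x, \sum_(i <- r) \sum_(j <- r | c i j) \1_(A i `|` A j) x <= N}%R ->
  \sum_(i <- r) \sum_(j <- r | c i j) seminorm2 (A i `|` A j) w <=
    N%:E * seminorm2 setT w.
Proof.
move=> N0 countN; rewrite sum_seminorm2_dint.
have mdq := measurable_difference_quotient mw.
have -> : N%:E * seminorm2 setT w = dint m (fun z => N * difference_quotient w z)%R.
  rewrite /seminorm2 /dint -ge0_integralZl_EFin//; last 2 first.
  - by move=> x _; apply: dint_inner_ge0; exact: difference_quotient_ge0.
  - by apply: measurable_dint_inner => //; exact: difference_quotient_ge0.
  apply: eq_integral => x _; under [RHS]eq_integral do rewrite EFinM.
  rewrite ge0_integralZl_EFin//.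
  - by move=> y _; rewrite lee_fin difference_quotient_ge0.
  - exact: measurable_slice.
apply: le_dint => //.
- exact: measurable_funM.
- by move=> z; apply: mulr_ge0 => //; exact: difference_quotient_ge0.
apply: filterS countN => x countx; apply: aeW => y.
apply: (@le_trans _ _ ((\sum_(i <- r) \sum_(j <- r | c i j) \1_(A i `|` A j) x) *
    difference_quotient w (x, y))%R); last first.
  by rewrite ler_wpM2r// difference_quotient_ge0.
rewrite mulr_suml; apply: ler_sum => i _; rewrite mulr_suml; apply: ler_sum => j _.
rewrite /pair_term/= ler_wpM2r ?difference_quotient_ge0//.
by rewrite ler_piMr// indicE lern1 leq_b1.
Qed.

Variable h : I -> R.
Hypothesis h0 : forall i, i \in r -> (0 < h i)%R.

Let far_term i (z : T * T) : R :=
  (\1_(A i) z.1 * (2 * w z.1 ^+ 2) * (far (h i) z * (dist z.1 z.2 `^ q)^-1))%R.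

Let far_coef_ge0 i x : (0 <= \1_(A i) x * (2 * w x ^+ 2))%R.
Proof. by apply: mulr_ge0 => //; apply: mulr_ge0 => //; exact: sqr_ge0. Qed.

Let far_kernel_ge0 i z : (0 <= far (h i) z * (dist z.1 z.2 `^ q)^-1)%R.
Proof. by apply: mulr_ge0 => //; rewrite invr_ge0 powR_ge0. Qed.

Let far_term_ge0 i z : (0 <= far_term i z)%R.
Proof. exact: mulr_ge0. Qed.

Let mfar_coef i : measurable_fun setT (fun x => \1_(A i) x * (2 * w x ^+ 2))%R.
Proof.
apply: measurable_funM; first exact: measurable_indic.
by apply: measurable_funM => //; exact: measurable_funX.
Qed.

Let mfar_kernel i : measurable_fun setT (fun z => far (h i) z * (dist z.1 z.2 `^ q)^-1)%R.
Proof. apply: measurable_funM; [exact: measurable_far|exact: measurable_kernel]. Qed.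

Let mfar_term i : measurable_fun setT (far_term i).
Proof. by apply: measurable_funM => //; exact: (measurableT_comp (mfar_coef i)). Qed.

Let dint_far_term i : i \in r -> dint m (far_term i) <=
  (2 * tail_const * h i `^ (- (2 * mu)))%:E * \int[m]_(x in A i) (w x ^+ 2)%:E.
Proof.
move=> ir.
apply: (@le_trans _ _ (\int[m]_x ((\1_(A i) x * (2 * w x ^+ 2))%:E *
    (tail_const * h i `^ (- (2 * mu)))%:E))).
  apply: ge0_le_integral => //.
  - by move=> x _; apply: dint_inner_ge0.
  - exact: measurable_dint_inner.
  - by apply: emeasurable_funM => //; apply/measurable_EFinP.
  move=> x _; rewrite /far_term/=; under eq_integral do rewrite EFinM.
  rewrite ge0_integralZl_EFin//; last 2 first.
  - by move=> y _; rewrite lee_fin; exact: (far_kernel_ge0 i (x, y)).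
  - apply/measurable_EFinP.
    exact: (measurableT_comp (mfar_kernel i) (pair1_measurable x)).
  apply: lee_wpmul2l; first by rewrite lee_fin.
  by apply: kernel_tail; exact: h0.
rewrite le_eqVlt; apply/orP; left; apply/eqP.
rewrite ge0_integralZr//; last 3 first.
- by apply/measurable_EFinP.
- by move=> x _; rewrite lee_fin.
- by rewrite lee_fin mulr_ge0 ?powR_ge0// tail_const_ge0.
rewrite (_ : \int[m]_x _ = 2%:E * \int[m]_(x in A i) (w x ^+ 2)%:E).
  by rewrite muleAC -EFinM mulrA.
rewrite [in RHS]integral_mkcond -ge0_integralZl_EFin//.
- apply: eq_integral => x _; rewrite patchE indicE; case: ifPn => _.
    by rewrite mul1r EFinM.
  by rewrite mul0r mule0.
- by move=> x _; rewrite patchE; case: ifPn => // _; rewrite lee_fin sqr_ge0.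
- apply/(measurable_restrictT _ (mA i)) => //; apply: measurable_funTS.
  by apply/measurable_EFinP; exact: measurable_funX.
Qed.

(** A pair (x, y) in pieces i and j unrelated by [c] is charged to [far_term i] at (x, y) and to
    [far_term j] at (y, x). The factor 4 collects the 2 of [(a - b)^2 <= 2 a^2 + 2 b^2] and the 2
    from the swapped copy, whose integral is the same. *)
Lemma seminorm2_le_local :
  {ae m, forall x, exists2 i, i \in r & A i x} ->
  (forall i j x y, i \in r -> j \in r -> ~~ c i j -> A i x -> A j y ->
     (h i <= dist x y) /\ (h j <= dist x y))%R ->
  seminorm2 setT w <=
    \sum_(i <- r) \sum_(j <- r | c i j) seminorm2 (A i `|` A j) w +
    \sum_(i <- r) (4 * tail_const * h i `^ (- (2 * mu)))%:E *
      \int[m]_(x in A i) (w x ^+ 2)%:E.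
Proof.
move=> cover sep; rewrite sum_seminorm2_dint.
pose F z := (\sum_(i <- r) far_term i z)%R.
have F0 z : (0 <= F z)%R by exact: sumr_ge0.
have mF : measurable_fun setT F by exact: measurable_sum.
have mFs : measurable_fun setT (fun z => F (z.2, z.1)).
  exact: (measurableT_comp mF (measurable_fun_pair measurable_snd measurable_fst)).
have dintF : dint m F <= \sum_(i <- r) (2 * tail_const * h i `^ (- (2 * mu)))%:E *
      \int[m]_(x in A i) (w x ^+ 2)%:E.
  rewrite dint_sum// big_seq [leRHS]big_seq.
  by apply: lee_sum => i; exact: dint_far_term.
apply: (@le_trans _ _ (dint m (fun z => local_sum z + (F z + F (z.2, z.1)))%R)).
  apply: le_dint => //.
  - exact: measurable_difference_quotient.
  - by apply: measurable_funD => //; exact: measurable_funD.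
  - by move=> z; exact: difference_quotient_ge0.
  - by move=> z; rewrite !addr_ge0.
  apply: filterS (cover) => x [i ir Aix]; apply: filterS (cover) => y [j jr Ajy].
  have [cij|cij] := boolP (c i j).
    rewrite -[leLHS]addr0 lerD//; last by rewrite addr_ge0.
    rewrite /local_sum (big_rem i)//= (big_rem j)//= cij.
    rewrite /pair_term/= !indicE !mem_set ?mul1r; [|by right|by left].
    rewrite -addrA lerDl addr_ge0// ?sumr_ge0// => k _.
      exact: (pair_term_ge0 i k (x, y)).
    by apply: sumr_ge0 => l _; exact: (pair_term_ge0 k l (x, y)).
  have [hi hj] := sep _ _ _ _ ir jr cij Aix Ajy.
  have -> : difference_quotient w (x, y) = ((w x - w y) ^+ 2 / (dist x y `^ q))%R by [].
  apply: (@le_trans _ _ (far_term i (x, y) + far_term j (y, x))%R).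
    rewrite /far_term/= !indicE !mem_set// !mul1r /far/= (distC y x) hi hj !mul1r.
    rewrite -mulrDl ler_wpM2r ?invr_ge0 ?powR_ge0//.
    have := sqr_ge0 (w x + w y); rewrite sqrrD sqrrB; lra.
  rewrite -[leLHS]add0r lerD//; apply: lerD.
    by rewrite /F (big_rem i)//= lerDl sumr_ge0.
  by rewrite /F (big_rem j)//= lerDl sumr_ge0.
rewrite !dintD//; last 2 first.
- exact: measurable_funD.
- by move=> z; rewrite addr_ge0.
apply: leeD => //; rewrite dint_swap//.
apply: (le_trans (leeD dintF dintF)); rewrite -big_split/=.
rewrite le_eqVlt; apply/orP; left; apply/eqP; apply: eq_bigr => i _.
have a0 : (0 <= 2 * tail_const * h i `^ (- (2 * mu)))%R.
  by rewrite mulr_ge0 ?powR_ge0// mulr_ge0// tail_const_ge0.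
rewrite -ge0_muleDl ?lee_fin// -EFinD.
by congr (_%:E * _); ring.
Qed.

End localization.

End gagliardo.

(** * Slicing *)

Section slicing.
Local Open Scope ereal_scope.
Context dA (TA : measurableType dA) d (T : measurableType d) (R : realType).
Variable mA : {sigma_finite_measure set TA -> \bar R}.
Variable m : {sigma_finite_measure set T -> \bar R}.
Variables (dist : T -> T -> R) (s : nat) (mu Cb : R).
Hypothesis mdist : measurable_fun setT (fun z : T * T => dist z.1 z.2).
Hypothesis distC : forall x y, dist x y = dist y x.
Hypothesis mu0 : (0 < mu)%R.
Hypothesis Cb0 : (0 <= Cb)%R.
Hypothesis ball_bound : forall x r, (0 < r)%R ->
  m [set y | dist x y <= r]%R <= (Cb * r ^+ s)%:E.
Variable u : TA -> T -> R.
Hypothesis hu : measurable_fun setT (fun z : TA * T => u z.1 z.2).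

Local Notation semi := (seminorm2 m dist s mu).

Let mua a : measurable_fun setT (u a).
Proof. exact: (measurableT_comp hu (pair1_measurable a)). Qed.

Lemma measurable_seminorm2_slice V : measurable V ->
  measurable_fun setT (fun a => semi V (u a)).
Proof.
move=> mV.
(* As a function of the slice, x and y jointly, the integrand stays measurable in the slice after y
   and then x are integrated out. *)
pose F (z : (TA * T) * T) : R := (\1_V z.1.2 * \1_V z.2 *
  ((u z.1.1 z.1.2 - u z.1.1 z.2) ^+ 2 * (dist z.1.2 z.2 `^ kernel_exponent s mu)^-1))%R.
have F0 z : (0 <= F z)%R.
  apply: mulr_ge0; first exact: mulr_ge0.
  by apply: mulr_ge0; rewrite ?sqr_ge0// invr_ge0 powR_ge0.
have m11 : measurable_fun setT (fun z : (TA * T) * T => z.1.1).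
  exact: (measurableT_comp measurable_fst measurable_fst).
have m12 : measurable_fun setT (fun z : (TA * T) * T => z.1.2).
  exact: (measurableT_comp measurable_snd measurable_fst).
have m2 : measurable_fun setT (fun z : (TA * T) * T => z.2) by exact: measurable_snd.
have mF : measurable_fun setT F.
  have mI : measurable_fun setT (\1_V : T -> R) by exact: measurable_indic.
  apply: measurable_funM.
    by apply: measurable_funM; [exact: (measurableT_comp mI m12)|exact: (measurableT_comp mI m2)].
  apply: measurable_funM.
    apply: measurable_funX; apply: measurable_funB.
      exact: (measurableT_comp hu (measurable_fun_pair m11 m12)).
    exact: (measurableT_comp hu (measurable_fun_pair m11 m2)).
  exact: (measurableT_comp (measurable_kernel s mu mdist) (measurable_fun_pair m12 m2)).
have mG : measurable_fun setT (fun z : TA * T => \int[m]_y (F (z, y))%:E).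
  apply: (measurable_fun_fubini_tonelli_F (EFin \o F)).
    exact/measurable_EFinP.
  by move=> z; rewrite lee_fin.
rewrite (_ : (fun a => _) = (fun a => \int[m]_x \int[m]_y (F ((a, x), y))%:E)).
  apply: (measurable_fun_fubini_tonelli_F (fun z : TA * T => \int[m]_y (F (z, y))%:E)) => //.
  by move=> z; apply: integral_ge0 => y _; rewrite lee_fin.
by apply/funext => a; rewrite seminorm2_dint.
Qed.

Context (I : eqType) (r : seq I) (U : I -> set TA) (V : I -> set T).
Hypothesis mU : forall i, measurable (U i).
Hypothesis mV : forall i, measurable (V i).
Variables c c' : rel I.
Hypothesis c'c : forall i j, c' i j -> c i j.
Hypothesis cN : forall i j, i \in r -> j \in r -> c i j -> ~~ c' i j -> mA (U i `&` U j) = 0.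

Definition active a := [seq i <- r | a \in U i].

Let S i j a := semi (V i `|` V j) (u a).

Let S0 i j a : 0 <= S i j a.
Proof. exact: seminorm2_ge0. Qed.

Let mS i j : measurable_fun setT (S i j).
Proof. by apply: measurable_seminorm2_slice; exact: measurableU. Qed.

Let mUU i j : measurable (U i `&` U j).
Proof. exact: measurableI. Qed.

Let pair_integral i j : i \in r -> j \in r ->
  \int[mA]_a (if c i j then (S i j \_ (U i `&` U j)) a else 0) =
  (if c' i j then \int[mA]_(a in U i `&` U j) S i j a else 0).
Proof.
move=> ir jr; have [cij|ncij] := boolP (c i j); last first.
  rewrite integral0_eq//; case: ifP => // /c'c.
  by rewrite (negbTE ncij).
rewrite -integral_mkcond; case: ifP => // /negbT/(cN ir jr cij) N0.
rewrite (ge0_negligible_integral (N := U i `&` U j)) ?setDv ?integral_set0//.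
exact: measurable_funTS.
Qed.

Let active_sum a : \sum_(i <- active a) \sum_(j <- active a | c i j) S i j a =
  \sum_(i <- r) \sum_(j <- r) (if c i j then (S i j \_ (U i `&` U j)) a else 0).
Proof.
rewrite /active big_filter big_mkcond; apply: eq_bigr => i _.
rewrite big_filter_cond [in LHS]big_mkcond; case: ifPn => aUi; last first.
  by rewrite big1// => j _; case: ifP => // _; rewrite patchE in_setI (negbTE aUi).
apply: eq_bigr => j _; rewrite patchE in_setI aUi/=.
by case: (c i j); case: (a \in U j).
Qed.

Let mterm i j : measurable_fun setT
  (fun a => if c i j then (S i j \_ (U i `&` U j)) a else 0).
Proof.
case: (c i j); last exact: measurable_cst.
by apply/(measurable_restrictT _ (mUU i j)) => //; apply: measurable_funTS.
Qed.

Let term_ge0 i j a : 0 <= (if c i j then (S i j \_ (U i `&` U j)) a else 0).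
Proof. by case: ifP => // _; rewrite patchE; case: ifP. Qed.

(** A slice selects pairs by [c] alone. Integrating over the slices loses exactly the pairs whose
    factors [U i], [U j] meet in a null set, and by [cN] these include all pairs in [c] but not in
    [c']. *)
Lemma integral_active_sum :
  \int[mA]_a (\sum_(i <- active a) \sum_(j <- active a | c i j) S i j a) =
  \sum_(i <- r) \sum_(j <- r | c' i j) \int[mA]_(a in U i `&` U j) S i j a.
Proof.
under eq_integral do rewrite active_sum.
rewrite ge0_integral_sum//; last 2 first.
- by move=> i; exact: emeasurable_sum.
- by move=> i a _; apply: sume_ge0.
rewrite big_seq [RHS]big_seq; apply: eq_bigr => i ir.
rewrite ge0_integral_sum// [RHS]big_mkcond [LHS]big_seq [RHS]big_seq.
by apply: eq_bigr => j jr; exact: pair_integral.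
Qed.

Let measurable_active_sum : measurable_fun setT
  (fun a => \sum_(i <- active a) \sum_(j <- active a | c i j) S i j a).
Proof.
under eq_fun do rewrite active_sum.
by apply: emeasurable_sum => i; exact: emeasurable_sum.
Qed.

Let active_sum_ge0 a : 0 <= \sum_(i <- active a) \sum_(j <- active a | c i j) S i j a.
Proof. by apply: sume_ge0 => i _; apply: sume_ge0. Qed.

Lemma slice_sum_le (N : R) : (0 <= N)%R ->
  {ae mA, forall a, {ae m, forall x,
    \sum_(i <- active a) \sum_(j <- active a | c i j) \1_(V i `|` V j) x <= N}%R} ->
  \sum_(i <- r) \sum_(j <- r | c' i j)
     \int[mA]_(a in U i `&` U j) semi (V i `|` V j) (u a) <=
    N%:E * \int[mA]_a semi setT (u a).
Proof.
move=> N0 countN; rewrite -integral_active_sum -ge0_integralZl_EFin//; last 2 first.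
- by move=> a _; exact: seminorm2_ge0.
- exact: measurable_seminorm2_slice.
apply: ae_ge0_le_integral => //.
- by move=> a _; rewrite mule_ge0// seminorm2_ge0.
- by apply: emeasurable_funM => //; exact: measurable_seminorm2_slice.
by apply: filterS countN => a counta _; apply: sum_seminorm2_le.
Qed.

Variable h : I -> R.

Let L2slice i a := \int[m]_(x in V i) (u a x ^+ 2)%:E.

Let L2slice_ge0 i a : 0 <= L2slice i a.
Proof. by apply: integral_ge0 => x _; rewrite lee_fin sqr_ge0. Qed.

Let mL2slice i : measurable_fun setT (L2slice i).
Proof.
rewrite /L2slice; under eq_fun do rewrite integral_mkcond.
apply: (measurable_fun_fubini_tonelli_F
  (fun z : TA * T => ((fun x => (u z.1 x ^+ 2)%:E) \_ (V i)) z.2)); last first.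
  by move=> z; rewrite patchE; case: ifP => // _; rewrite lee_fin sqr_ge0.
rewrite (_ : (fun z => _) =
    (fun z : TA * T => (\1_(V i) z.2)%:E * (u z.1 z.2 ^+ 2)%:E)); last first.
  apply/funext => z; rewrite patchE indicE; case: ifP => _; first by rewrite mul1e.
  by rewrite mul0e.
apply: emeasurable_funM; apply/measurable_EFinP; last exact: measurable_funX.
by apply: (measurableT_comp _ measurable_snd); exact: measurable_indic.
Qed.

Local Notation tc := (tail_const s mu Cb).
Let wgt i : R := (4 * tc * h i `^ (- (2 * mu)))%R.

Let wgt_ge0 i : (0 <= wgt i)%R.
Proof. by rewrite mulr_ge0 ?powR_ge0// mulr_ge0// tail_const_ge0. Qed.

(** Positivity of [h] and separation are asked only of the pieces seen by one slice, since the mesh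
    conditions hold slice by slice. *)
Lemma slice_le_sum :
  {ae mA, forall a, [/\ {ae m, forall x, exists2 i, i \in active a & V i x},
     forall i, i \in active a -> (0 < h i)%R &
     forall i j x y, i \in active a -> j \in active a -> ~~ c i j ->
       V i x -> V j y -> (h i <= dist x y /\ h j <= dist x y)%R]} ->
  \int[mA]_a semi setT (u a) <=
    \sum_(i <- r) \sum_(j <- r | c' i j)
      \int[mA]_(a in U i `&` U j) semi (V i `|` V j) (u a) +
    \sum_(i <- r) (4 * tc * h i `^ (- (2 * mu)))%:E *
      \int[mA]_(a in U i) \int[m]_(x in V i) (u a x ^+ 2)%:E.
Proof.
move=> Hae; rewrite -integral_active_sum.
pose W a := \sum_(i <- r) (wgt i)%:E * (L2slice i \_ (U i)) a.
have mWi i : measurable_fun setT (fun a => (L2slice i \_ (U i)) a).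
  by apply/(measurable_restrictT _ (mU i)) => //; apply: measurable_funTS.
have W0 i a : 0 <= (L2slice i \_ (U i)) a by rewrite patchE; case: ifP.
have -> : \sum_(i <- r) (4 * tc * h i `^ (- (2 * mu)))%:E *
    \int[mA]_(a in U i) \int[m]_(x in V i) (u a x ^+ 2)%:E = \int[mA]_a W a.
  rewrite ge0_integral_sum//.
  - apply: eq_bigr => i _; rewrite ge0_integralZl_EFin// -?integral_mkcond//.
  - by move=> i; apply: emeasurable_funM.
  - by move=> i a _; rewrite mule_ge0// lee_fin wgt_ge0.
have mW : measurable_fun setT W.
  by apply: emeasurable_sum => i; apply: emeasurable_funM.
have W_ge0 a : 0 <= W a.
  by apply: sume_ge0 => i _; rewrite mule_ge0// lee_fin wgt_ge0.
rewrite -ge0_integralD//.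
apply: ae_ge0_le_integral => //.
- by move=> a _; exact: seminorm2_ge0.
- exact: measurable_seminorm2_slice.
- by move=> a _; exact: adde_ge0.
- exact: emeasurable_funD.
apply: filterS Hae => a [cover hpos sep] _.
apply: (le_trans (seminorm2_le_local mdist distC mu0 Cb0 ball_bound mV (mua a) hpos cover sep)).
apply: leeD => //; rewrite /W /active big_filter big_mkcond.
apply: lee_sum => i _; rewrite patchE; case: ifP => // _; by rewrite mule0.
Qed.

End slicing.

(** * Restricted measures *)

Section finite_restriction.
Local Open Scope ereal_scope.
Context d (T : measurableType d) (R : realType) (mu : {measure set T -> \bar R}).
Variables (D : set T) (mD : measurable D) (finD : mu D < +oo).

(** The finiteness proof is an argument so that the finite, hence sigma-finite, measure structure
    required by Tonelli can be attached to the restriction. *)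
Definition finrestr of mu D < +oo := mrestr mu mD.

Local Notation nu := (finrestr finD).

HB.instance Definition _ := Measure.on nu.

Let finrestr_fin : fin_num_fun nu.
Proof.
move=> A mA; rewrite ge0_fin_numE ?measure_ge0//.
apply: le_lt_trans finD; apply: le_measure; rewrite ?inE//.
exact: measurableI.
Qed.

HB.instance Definition _ := @Measure_isFinite.Build _ _ _ nu finrestr_fin.

Lemma integral_finrestr_sub A f : A `<=` D -> \int[nu]_(x in A) f x = \int[mu]_(x in A) f x.
Proof.
move=> AD; apply: eq_measure_integral => B mB BA.
by rewrite -[LHS]/(mu (B `&` D)) setIidl// => x /BA/AD.
Qed.

Lemma finrestr_ae : {ae nu, forall x, D x}.
Proof.
exists (~` D); split=> //; first exact: measurableC.
by rewrite /= /finrestr /mrestr setICl measure0.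
Qed.

Lemma ae_finrestr (Q : T -> Prop) : {ae mu, forall x, Q x} -> {ae nu, forall x, Q x}.
Proof.
move=> [N [mN N0 QN]]; exists N; split=> //.
apply/eqP; rewrite eq_le measure_ge0 andbT -N0.
by apply: le_measure; rewrite ?inE//; exact: measurableI.
Qed.

Lemma finrestr_negligible (N : set T) : measurable N -> mu N = 0 -> nu.-negligible N.
Proof.
move=> mN N0; exists N; split => //.
apply/eqP; rewrite eq_le measure_ge0 andbT -N0.
by apply: le_measure; rewrite ?inE//; exact: measurableI.
Qed.

Lemma integral_finrestr A f : measurable A -> measurable_fun A f ->
  (forall x, A x -> 0 <= f x) ->
  \int[nu]_(x in A) f x = \int[mu]_(x in A `&` D) f x.
Proof.
move=> mA mf f0.
rewrite [LHS](ge0_negligible_integral (mu := nu) (N := ~` D))//.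
- by rewrite setDE setCK integral_finrestr_sub// => x [].
- exact: measurableC.
- by rewrite /= /finrestr /mrestr setICl measure0.
Qed.

End finite_restriction.

Lemma ae_notin {d} {T : measurableType d} {R : realType}
    (mu : {measure set T -> \bar R}) (N : set T) :
  mu.-negligible N -> {ae mu, forall x, ~ N x}.
Proof. by move=> nN; apply: negligibleS nN => x /= /contrapT. Qed.

Lemma filter_forall_in {T : Type} (F : set_system T) {FF : Filter F} (I : eqType)
    (r : seq I) (Q : I -> T -> Prop) :
  (forall i, i \in r -> F [set x | Q i x]) -> F [set x | forall i, i \in r -> Q i x].
Proof.
elim: r => [|i r IH] FQ; first by apply: filterS filterT.
have Fi := FQ i (mem_head _ _).
have Fr : F [set x | forall j, j \in r -> Q j x].
  by apply: IH => j jr; apply: FQ; rewrite inE jr orbT.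
by apply: filterS2 Fi Fr => x /= Qi Qr j; rewrite inE => /predU1P[->//|/Qr].
Qed.

Section tonelli3.
Local Open Scope ereal_scope.
Context dA dB dC (A : measurableType dA) (B : measurableType dB) (C : measurableType dC)
  (R : realType).
Variables (mA : {sigma_finite_measure set A -> \bar R})
  (mB : {sigma_finite_measure set B -> \bar R}) (mC : {sigma_finite_measure set C -> \bar R}).

(** Serves to pull the space integral out of the two time integrals of the [H^nu(J; L_2)]
    seminorm. *)
Lemma tonelli3 (F : A * B * C -> R) : measurable_fun setT F -> (forall z, 0 <= F z)%R ->
  \int[mA]_a \int[mB]_b \int[mC]_c (F (a, b, c))%:E =
  \int[mC]_c \int[mA]_a \int[mB]_b (F (a, b, c))%:E.
Proof.
move=> mF F0.
transitivity (\int[mA]_a \int[mC]_c \int[mB]_b (F (a, b, c))%:E).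
  apply: eq_integral => a _.
  apply: (fubini_tonelli (m1 := mB) (m2 := mC) (fun z : B * C => (F (a, z.1, z.2))%:E)).
    apply/measurable_EFinP; apply: (measurableT_comp mF).
    apply: measurable_fun_pair => //; apply: measurable_fun_pair => //.
  by move=> z; rewrite lee_fin.
apply: (fubini_tonelli (m1 := mA) (m2 := mC)
  (fun z : A * C => \int[mB]_b (F (z.1, b, z.2))%:E)).
  apply: (measurable_fun_fubini_tonelli_F
    (fun z : A * C * B => (F (z.1.1, z.2, z.1.2))%:E)).
    apply/measurable_EFinP; apply: (measurableT_comp mF).
    apply: measurable_fun_pair; last exact: (measurableT_comp measurable_snd).
    by apply: measurable_fun_pair => //; exact: (measurableT_comp measurable_fst).
  by move=> z; rewrite lee_fin.
by move=> z; apply: integral_ge0 => b _; rewrite lee_fin.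
Qed.

End tonelli3.

(** * Partitions of an interval *)

Section counting.
Context {R : realType} (I : eqType).

(** The contributing pairs lie in the row or in the column of [p]; by symmetry of [c] the bound for
    the row serves for the column. *)
Lemma double_count_le (r : seq I) (c : rel I) (p : I) (f : I -> I -> R) (N : R) :
  uniq r -> p \in r -> symmetric c ->
  (forall i j, i \in r -> j \in r -> f i j <= (i == p)%:R + (j == p)%:R) ->
  \sum_(j <- r | c p j) 1 <= N ->
  \sum_(i <- r) \sum_(j <- r | c i j) f i j <= N + N.
Proof.
move=> ur pr csym fp cN.
have row : \sum_(i <- r) \sum_(j <- r | c i j) ((i == p)%:R : R) <= N.
  rewrite (bigD1_seq p)//= eqxx [X in _ + X]big1 ?addr0// => i ip.
  by rewrite big1// => j _; rewrite (negbTE ip).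
apply: (@le_trans _ _ (\sum_(i <- r) \sum_(j <- r | c i j) ((i == p)%:R + (j == p)%:R))).
  rewrite big_seq [leRHS]big_seq; apply: ler_sum => i ir.
  rewrite big_seq_cond [leRHS]big_seq_cond; apply: ler_sum => j /andP[jr _].
  exact: fp.
under eq_bigr do rewrite big_split/=.
rewrite big_split/= lerD//.
rewrite (exchange_big_dep xpredT)//=; under eq_bigr do under eq_bigl do rewrite csym.
exact: row.
Qed.

Lemma count_le1 (r : seq I) (a : pred I) : uniq r ->
  (forall i j, i \in r -> j \in r -> a i -> a j -> i = j) -> (count a r <= 1)%N.
Proof.
move=> ur aeq; rewrite -size_filter.
have uf : uniq (seq.filter a r) by exact: filter_uniq.
case E : (seq.filter a r) uf => [|i [|j s]]//= /andP[+ _].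
have : i \in seq.filter a r by rewrite E mem_head.
have : j \in seq.filter a r by rewrite E !inE eqxx orbT.
rewrite !mem_filter => /andP[aj jr] /andP[ai ir].
by rewrite inE negb_or (aeq i j ir jr ai aj) eqxx.
Qed.

End counting.

Section interval_partition.
Context {R : realType} (I : eqType) (r : seq I) (lo hi : I -> R) (T C : R).
Hypothesis ur : uniq r.
Hypothesis T0 : 0 < T.
Hypothesis C0 : 0 < C.
Hypothesis lohi : forall p, p \in r -> [/\ 0 <= lo p, lo p <= hi p & hi p <= T].
Hypothesis nonoverlap : forall p q, p \in r -> q \in r -> p != q ->
  Num.min (hi p) (hi q) <= Num.max (lo p) (lo q).
Hypothesis cover : forall t, 0 < t < T -> exists2 p, p \in r & lo p <= t <= hi p.

Definition touching p q := (lo p <= hi q) && (lo q <= hi p).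

Hypothesis lqu : forall p q, p \in r -> q \in r -> touching p q ->
  hi p - lo p <= C * (hi q - lo q).

Let gap_right (E : seq R) b : b < T ->
  exists2 c, b < c <= T & forall e, e \in E -> b < e -> c <= e.
Proof.
move=> bT; elim: E => [|e E [c bc cE]]; first by exists T; rewrite ?bT/=.
have [be|eb] := ltP b e; last first.
  exists c => // e'; rewrite inE => /predU1P[->|]; last exact: cE.
  by rewrite ltNge eb.
exists (Num.min c e).
  by case/andP: bc => bc cT; rewrite lt_min bc be/= ge_min cT.
move=> e'; rewrite inE => /predU1P[->|e'E be']; first by rewrite ge_min lexx orbT.
by rewrite ge_min cE.
Qed.

Let gap_left (E : seq R) b : 0 < b ->
  exists2 c, 0 <= c < b & forall e, e \in E -> e < b -> e <= c.
Proof.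
move=> b0; elim: E => [|e E [c bc cE]]; first by exists 0; rewrite ?b0/= ?lexx.
have [be|eb] := ltP e b; last first.
  exists c => // e'; rewrite inE => /predU1P[->|]; last exact: cE.
  by rewrite ltNge eb.
exists (Num.max c e).
  by case/andP: bc => bc cT; rewrite le_max bc/= gt_max cT.
move=> e'; rewrite inE => /predU1P[->|e'E be']; first by rewrite le_max lexx orbT.
by rewrite le_max cE.
Qed.

(** An interval containing b may end at b. A point to the right of b, but before every left endpoint
    beyond b, lies in an interval that starts no later than b and ends after it. *)
Lemma cover_right b : 0 <= b < T -> exists2 p, p \in r & lo p <= b < hi p.
Proof.
move=> /andP[b0 bT]; have [c /andP[bc cT] cE] := gap_right [seq lo p | p <- r] bT.
have [|p pr /andP[p1 p2]] := cover (t := (b + c) / 2); first by apply/andP; split; lra.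
exists p => //; apply/andP; split; last by lra.
by rewrite leNgt; apply/negP => /(cE _ (map_f _ pr)); lra.
Qed.

Lemma cover_left b : 0 < b <= T -> exists2 p, p \in r & lo p < b <= hi p.
Proof.
move=> /andP[b0 bT]; have [c /andP[bc cT] cE] := gap_left [seq hi p | p <- r] b0.
have [|p pr /andP[p1 p2]] := cover (t := (b + c) / 2); first by apply/andP; split; lra.
exists p => //; apply/andP; split; first by lra.
by rewrite leNgt; apply/negP => /(cE _ (map_f _ pr)); lra.
Qed.

(** By the covering, a degenerate interval touches one of positive length, whose length [lqu] bounds
    by C times zero. *)
Lemma partition_nondegenerate p : p \in r -> lo p < hi p.
Proof.
move=> pr; have [p0 pp pT] := lohi pr; rewrite lt_neqAle pp andbT; apply/eqP => pe.
have [k kr [kp kd]] : exists2 k, k \in r & touching k p /\ lo k < hi k.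
  have [hT|Th] := ltP (hi p) T.
    have [|k kr /andP[k1 k2]] := cover_right (b := hi p); first by rewrite hT -pe p0.
    exists k => //; split; last exact: le_lt_trans k1 k2.
    by rewrite /touching k1 pe ltW.
  have [|k kr /andP[k1 k2]] := cover_left (b := hi p).
    by rewrite pT andbT; exact: lt_le_trans Th.
  exists k => //; split; last exact: lt_le_trans k1 k2.
  by rewrite /touching ltW//= pe.
by have := lqu kr pr kp; rewrite pe subrr mulr0; lra.
Qed.

Let disjunction p q : p \in r -> q \in r -> p != q -> hi p <= lo q \/ hi q <= lo p.
Proof.
move=> pr qr pq; have := nonoverlap pr qr pq.
have := partition_nondegenerate pr; have := partition_nondegenerate qr.
rewrite ge_min !le_max => dq dp /orP[] /orP[]; [lra|by left|by right|lra].
Qed.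

Let neighbour_between p q : p \in r -> q \in r -> hi p < lo q ->
  (hi p - lo p <= C * (lo q - hi p)) /\ (hi q - lo q <= C * (lo q - hi p)).
Proof.
move=> pr qr pq.
have dp := partition_nondegenerate pr; have dq := partition_nondegenerate qr.
have [p0 _ pT] := lohi pr; have [q0 _ qT] := lohi qr.
split.
  (* The interval [k] just after [hi p] touches [p] and overlaps neither [p] nor [q], so it fits
     into the gap and is no longer than [lo q - hi p]. *)
  have [|k kr /andP[k1 k2]] := cover_right (b := hi p); first by apply/andP; split; lra.
  have kp : p != k by apply/eqP => e; move: k2; rewrite -e ltxx.
  have e1 : hi p <= lo k by have [//|] := disjunction pr kr kp; lra.
  have kq : k != q by apply/eqP => e; move: pq; rewrite -e; lra.
  have e2 : hi k <= lo q by have [//|] := disjunction kr qr kq; lra.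
  apply: (le_trans (lqu pr kr _)); first by rewrite /touching k1 andbT; lra.
  by rewrite ler_pM2l//; lra.
have [|k kr /andP[k1 k2]] := cover_left (b := lo q); first by apply/andP; split; lra.
have kq : k != q by apply/eqP => e; move: k1; rewrite -e ltxx.
have e1 : hi k <= lo q by have [//|] := disjunction kr qr kq; lra.
have kp : p != k by apply/eqP => e; move: pq; rewrite e; lra.
have e2 : hi p <= lo k by have [//|] := disjunction pr kr kp; lra.
apply: (le_trans (lqu qr kr _)); first by rewrite /touching k2/=; lra.
by rewrite ler_pM2l//; lra.
Qed.

Lemma partition_separation p q t s : p \in r -> q \in r -> ~~ touching p q ->
  lo p <= t <= hi p -> lo q <= s <= hi q ->
  ((hi p - lo p) / C <= `|t - s|) /\ ((hi q - lo q) / C <= `|t - s|).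
Proof.
move=> pr qr + /andP[t1 t2] /andP[s1 s2].
rewrite negb_and -!ltNge => /orP[qp|pq].
  have [Hq Hp] := neighbour_between qr pr qp.
  have st : lo p - hi q <= `|t - s| by apply: le_trans (ler_norm _); lra.
  rewrite !ler_pdivrMr// ![_ * C]mulrC.
  by split; [apply: (le_trans Hp)|apply: (le_trans Hq)]; rewrite ler_pM2l.
have [Hp Hq] := neighbour_between pr qr pq.
have st : lo q - hi p <= `|t - s| by rewrite distrC; apply: le_trans (ler_norm _); lra.
rewrite !ler_pdivrMr// ![_ * C]mulrC.
by split; [apply: (le_trans Hp)|apply: (le_trans Hq)]; rewrite ler_pM2l.
Qed.

(** An interval touching [p] is [p] itself, starts at [hi p], or ends at [lo p]. Two different
    nondegenerate intervals with a common left (or right) endpoint would overlap, so each case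
    occurs at most once. *)
Lemma partition_touching_count p : p \in r -> \sum_(q <- r | touching p q) (1 : R) <= 3.
Proof.
move=> pr; rewrite big_const_seq iter_addr_0 ler_nat.
pose a1 q := q == p; pose a2 q := lo q == hi p; pose a3 q := hi q == lo p.
apply: (@leq_trans (count a1 r + count a2 r + count a3 r)).
  have : {in r, subpred (touching p) (fun q => [|| a1 q, a2 q | a3 q])}.
    move=> q qr /andP[h1 h2]; rewrite /a1/a2/a3; have [//|qp] := eqVneq q p.
    by have [h|h] := disjunction qr pr qp; rewrite ?eq_le ?h ?h1 ?h2 ?orbT.
  move=> sub; rewrite (eq_in_count (a2 := fun q => touching p q && [|| a1 q, a2 q | a3 q])); last first.
    by move=> q qr; have := sub q qr; case: (touching p q) => // ->.
  apply: (@leq_trans (count (predU (predU a1 a2) a3) r)).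
    by apply: sub_count => q /andP[_]; rewrite /= orbA.
  have predU_le (a b : pred I) : (count (predU a b) r <= count a r + count b r)%N.
    by rewrite -count_predUI leq_addr.
  by apply: (leq_trans (predU_le _ _)); rewrite leq_add2r.
have c1 : (count a1 r <= 1)%N by apply: count_le1 => // i j _ _ /eqP-> /eqP->.
have c2 : (count a2 r <= 1)%N.
  apply: count_le1 => // i j ir jr /eqP ei /eqP ej; apply/eqP/negP => /negP ij.
  have := disjunction ir jr ij; have := partition_nondegenerate ir.
  have := partition_nondegenerate jr; lra.
have c3 : (count a3 r <= 1)%N.
  apply: count_le1 => // i j ir jr /eqP ei /eqP ej; apply/eqP/negP => /negP ij.
  have := disjunction ir jr ij; have := partition_nondegenerate ir.
  have := partition_nondegenerate jr; lra.
by rewrite (leq_add (leq_add c1 c2) c3).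
Qed.

End interval_partition.

(** * Metric outer measures *)

Section metric_outer_measure.
Local Open Scope ereal_scope.
Context (T : Type) (R : realType) (mu : {outer_measure set T -> \bar R}).
Variable G : (set T)^nat.
Hypothesis ndG : forall k, G k `<=` G k.+1.
Hypothesis sepG : forall k X Y, X `<=` G k -> Y `<=` ~` G k.+1 ->
  mu X + mu Y <= mu (X `|` Y).

Let le_G j k : (j <= k)%N -> G j `<=` G k.
Proof.
move=> /subnK <-; elim: (k - j)%N => [//|m IH].
by move=> x /IH; exact: ndG.
Qed.

Let ring A j := A `&` (G j.+1 `\` G j).

(* Rings two apart are separated, so their measures add up. *)
Let sum_alternate_rings A b N :
  \sum_(j < N) mu (ring A (b + j.*2)) <= mu (\big[setU/set0]_(j < N) ring A (b + j.*2)).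
Proof.
elim: N => [|N IH]; first by rewrite !big_ord0 outer_measure0.
rewrite !big_ord_recr/=; case: N IH => [|N] IH.
  by rewrite !big_ord0 set0U add0e.
apply: (le_trans (leeD2r _ IH)); apply: (@sepG (b + N.*2).+1).
- rewrite -(bigcup_mkord _ (fun j => ring A (b + j.*2))) => x [j /= jN [_ [+ _]]].
  by apply: le_G; rewrite ltnS leq_add2l leq_double -ltnS.
- by move=> x [_ [_]]; rewrite doubleS !addnS.
Qed.

Let sum_double (f : nat -> \bar R) N :
  \sum_(j < N.*2) f j = \sum_(j < N) f j.*2 + \sum_(j < N) f j.*2.+1.
Proof.
elim: N => [|N IH]; first by rewrite !big_ord0 adde0.
rewrite doubleS !big_ord_recr/= IH -!addeA; congr (_ + _).
by rewrite [in RHS]addeCA.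
Qed.

Let sum_rings A N : \sum_(j < N) mu (ring A j) <= mu A + mu A.
Proof.
have half b : \sum_(j < N) mu (ring A (b + j.*2)) <= mu A.
  apply: (le_trans (sum_alternate_rings _ _ _)); apply: le_outer_measure.
  by rewrite -(bigcup_mkord _ (fun j => ring A (b + j.*2))) => x [j _ []].
apply: (@le_trans _ _ (\sum_(j < N.*2) mu (ring A j))).
  rewrite -!(big_mkord xpredT (fun j => mu (ring A j))).
  apply: lee_sum_nneg_natr => [j _ _|]; first exact: outer_measure_ge0.
  by rewrite -addnn leq_addr.
rewrite (sum_double (fun j => mu (ring A j))); apply: leeD.
  exact: (half 0%N).
exact: (half 1%N).
Qed.

(** Caratheodory's argument for metric outer measures. The even rings of [A] are mutually separated,
    and so are the odd ones; hence all rings together have measure at most [2 mu A], and the tail of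
    the series tends to 0. The part of [A] in the union exceeds its part in [G k] by at most that
    tail, and the latter is separated from the part of [A] outside the union. *)
Lemma caratheodory_measurable_exhaustion : mu.-caratheodory (\bigcup_k G k).
Proof.
apply: le_caratheodory_measurable => A.
have [->|Afin] := eqVneq (mu A) +oo; first exact: leey.
have ring_ge0 j : 0 <= mu (ring A j) by exact: outer_measure_ge0.
have ringsfin : \sum_(j <oo) mu (ring A j) < +oo.
  apply: (@le_lt_trans _ _ (mu A + mu A)); last first.
    by rewrite lte_add_pinfty// ltey.
  apply: lime_le; first exact: is_cvg_nneseries.
  by apply: nearW => N; rewrite big_mkord; exact: sum_rings.
have tail0 := nneseries_tail_cvg ringsfin (fun k _ => ring_ge0 k).
have bound k : mu (A `&` \bigcup_k G k) + mu (A `&` ~` \bigcup_k G k) <=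
    mu A + \sum_(k <= j <oo) mu (ring A j).
  apply: (@le_trans _ _ (mu (A `&` G k) + \sum_(k <= j <oo) mu (ring A j) +
      mu (A `&` ~` \bigcup_k G k))).
    apply: leeD2r; apply: (@le_trans _ _
      (mu ((A `&` G k) `|` \bigcup_(n in ~` `I_k) ring A n))).
      apply: le_outer_measure => x [Ax [m _ Gmx]].
      have [Gkx|Gkx] := pselect (G k x); [by left|right].
      have ex : exists m, x \in G m by exists m; exact/mem_set.
      (* A point outside [G k] lies in the ring just before the first [G] that contains it. *)
      case: (ex_minnP ex) => -[|l] /set_mem Glx lmin.
        by case: Gkx; exact: le_G Glx.
      exists l => /=.
        by apply/negP; rewrite -leqNgt; apply: contra_notT Gkx; rewrite -ltnNge => /le_G; exact.
      split=> //; split=> // /mem_set /lmin; by rewrite ltnn.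
    apply: (le_trans (outer_measureU2 _ _ _)); apply: leeD2l.
    exact: outer_measure_sigma_subadditive_tail.
  rewrite addeAC; apply: leeD2r; apply: (le_trans (@sepG k _ _ _ _)).
  - exact: subIsetr.
  - by move=> x [_ NGx] Gx; apply: NGx; exists k.+1.
  - by apply: le_outer_measure => x [[]|[]].
apply/lee_addgt0Pr => e e0.
have [N _ HN] : \forall k \near \oo, \sum_(k <= j <oo) mu (ring A j) < e%:E.
  move/fine_cvgP: tail0 => [fin /cvgr0_norm_lt/(_ _ e0)] H.
  near=> k.
  have : \sum_(k <= j <oo) mu (ring A j) \is a fin_num by near: k; exact: fin.
  move=> /fineK <-; rewrite lte_fin; apply: le_lt_trans (ler_norm _) _.
  by near: k; exact: H.
apply: (le_trans (bound N)); apply: leeD2l; apply/ltW; apply: HN => /=.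
by [].
Unshelve. all: by end_near. Qed.

End metric_outer_measure.

(** * Hausdorff measure *)

Section euclidean_norm.
Context {R : realType} (n : nat).
Implicit Types x y : 'rV[R]_n.

Lemma enorm_ge0 x : 0 <= enorm x.
Proof. exact: sqrtr_ge0. Qed.

Lemma enorm_distC x y : enorm (x - y) = enorm (y - x).
Proof.
rewrite /enorm; congr (Num.sqrt _); apply: eq_bigr => i _.
by rewrite !mxE -sqrrN opprB.
Qed.

Lemma coord_le_enorm x i : `|x ord0 i| <= enorm x.
Proof.
rewrite -sqrtr_sqr ler_wsqrtr// (bigD1 i)//= lerDl.
by apply: sumr_ge0 => j _; exact: sqr_ge0.
Qed.

Lemma enorm_le x M : 0 <= M -> (forall i, `|x ord0 i| <= M) ->
  enorm x <= n%:R * M.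
Proof.
move=> M0 xM; have nM0 : 0 <= n%:R * M by rewrite mulr_ge0.
rewrite -(ger0_norm nM0) -sqrtr_sqr ler_wsqrtr//.
apply: (@le_trans _ _ (\sum_(i < n) M ^+ 2)).
  by apply: ler_sum => i _; rewrite -real_normK ?num_real// lerXn2r ?nnegrE.
rewrite sumr_const card_ord -[leLHS]mulr_natl exprMn.
rewrite ler_wpM2r ?sqr_ge0// -natrX ler_nat.
by case: n => // k; rewrite expnS expn1 leq_pmulr.
Qed.

End euclidean_norm.

Section euclidean_diameter.
Context {R : realType} (n : nat).
Implicit Types A B : set 'rV[R]_n.
Local Open Scope ereal_scope.

Lemma ediam_ge0 A : 0 <= ediam A.
Proof. by apply: ereal_sup_ubound; left. Qed.

Lemma ediam0 : ediam (set0 : set 'rV[R]_n) = 0.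
Proof.
apply/eqP; rewrite eq_le ediam_ge0 andbT.
by apply: ge_ereal_sup => _ [->//|[[x y] [[]]]].
Qed.

Lemma le_ediam A B : A `<=` B -> ediam A <= ediam B.
Proof.
move=> AB; apply: ge_ereal_sup => _ [->//|[[x y] [/= Ax Ay] <-]].
  exact: ediam_ge0.
by apply: ereal_sup_ubound; right; exists (x, y) => //; split; exact: AB.
Qed.

Lemma enorm_le_ediam A x y : A x -> A y -> (enorm (x - y))%:E <= ediam A.
Proof. by move=> Ax Ay; apply: ereal_sup_ubound; right; exists (x, y). Qed.

Lemma ediam_le A (d : R) : (0 <= d)%R ->
  (forall x y, A x -> A y -> enorm (x - y) <= d)%R -> ediam A <= d%:E.
Proof.
move=> d0 Ad; apply: ge_ereal_sup => _ [->|[[x y] [/= Ax Ay] <-]].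
  by rewrite lee_fin.
by rewrite lee_fin Ad.
Qed.

Lemma expe_ediam_ge0 s A : 0 <= ediam A ^+ s.
Proof. by rewrite expe_ge0// ediam_ge0. Qed.

Lemma le_expe s (x y : \bar R) : 0 <= x -> x <= y -> x ^+ s <= y ^+ s.
Proof.
move=> x0 xy; elim: s => [|s IH]; first by rewrite !expe0.
by rewrite !expeS lee_pmul// expe_ge0.
Qed.

End euclidean_diameter.

(** * Hausdorff content at a fixed scale *)

Section hausdorff_content.
Context {R : realType} (n s : nat).
Implicit Types A B : set 'rV[R]_n.
Local Open Scope ereal_scope.

(** [mu_ext] uses covers by measurable sets: generating the sigma-algebra from all sets admits every
    cover, and the value +oo of [pre] on sets of large diameter enforces the scale. The content thus
    inherits monotonicity and subadditivity. The exponent is a successor so that the empty set has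
    weight 0. *)
Let V := g_sigma_algebraType (@setT (set 'rV[R]_n)).

Let pre (delta : R) (F : set V) : \bar R :=
  if ediam F <= delta%:E then ediam F ^+ s.+1 else +oo.

Let pre_ge0 delta F : 0 <= pre delta F.
Proof. by rewrite /pre; case: ifP => // _; exact: expe_ediam_ge0. Qed.

Let pre0 delta : (0 <= delta)%R -> pre delta set0 = 0.
Proof. by move=> d0; rewrite /pre ediam0 lee_fin d0 expeS mul0e. Qed.

Let content_mu_ext delta A :
  hausdorff_content s.+1 delta A = mu_ext (pre delta) (A : set V).
Proof.
apply/eqP; rewrite eq_le; apply/andP; split; apply: le_ereal_inf_tmp => _ [F [F1 F2] <-].
  have [H|/existsNP[k /negP Hk]] := pselect (forall k, ediam (F k) <= delta%:E).
    by apply: ereal_inf_lbound; exists F => //; apply: eq_eseriesr => k _; rewrite /pre H.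
  rewrite (@eseries_pinfty _ _ _ k) ?leey//.
    by move=> i _; rewrite -ltNye (lt_le_trans _ (pre_ge0 _ _)).
  by rewrite /pre (negbTE Hk).
apply: ereal_inf_lbound; exists F.
  split=> // k; apply: sub_sigma_algebra => //.
by apply: eq_eseriesr => k _; rewrite /pre F2.
Qed.

Lemma hausdorff_content_ge0 delta A : 0 <= hausdorff_content s.+1 delta A.
Proof. by rewrite content_mu_ext; apply: mu_ext_ge0. Qed.

Lemma le_hausdorff_content delta A B : A `<=` B ->
  hausdorff_content s.+1 delta A <= hausdorff_content s.+1 delta B.
Proof. by move=> AB; rewrite !content_mu_ext; apply: le_mu_ext. Qed.

Lemma hausdorff_content0 delta : (0 <= delta)%R ->
  hausdorff_content s.+1 delta (set0 : set 'rV[R]_n) = 0.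
Proof. by move=> d0; rewrite content_mu_ext; apply: mu_ext0 => //; exact: pre0. Qed.

Lemma hausdorff_content_subadditive delta :
  sigma_subadditive (fun A => hausdorff_content s.+1 delta A).
Proof.
move=> F; rewrite content_mu_ext.
under [leRHS]eq_eseriesr do rewrite content_mu_ext.
by apply: mu_ext_sigma_subadditive.
Qed.

Lemma hausdorff_content_nincr delta delta' A : (delta <= delta')%R ->
  hausdorff_content s.+1 delta' A <= hausdorff_content s.+1 delta A.
Proof.
move=> dd; apply: le_ereal_inf_tmp => _ [F [AF dF] <-].
apply: ereal_inf_lbound; exists F => //; split=> // k.
by rewrite (le_trans (dF k))// lee_fin.
Qed.

(** A set of diameter at most [delta] cannot meet both A and B, so every cover of the union splits
    into a cover of A and one of B. *)
Lemma hausdorff_content_separated delta A B : (0 <= delta)%R ->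
  (forall x y, A x -> B y -> delta < enorm (x - y))%R ->
  hausdorff_content s.+1 delta A + hausdorff_content s.+1 delta B <=
  hausdorff_content s.+1 delta (A `|` B).
Proof.
move=> d0 sepAB; apply: le_ereal_inf_tmp => _ [F [ABF dF] <-].
have dI (E : set 'rV[R]_n) k : ediam (F k `&` E) <= delta%:E.
  by rewrite (le_trans _ (dF k))// le_ediam.
apply: (@le_trans _ _ (\sum_(k <oo) ediam (F k `&` A) ^+ s.+1 +
    \sum_(k <oo) ediam (F k `&` B) ^+ s.+1)).
  apply: leeD; apply: ereal_inf_lbound; (eexists; [split|reflexivity]) => //.
  - by move=> x Ax; have [k _ Fx] := ABF x (or_introl Ax); exists k.
  - by move=> x Bx; have [k _ Fx] := ABF x (or_intror Bx); exists k.
rewrite -nneseriesD; [|by move=> k _ _; exact: expe_ediam_ge0..].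
apply: lee_nneseries => k.
  by move=> _ _; rewrite adde_ge0// expe_ediam_ge0.
move=> _; have [FA|/set0P[x [Fx Ax]]] := eqVneq (F k `&` A) set0.
  rewrite FA ediam0 expeS mul0e add0e.
  by apply: le_expe; [exact: ediam_ge0|exact: le_ediam].
rewrite [X in _ + X](_ : _ = 0) ?adde0.
  by apply: le_expe; [exact: ediam_ge0|exact: le_ediam].
rewrite (_ : F k `&` B = set0) ?ediam0 ?expeS ?mul0e//.
apply/seteqP; split=> // y [Fy By].
have := le_trans (enorm_le_ediam Fx Fy) (dF k).
by rewrite lee_fin leNgt sepAB.
Qed.

End hausdorff_content.

(** * The Hausdorff outer measure is a metric outer measure *)

Section hausdorff_outer_measure.
Context {R : realType} (n s : nat).
Implicit Types A B : set 'rV[R]_n.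
Local Open Scope ereal_scope.

Lemma unit_ball_volume_gt0 k : (0 < unit_ball_volume k :> R)%R.
Proof.
have [m] := ubnP k; elim: m k => // m IH [|[|k]]//= km.
rewrite mulr_gt0 ?divr_gt0 ?mulr_gt0 ?pi_gt0//; apply: IH.
by rewrite -ltnS (ltn_trans _ km).
Qed.

Let c : R := unit_ball_volume s.+1 / 2 ^+ s.+1.
Let c0 : (0 < c)%R. Proof. by rewrite divr_gt0 ?unit_ball_volume_gt0. Qed.
Let ce0 : 0 <= c%:E. Proof. by rewrite lee_fin ltW. Qed.

Let S A := ereal_sup [set hausdorff_content s.+1 delta A |
                      delta in [set delta : R | (0 < delta)%R]].

Let content_le_S delta A : (0 < delta)%R -> hausdorff_content s.+1 delta A <= S A.
Proof. by move=> d0; apply: ereal_sup_ubound; exists delta. Qed.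

Let S_ge0 A : 0 <= S A.
Proof. exact: le_trans (hausdorff_content_ge0 s 1 A) (content_le_S _ ltr01). Qed.

Let H : set 'rV[R]_n -> \bar R := @hausdorff_measure R n s.+1.

Let H0 : H set0 = 0.
Proof.
rewrite /H /hausdorff_measure (_ : ereal_sup _ = 0) ?mule0//.
apply/eqP; rewrite eq_le S_ge0 andbT; apply: ge_ereal_sup => _ [d /= d0 <-].
by rewrite hausdorff_content0// ltW.
Qed.

Let H_ge0 A : 0 <= H A. Proof. exact: mule_ge0 ce0 (S_ge0 A). Qed.

Let le_H : {homo H : A B / A `<=` B >-> A <= B}.
Proof.
move=> A B AB; apply: lee_wpmul2l => //; apply: ge_ereal_sup => _ [d /= d0 <-].
exact: le_trans (le_hausdorff_content _ _ AB) (content_le_S _ d0).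
Qed.

Let H_sub : sigma_subadditive H.
Proof.
move=> F; rewrite [leRHS](_ : _ = c%:E * \sum_(i <oo) S (F i)); last first.
  by rewrite -nneseriesZl// lee_fin ltW.
apply: lee_wpmul2l => //; apply: ge_ereal_sup => _ [d /= d0 <-].
apply: le_trans (hausdorff_content_subadditive _ _ _) _.
apply: lee_nneseries => k _; first by move=> _; exact: hausdorff_content_ge0.
exact: content_le_S.
Qed.

HB.instance Definition _ := isOuterMeasure.Build R 'rV[R]_n H H0 H_ge0 le_H H_sub.

Definition hausdorff_outer : {outer_measure set 'rV[R]_n -> \bar R} := H.

Lemma hausdorff_outer_le A (M : R) : (0 <= M)%R ->
  (forall delta, (0 < delta)%R -> hausdorff_content s.+1 delta A <= M%:E) ->
  hausdorff_outer A <= (c * M)%:E.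
Proof.
move=> M0 AM; rewrite EFinM; apply: lee_wpmul2l => //.
by apply: ge_ereal_sup => _ [d /= d0 <-]; exact: AM.
Qed.

Lemma hausdorff_outer_gt0 A delta : (0 < delta)%R ->
  0 < hausdorff_content s.+1 delta A -> 0 < hausdorff_outer A.
Proof.
move=> d0 A0; apply: mule_gt0; first by rewrite lte_fin.
exact: lt_le_trans A0 (content_le_S _ d0).
Qed.

(** The suprema for A and for B run over independent scales. Both scales are replaced by a smaller
    common one, at which the contents add up; contents grow as the scale shrinks. The suprema are
    then removed one at a time by subtracting a finite quantity. *)
Lemma hausdorff_outer_separated A B (delta : R) : (0 < delta)%R ->
  (forall x y, A x -> B y -> delta <= enorm (x - y))%R ->
  hausdorff_outer A + hausdorff_outer B <= hausdorff_outer (A `|` B).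
Proof.
move=> d0 sepAB; rewrite /hausdorff_outer /H /hausdorff_measure.
rewrite -ge0_muleDr ?S_ge0//; apply: lee_wpmul2l => //.
rewrite -![ereal_sup _]/(S _).
have key (d1 d2 : R) : (0 < d1)%R -> (0 < d2)%R ->
    hausdorff_content s.+1 d1 A + hausdorff_content s.+1 d2 B <= S (A `|` B).
  move=> d10 d20.
  (* Half of [delta] provides the strict separation that the content asks for. *)
  pose d : R := Num.min (Num.min d1 d2) (delta / 2)%R.
  have dp : (0 < d)%R by rewrite !lt_min d10 d20 divr_gt0.
  apply: le_trans (content_le_S _ dp).
  apply: le_trans (hausdorff_content_separated s (ltW dp) _).
    by apply: leeD; apply: hausdorff_content_nincr; rewrite /d !ge_min lexx ?orbT.
  move=> x y Ax By; apply: lt_le_trans (sepAB _ _ Ax By).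
  by rewrite gt_min; apply/orP; right; rewrite ltr_pdivrMr// ltr_pMr// ltr1n.
have [->|Uoo] := eqVneq (S (A `|` B)) +oo; first exact: leey.
have Ufin : S (A `|` B) \is a fin_num.
  by rewrite ge0_fin_numE ?ltey.
have fin d A' : A' `<=` A `|` B -> (0 < d)%R -> hausdorff_content s.+1 d A' \is a fin_num.
  move=> A'AB dp; rewrite ge0_fin_numE ?hausdorff_content_ge0//.
  apply: le_lt_trans (_ : S (A `|` B) < _); last by rewrite ltey.
  exact: le_trans (le_hausdorff_content _ _ A'AB) (content_le_S _ dp).
have SAB d2 : (0 < d2)%R -> S A + hausdorff_content s.+1 d2 B <= S (A `|` B).
  move=> d20; rewrite -leeBrDr; last by apply: fin => // x; right.
  apply: ge_ereal_sup => _ [d1 /= d10 <-]; rewrite leeBrDr; last by apply: fin => // x; right.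
  exact: key.
have SAfin : S A \is a fin_num.
  rewrite ge0_fin_numE ?S_ge0//; apply: le_lt_trans (_ : S (A `|` B) < _); last by rewrite ltey.
  apply: le_trans (SAB _ ltr01).
  by rewrite leeDl ?hausdorff_content_ge0.
rewrite addeC -leeBrDr//; apply: ge_ereal_sup => _ [d2 /= d20 <-].
by rewrite leeBrDr// addeC; exact: SAB.
Qed.

Lemma open_caratheodory_measurable (G : set 'rV[R]_n) : open G ->
  hausdorff_outer.-caratheodory G.
Proof.
move=> oG.
(* [Gk k] consists of the points whose open sup-norm ball of radius [1/(k+1)] lies in G. A point
   outside [Gk k.+1] is within [1/(k+2)] of the complement of G, which separates it from [Gk k] by
   the difference of the radii. *)
pose Gk k := [set x : 'rV[R]_n | forall y : 'rV[R]_n, (forall i, `|x ord0 i - y ord0 i| < k.+1%:R^-1)%R -> G y].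
have -> : G = \bigcup_k Gk k.
  apply/seteqP; split=> [x Gx|x [k _ /(_ x)]]; last first.
    by apply => i; rewrite subrr normr0 invr_gt0.
  have /nbhs_ballP[e /= e0 xeG] := open_nbhs_nbhs (conj oG Gx).
  exists (Num.truncn e^-1) => // y xy; apply: xeG; split=> // i j.
  rewrite (ord1 i) /ball/=; apply: lt_trans (xy j) _.
  by rewrite invf_plt ?posrE// truncnS_gt.
apply: caratheodory_measurable_exhaustion => [k x Gkx y xy|k X Y XG YG].
  apply: Gkx => i; apply: lt_le_trans (xy i) _.
  by rewrite lef_pV2 ?posrE// ler_nat.
apply: (@hausdorff_outer_separated X Y (k.+1%:R^-1 - k.+2%:R^-1)).
  by rewrite subr_gt0 ltf_pV2 ?posrE// ltr_nat.
move=> x y /XG Gkx /YG/existsNP[z /not_implyP[yz Gz]].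
have /existsNP[i /negP] : ~ forall i, (`|x ord0 i - z ord0 i| < k.+1%:R^-1)%R.
  by move=> /Gkx.
rewrite -leNgt => xz; apply: le_trans (coord_le_enorm _ i).
rewrite !mxE lerBlDr; apply: (le_trans xz).
apply: (le_trans (ler_distD (y ord0 i) _ _)); rewrite lerD2l ltW//.
Qed.

End hausdorff_outer_measure.

Section hausdorff_measure_instance.
Context {R : realType} (n s : nat).
Local Open Scope ereal_scope.

Lemma borel_caratheodory_measurable (A : set (borel_rV R n)) : measurable A ->
  (hausdorff_outer n s : set 'rV[R]_n -> \bar R).-caratheodory A.
Proof.
suff : <<s @open 'rV[R]_n >> `<=`
    (hausdorff_outer n s : set 'rV[R]_n -> \bar R).-caratheodory by exact.
apply: (@smallest_sub _ (sigma_algebra setT) _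
    (hausdorff_outer n s : set 'rV[R]_n -> \bar R).-caratheodory).
  split; first exact: caratheodory_measurable_set0.
    by move=> B mB; rewrite setTD; exact: caratheodory_measurable_setC.
  exact: caratheodory_measurable_bigcup.
by move=> G oG; exact: open_caratheodory_measurable.
Qed.

Let mu : set (borel_rV R n) -> \bar R := hausdorff_measure s.+1.

Let mu0 : mu set0 = 0. Proof. exact: (outer_measure0 (hausdorff_outer n s)). Qed.
Let mu_ge0 A : 0 <= mu A. Proof. exact: (outer_measure_ge0 (hausdorff_outer n s)). Qed.
Let mu_sigma_additive : semi_sigma_additive mu.
Proof.
move=> F mF tF mUF.
apply: (@caratheodory_measure_sigma_additive R _ (hausdorff_outer n s)) => // [i|];
  exact: borel_caratheodory_measurable.
Qed.

HB.instance Definition _ := isMeasure.Build _ (borel_rV R n) R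
  (@hausdorff_measure R n s.+1) mu0 mu_ge0 mu_sigma_additive.

End hausdorff_measure_instance.

(** The ambient dimension is written [m.+2] so that [n.-1] reduces to a successor, the form in which
    the Hausdorff measure carries its measure structure. *)
HB.instance Definition _ (R : realType) m :=
  Measure.copy (@surface_measure R m.+2) (@hausdorff_measure R m.+2 m.+1).

(** * Hausdorff measure of Lipschitz images *)

Section hausdorff_lipschitz_image.
Context {R : realType} (n s : nat).

Lemma hausdorff_content_finite_cover (I : finType) (F : I -> set 'rV[R]_n)
    (A : set 'rV[R]_n) (delta d : R) :
  0 <= d <= delta -> A `<=` \bigcup_i F i ->
  (forall i, ediam (F i) <= d%:E)%E ->
  (hausdorff_content s.+1 delta A <= (#|I|%:R * d ^+ s.+1)%:E)%E.
Proof.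
move=> /andP[d0 ddelta] AF Fd.
pose G k := nth set0 [seq F i | i <- enum I] k.
have sG : size [seq F i | i <- enum I] = #|I| by rewrite size_map -cardE.
have Gd k : (ediam (G k) <= d%:E)%E.
  have [kI|Ik] := ltnP k #|I|; last by rewrite /G nth_default ?sG// ediam0 lee_fin.
  have /mapP[i _ ->] : G k \in [seq F i | i <- enum I] by rewrite mem_nth ?sG.
  exact: Fd.
apply: (@le_trans _ _ (\sum_(k <oo) ediam (G k) ^+ s.+1)%E).
  apply: ereal_inf_lbound; exists G => //; split=> [x /AF[i _ Fix]|k].
    exists (index i (enum I)) => //; rewrite /G (nth_map i) ?index_mem ?mem_enum//.
    by rewrite nth_index ?mem_enum.
  by rewrite (le_trans (Gd k))// lee_fin.
rewrite (nneseries_split _ #|I|); last by move=> k _; exact: expe_ediam_ge0.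
rewrite add0n [X in (_ + X)%E]eseries0 ?adde0; last first.
  by move=> k Ik _; rewrite /G nth_default ?sG// ediam0 expeS mul0e.
apply: (@le_trans _ _ (\sum_(0 <= i < #|I|) (d ^+ s.+1)%:E)%E).
  by apply: lee_sum => k _; rewrite EFin_expe le_expe// ediam_ge0.
by rewrite sumEFin sumr_const_nat subn0 mulr_natl.
Qed.

Lemma grid_cell (h u : R) (M : nat) : 0 <= u <= M.+1%:R * h ->
  exists k : 'I_M.+1, k%:R * h <= u <= k%:R * h + h.
Proof.
elim: M => [|M IH] /andP[u0 uh].
  by exists ord0; rewrite mul0r add0r u0 -[h]mul1r.
have [uM|Mu] := leP u (M.+1%:R * h).
  have [|k Hk] := IH; first by rewrite u0.
  by exists (widen_ord (leqnSn _) k).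
exists ord_max; rewrite (ltW Mu)/=; apply: le_trans uh _.
by rewrite -[X in _ + X]mul1r -mulrDl natr1.
Qed.

(** The cube is cut into [(M+1)^(s+1)] cells, with M so large that their images have diameter at
    most [D/(M+1) <= delta]. The number of cells times the power of this diameter is [D^(s+1)] for
    every M, which gives a bound uniform in [delta]. *)
Lemma hausdorff_lipschitz_image_cube (A : set 'rV[R]_s.+1)
    (phi : 'rV[R]_s.+1 -> 'rV[R]_n) (L l : R) (a : 'rV[R]_s.+1) :
  0 <= L -> 0 <= l ->
  (forall x y, A x -> A y -> enorm (phi x - phi y) <= L * enorm (x - y)) ->
  (forall x i, A x -> a ord0 i <= x ord0 i <= a ord0 i + l) ->
  (hausdorff_outer n s (phi @` A) <=
     (unit_ball_volume s.+1 / 2 ^+ s.+1 * (L * (s.+1%:R * l)) ^+ s.+1)%:E)%E.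
Proof.
move=> L0 l0 phiL Aa; set D := L * (s.+1%:R * l).
have D0 : 0 <= D by rewrite !mulr_ge0.
apply: hausdorff_outer_le => [|delta d0]; first exact: exprn_ge0.
pose M := Num.truncn (D / delta).
pose h := l / M.+1%:R.
have h0 : 0 <= h by rewrite divr_ge0.
pose F (f : {ffun 'I_s.+1 -> 'I_M.+1}) := phi @` [set x | A x /\ forall i,
  (f i)%:R * h <= x ord0 i - a ord0 i <= (f i)%:R * h + h].
have := @hausdorff_content_finite_cover _ F (phi @` A) delta (D / M.+1%:R).
rewrite card_ffun !card_ord natrX -exprMn mulrCA divff ?mulr1 ?pnatr_eq0//.
apply.
- rewrite divr_ge0//= ler_pdivrMr// mulrC -ler_pdivrMr//.
  exact/ltW/truncnS_gt.
- move=> _ [x Ax <-].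
  have ex i : exists k : 'I_M.+1, k%:R * h <= x ord0 i - a ord0 i <= k%:R * h + h.
    apply: grid_cell; rewrite /h mulrC divfK ?pnatr_eq0//.
    by have /andP[? ?] := Aa x i Ax; rewrite subr_ge0 lerBlDl; apply/andP.
  have /choice[f Hf] := ex.
  exists (finfun f) => //; exists x => //; split=> // i; by rewrite ffunE.
- move=> f; apply: ediam_le; first by rewrite divr_ge0.
  move=> _ _ [x [Ax fx] <-] [y [Ay fy] <-].
  apply: (le_trans (phiL _ _ Ax Ay)).
  rewrite /D -!mulrA ler_wpM2l// enorm_le// => i.
  rewrite !mxE -/h; have /andP[? ?] := fx i; have /andP[? ?] := fy i.
  rewrite ler_norml; apply/andP; split; lra.
Qed.

End hausdorff_lipschitz_image.

(** * Volume lower bounds for covers of a cube *)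

Section box_volume.
Context {R : realType}.

(** Countable subadditivity of volume for cubes of dimension [s + 1], stated without a measure on
    row vectors: it is proved from Lebesgue measure on R and from its square on R^2, the two
    dimensions of surfaces that occur. *)
Definition box_cover_bound (s : nat) : Prop :=
  forall (a : 'rV[R]_s.+1) (eps : R) (z : nat -> 'rV[R]_s.+1) (r : nat -> R),
  0 < eps -> (forall k, 0 <= r k) ->
  (forall x : 'rV[R]_s.+1, (forall i, `|x ord0 i - a ord0 i| < eps) ->
     exists k, forall i, `|x ord0 i - z k ord0 i| <= r k) ->
  (((2 * eps) ^+ s.+1)%:E <= \sum_(k <oo) ((2 * r k) ^+ s.+1)%:E)%E.

Let lebesgue_itv_closed (z r : R) : 0 <= r ->
  (@lebesgue_measure R `[(z - r)%R, (z + r)%R] = (2 * r)%:E)%E.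
Proof.
move=> r0; rewrite lebesgue_measure_itv/= lte_fin.
case: ltP => [_|zr]; first by rewrite -EFinB; congr EFin; ring.
suff -> : r = 0 by rewrite mulr0.
by apply/eqP; rewrite eq_le r0 andbT; lra.
Qed.

Let lebesgue_itv_open (z r : R) : 0 < r ->
  (@lebesgue_measure R `](z - r)%R, (z + r)%R[ = (2 * r)%:E)%E.
Proof.
move=> r0; rewrite lebesgue_measure_itv/= lte_fin ltrD2l gtrN// -EFinB.
by congr EFin; ring.
Qed.

Lemma box_cover_bound1 : box_cover_bound 0.
Proof.
move=> a eps z r eps0 r0 cov.
rewrite expr1 -(lebesgue_itv_open (a ord0 ord0))//.
rewrite (_ : \sum_(k <oo) _ = \sum_(k <oo) @lebesgue_measure R
  `[(z k ord0 ord0 - r k)%R, (z k ord0 ord0 + r k)%R])%E; last first.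
  by apply: eq_eseriesr => k _; rewrite expr1 lebesgue_itv_closed.
apply: measure_sigma_subadditive => //= t /=; rewrite in_itv/= => /andP[t1 t2].
have [|k Hk] := cov (const_mx t).
  by move=> i; rewrite mxE (ord1 i) ltr_norml; lra.
exists k => //=; have := Hk ord0; rewrite mxE in_itv/= ler_norml; lra.
Qed.

Lemma box_cover_bound2 : box_cover_bound 1.
Proof.
move=> a eps z r eps0 r0 cov.
pose lambda2 := (@lebesgue_measure R \x @lebesgue_measure R)%E.
pose O := `](a ord0 ord0 - eps)%R, (a ord0 ord0 + eps)%R[%classic `*`
          `](a ord0 ord_max - eps)%R, (a ord0 ord_max + eps)%R[%classic.
pose C k := `[(z k ord0 ord0 - r k)%R, (z k ord0 ord0 + r k)%R]%classic `*`
          `[(z k ord0 ord_max - r k)%R, (z k ord0 ord_max + r k)%R]%classic.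
have mO : measurable O by apply: measurableX.
have mC k : measurable (C k) by apply: measurableX.
have -> : ((2 * eps) ^+ 2)%:E = lambda2 O.
  by rewrite /lambda2 product_measure1E//= !lebesgue_itv_open// -EFinM expr2.
rewrite (_ : \sum_(k <oo) _ = \sum_(k <oo) lambda2 (C k))%E; last first.
  apply: eq_eseriesr => k _.
  by rewrite /lambda2 product_measure1E//= !lebesgue_itv_closed// -EFinM expr2.
apply: measure_sigma_subadditive => // -[u w].
rewrite /O/= !in_itv/= => -[/andP[u1 u2] /andP[w1 w2]].
have [|k Hk] := cov (\row_i if i == ord0 then u else w).
  move=> i; rewrite mxE; case: eqP => [->|/eqP i0]; first by rewrite ltr_norml; lra.
  have -> : i = ord_max by apply/val_inj; case: i i0 => -[|[|]].
  by rewrite ltr_norml; lra.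
exists k => //; rewrite /C/= !in_itv/=.
have := Hk ord0; have := Hk ord_max; rewrite !mxE/= !ler_norml => H1 H2.
by split; lra.
Qed.

End box_volume.

Section hausdorff_lower_bound.
Context {R : realType} (n s : nat).
Hypothesis hs : (s <= 1)%N.

(** A cover of the image pulls back to a cover of the box by cubes of half-side [diam (F k) / c],
    each centred at a preimage. Comparing volumes bounds the content at scale 1 below by
    [(c * eps)^(s+1)]. *)
Lemma hausdorff_expansive_image_gt0 (A : set 'rV[R]_s.+1)
    (phi : 'rV[R]_s.+1 -> 'rV[R]_n) (c eps : R) (a : 'rV[R]_s.+1) :
  0 < c -> 0 < eps ->
  (forall x y, A x -> A y -> c * enorm (x - y) <= enorm (phi x - phi y)) ->
  (forall x : 'rV[R]_s.+1, (forall i, `|x ord0 i - a ord0 i| < eps) -> A x) ->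
  (0 < hausdorff_outer n s (phi @` A))%E.
Proof.
move=> c0 eps0 phic Aa.
apply: (@hausdorff_outer_gt0 _ _ _ _ 1) => //.
apply: (@lt_le_trans _ _ ((c * eps) ^+ s.+1)%:E).
  by rewrite lte_fin exprn_gt0// mulr_gt0.
apply: le_ereal_inf_tmp => _ [F [AF dF] <-].
have dfin k : ediam (F k) \is a fin_num.
  by rewrite ge0_fin_numE ?ediam_ge0// (le_lt_trans (dF k))// ltry.
pose r k := fine (ediam (F k)) / c.
have r0 k : 0 <= r k by apply: divr_ge0; [exact/fine_ge0/ediam_ge0|exact: ltW].
pose E k := [set x | A x /\ F k (phi x)].
(* If [F k] misses the image, the centre defaults to 0; only the cubes of sets [F k] containing some
   [phi x] serve to cover the box. *)
pose z k := xget 0 (E k).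
have bnd : box_cover_bound (R := R) s.
  move: hs; case: (s) => [_|[_|//]]; [exact: box_cover_bound1|exact: box_cover_bound2].
have := bnd a eps z r eps0 r0.
rewrite (_ : \sum_(k <oo) _ = ((2 / c) ^+ s.+1)%:E * \sum_(k <oo) ediam (F k) ^+ s.+1)%E; last first.
  rewrite -nneseriesZl; last by move=> k _; exact: expe_ediam_ge0.
  by apply: eq_eseriesr => k _; rewrite -[in RHS](fineK (dfin k)) -EFin_expe -EFinM -exprMn /r mulrA mulrAC.
move=> H; have {}H := H _.
rewrite (_ : c * eps = c / 2 * (2 * eps)); last by field.
rewrite exprMn EFinM.
rewrite -lee_pdivlMl ?exprn_gt0 ?divr_gt0//.
rewrite -exprVn invf_div; apply: H => x /Aa Ax.
have [k _ Fk] : (\bigcup_k F k) (phi x) by apply: AF; exists x.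
exists k => i.
have [Az Fz] : E k (z k) by rewrite /z; case: xgetP => // /(_ x); case.
apply: (@le_trans _ _ (enorm (x - z k))).
  by have := coord_le_enorm (x - z k) i; rewrite !mxE.
rewrite /r ler_pdivlMr// mulrC; apply: (le_trans (phic _ _ Ax Az)).
by rewrite -lee_fin fineK//; exact: enorm_le_ediam.
Qed.

End hausdorff_lower_bound.

Section sup_norm.
Context {R : realType} (n : nat).
Implicit Types x : 'rV[R]_n.

Lemma coord_le_norm x i : `|x ord0 i| <= `|x|.
Proof.
rewrite [in leRHS]/Num.norm/= mx_normrE.
exact: (le_bigmax _ (fun ij : 'I_1 * 'I_n => `|x ij.1 ij.2|) (ord0, i)).
Qed.

Lemma norm_le_enorm x : `|x| <= enorm x.
Proof.
rewrite [in leLHS]/Num.norm/= mx_normrE; apply: bigmax_le => [|[i j] _ /=].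
  exact: enorm_ge0.
by rewrite (ord1 i) coord_le_enorm.
Qed.

Lemma enorm_le_norm x : enorm x <= n%:R * `|x|.
Proof. by apply: enorm_le => // i; exact: coord_le_norm. Qed.

End sup_norm.

Section compact_lipschitz_domains.
Context {R : realType} (d : nat).
Implicit Types K : set 'rV[R]_d.

Lemma compact_lipschitz_domain_compact K : compact_lipschitz_domain K -> compact K.
Proof.
rewrite /compact_lipschitz_domain; case: ifP => [_ [a [b [_ KE]]]|_ [D [_ [M [Mreal DM]] ->]]].
  rewrite (_ : K = [set v : 'rV[R]_d | forall i, `[a, b]%classic (v ord0 i)]).
    by apply: (@rV_compact R d (fun=> `[a, b]%classic)) => _; exact: segment_compact.
  by rewrite KE; apply/seteqP; split=> x /= Hx i; have := Hx i; rewrite in_itv.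
have cB : compact [set v : 'rV[R]_d | forall i, `[- (M + 1), M + 1]%classic (v ord0 i)].
  by apply: (@rV_compact R d (fun=> `[- (M + 1), M + 1]%classic)) => _; exact: segment_compact.
apply: (subclosed_compact _ cB); first exact: closed_closure.
apply: (@subset_trans _ (closure [set v : 'rV[R]_d | forall i, `[- (M + 1), M + 1]%classic (v ord0 i)])).
  apply: closureS => x Dx i /=; rewrite in_itv/= -ler_norml.
  by apply: le_trans (coord_le_norm _ _) _; apply: (DM (M + 1)); rewrite ?ltrDl.
rewrite -(closure_id _).1//; apply: (compact_closed _ cB); exact: norm_hausdorff.
Qed.

Lemma compact_lipschitz_domain_box K : compact_lipschitz_domain K ->
  exists a : 'rV[R]_d, exists2 eps : R, 0 < eps &
    forall x : 'rV[R]_d, (forall i, `|x ord0 i - a ord0 i| < eps) -> K x.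
Proof.
rewrite /compact_lipschitz_domain; case: ifP => [_ [a [b [ab ->]]]|_ [D [[oD _ [a Da] _] _ ->]]].
  exists (const_mx ((a + b) / 2)), ((b - a) / 2); first by rewrite divr_gt0// subr_gt0.
  move=> x Hx i; have := Hx i; rewrite mxE ltr_norml => /andP[? ?].
  apply/andP; split; lra.
have /nbhs_ballP[e /= e0 aeD] := open_nbhs_nbhs (conj oD Da).
exists a, e => // x ax; apply: subset_closure; apply: aeD; split=> // i j.
by rewrite (ord1 i) /ball/= distrC.
Qed.

End compact_lipschitz_domains.

(** * Bi-Lipschitz patches: compactness, growth of balls, positive measure *)

Section lipschitz_patch.
Context {R : realType} (m : nat).
Local Notation sigma := (@surface_measure R m.+2).

Definition lipschitz_patch (K : set 'rV[R]_m.+2) : Prop :=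
  exists (Khat : set 'rV[R]_m.+1) (phi : 'rV[R]_m.+1 -> 'rV[R]_m.+2),
    [/\ compact_lipschitz_domain Khat, bilipschitz_on Khat phi & K = phi @` Khat].

Lemma lipschitz_patch_compact K : lipschitz_patch K -> compact K.
Proof.
move=> [Khat [phi [/compact_lipschitz_domain_compact cK [c [C [c0 C0 phiC]]] ->]]].
apply: continuous_compact => //; apply/subspace_continuousP => x Kx.
apply/cvgrPdist_le => e e0; rewrite near_withinE.
near=> y => Ky; apply: (le_trans (norm_le_enorm _)).
have /andP[_ /le_trans] := phiC _ _ Kx Ky; apply.
rewrite mulrC -ler_pdivlMr//; apply: (le_trans (enorm_le_norm _)).
rewrite mulrC -ler_pdivlMr ?ltr0Sn//.
by near: y; apply: (@cvgr_dist_le _ _ _ _ _ id x) => //; rewrite !divr_gt0.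
Unshelve. all: by end_near. Qed.

Lemma lipschitz_patch_closed K : lipschitz_patch K -> closed K.
Proof. by move=> /lipschitz_patch_compact; apply: compact_closed; exact: norm_hausdorff. Qed.

Lemma closed_borel n (K : set (borel_rV R n)) : closed (K : set 'rV[R]_n) -> measurable K.
Proof.
move=> cK; rewrite -[K]setCK; apply: measurableC; apply: sub_sigma_algebra.
exact: closed_openC.
Qed.

Lemma lipschitz_patch_measurable (K : set (borel_rV R m.+2)) :
  lipschitz_patch K -> measurable K.
Proof. by move=> /lipschitz_patch_closed/closed_borel. Qed.

Lemma lipschitz_patch_ediam_fin K : lipschitz_patch K -> ediam K \is a fin_num.
Proof.
move=> /lipschitz_patch_compact/compact_bounded[M [Mreal KM]].
rewrite ge0_fin_numE ?ediam_ge0//.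
apply: (@le_lt_trans _ _ (m.+2%:R * (`|M| + 1 + (`|M| + 1)))%:E); last exact: ltry.
have MM : M < `|M| + 1 by rewrite (le_lt_trans (ler_norm _))// ltrDl.
apply: ediam_le => [|x y Kx Ky]; first by rewrite mulr_ge0// ?addr_ge0.
apply: (le_trans (enorm_le_norm _)); rewrite ler_wpM2l//.
apply: (le_trans (ler_normB _ _)); apply: lerD; exact: (KM _ MM).
Qed.

Lemma enorm_le_diam K x y : lipschitz_patch K -> K x -> K y -> enorm (x - y) <= diam K.
Proof.
move=> /lipschitz_patch_ediam_fin Kfin Kx Ky.
by rewrite -lee_fin /diam fineK//; exact: enorm_le_ediam.
Qed.

(** The part of the patch within r of x is the image of a set that, by the lower Lipschitz bound,
    fits into a cube of half-side [rho * r] around any of its points; the upper bound then controls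
    the image. The radius 0 is included: it shows that a patch of diameter 0 would be null. *)
Lemma lipschitz_patch_ahlfors K : lipschitz_patch K -> exists2 C : R, 0 <= C &
  forall (x : 'rV[R]_m.+2) r, 0 <= r ->
    (sigma (K `&` [set y | enorm (x - y) <= r]%R) <= (C * r ^+ m.+1)%:E)%E.
Proof.
move=> [Khat [phi [_ [c [L [c0 L0 phiC]]] ->]]].
(* Two points of the ball differ by at most 2 r in each coordinate, hence by at most [m.+2 * 2 * r]
   in norm; dividing by [c] carries this back to the parameters. *)
pose rho := m.+2%:R * 2 / c : R.
have rho0 : 0 <= rho by rewrite divr_ge0 ?mulr_ge0// ltW.
have rhoE : c * rho = m.+2%:R * 2.
  by rewrite /rho mulrCA divff ?mulr1// gt_eqF.
clearbody rho.
set C := unit_ball_volume m.+1 / 2 ^+ m.+1 * (L * (m.+1%:R * (2 * rho))) ^+ m.+1.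
have C_ge0 : 0 <= C.
  apply: mulr_ge0; first by rewrite divr_ge0 ?exprn_ge0// ltW// unit_ball_volume_gt0.
  by apply: exprn_ge0; rewrite !mulr_ge0// ltW.
exists C => //.
move=> x r r0; set A := [set z | Khat z /\ enorm (x - phi z) <= r].
have -> : phi @` Khat `&` [set y | enorm (x - y) <= r] = phi @` A.
  apply/seteqP; split=> [_ [[z Kz <-] /= xz]|_ [z [Kz xz] <-]]; first by exists z.
  by split=> //; exists z.
have [A0|/set0P[z0 [Kz0 xz0]]] := eqVneq A set0.
  by rewrite A0 image_set0 measure0 lee_fin mulr_ge0 ?exprn_ge0.
have := @hausdorff_lipschitz_image_cube R m.+2 m A phi L (2 * (rho * r))
  (\row_i (z0 ord0 i - rho * r)).
rewrite /C -(mulrA _ _ (r ^+ _)) -exprMn -!mulrA; apply.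
- exact: ltW.
- by rewrite !mulr_ge0.
- by move=> u v [Ku _] [Kv _]; have /andP[] := phiC _ _ Ku Kv.
- move=> z i [Kz xz].
  suff : `|z ord0 i - z0 ord0 i| <= rho * r.
    rewrite mxE ler_norml => /andP[? ?]; apply/andP; split; lra.
  have := coord_le_enorm (z - z0) i; rewrite !mxE => /le_trans; apply.
  rewrite -(ler_pM2l c0); have /andP[/le_trans + _] := phiC _ _ Kz Kz0; apply.
  rewrite mulrA rhoE -mulrA.
  apply: enorm_le; first by rewrite mulr_ge0.
  move=> j; rewrite !mxE.
  have := le_trans (coord_le_enorm _ j) xz; have := le_trans (coord_le_enorm _ j) xz0.
  rewrite !mxE !ler_norml => /andP[? ?] /andP[? ?]; apply/andP; split; lra.
Qed.

Lemma lipschitz_patch_measure_gt0 K : (m <= 1)%N -> lipschitz_patch K -> (0 < sigma K)%E.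
Proof.
move=> m1 [Khat [phi [/compact_lipschitz_domain_box[a [eps eps0 aK]] [c [L [c0 L0 phiC]]] ->]]].
apply: (hausdorff_expansive_image_gt0 (s := m) m1 c0 eps0 _ aK) => x y Kx Ky.
by have /andP[] := phiC _ _ Kx Ky.
Qed.

End lipschitz_patch.

(** * Seminorms of the anisotropic spaces *)

Lemma measurable_coord {R : realType} n (i : 'I_n) :
  measurable_fun setT (fun x : borel_rV R n => x ord0 i : R).
Proof.
apply: (measurability _ (RGenOInfty.measurableE R)) => _ [_ [a ->] <-].
rewrite setTI; apply: sub_sigma_algebra.
have -> : (fun x : borel_rV R n => x ord0 i) @^-1` `]a, +oo[%classic =
    (fun x : 'rV[R]_n => x ord0 i) @^-1` [set t | a < t].
  by apply/seteqP; split=> x /=; rewrite in_itv/= andbT.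
apply: open_comp; last exact: open_gt.
by move=> x _; exact: coord_continuous.
Qed.

Lemma measurable_enorm_dist {R : realType} n :
  measurable_fun setT (fun z : borel_rV R n * borel_rV R n => enorm (z.1 - z.2 : 'rV[R]_n)).
Proof.
have msqrt : measurable_fun setT (@Num.sqrt R).
  by apply: continuous_measurable_fun; exact: sqrt_continuous.
apply: (measurableT_comp msqrt); apply: measurable_sum => i.
under eq_fun do rewrite mxE [X in _ + X]mxE.
apply: measurable_funX; apply: measurable_funB; apply: (measurableT_comp (measurable_coord i)).
  exact: measurable_fst.
exact: measurable_snd.
Qed.

Lemma measurable_real_dist {R : realType} :
  measurable_fun setT (fun z : R * R => `|z.1 - z.2|).
Proof.
apply: (measurableT_comp (@normr_measurable R setT)).
by apply: measurable_funB.
Qed.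

Section time_interval.
Local Open Scope ereal_scope.
Context {R : realType} (T : R).
Hypothesis T0 : (0 < T)%R.

Local Notation lambda := (@lebesgue_measure R).
Local Notation I := (`]0%R, T[%classic : set R).

Lemma lebesgue_open_interval_lty : lambda I < +oo.
Proof. by rewrite lebesgue_measure_itv/= lte_fin T0 -EFinB ltry. Qed.

Definition time_measure := finrestr (mu := @lebesgue_measure R) (measurable_itv `]0%R, T[) lebesgue_open_interval_lty.

Lemma lebesgue_finite0 (F : set R) : finite_set F -> lambda F = 0.
Proof. by move=> /finite_set_countable/countable_lebesgue_measure0. Qed.

(** [J] may contain the endpoints 0 and T, where nothing relates [f] to [f']. They form a null set,
    and since every function is measurable on a singleton, [f] is measurable on [J] whatever its
    values there. *)
Lemma integral_time (J : set R) (f f' : R -> \bar R) :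
  measurable J -> J `<=` `[0%R, T]%classic -> (forall t, J t -> I t -> f t = f' t) ->
  measurable_fun setT f' -> (forall t, 0 <= f' t) ->
  \int[lambda]_(t in J) f t = \int[time_measure]_(t in J) f' t.
Proof.
move=> mJ JT ff' mf' f'0.
have split_J : J = (J `&` I) `|` ((J `&` [set 0%R]) `|` (J `&` [set T])).
  apply/seteqP; split=> [t Jt|t [[]|[[]|[]]]//].
  have := JT _ Jt; rewrite /= in_itv/= => /andP[t0 tT].
  have [te|t0'] := eqVneq t 0%R; first by right; left.
  have [te|tT'] := eqVneq t T; first by right; right.
  by left; split=> //=; rewrite in_itv/= !lt_neqAle eq_sym t0' t0 tT'.
have mpt (a : R) : measurable_fun (J `&` [set a]) f.
  have [Ja|nJa] := pselect (J a).
    rewrite (_ : J `&` [set a] = [set a]); first exact: measurable_fun_set1.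
    by apply/seteqP; split=> [t []//|t ->].
  rewrite (_ : J `&` [set a] = set0); first exact: measurable_fun_set0.
  by apply/seteqP; split=> // t [Jt ta]; apply: nJa; rewrite -ta.
have mf : measurable_fun J f.
  rewrite split_J; apply/measurable_funU; [exact: measurableI|by apply: measurableU; exact: measurableI|split].
    apply: (eq_measurable_fun f'); last exact: measurable_funTS.
    by move=> t /set_mem[Jt It]; rewrite ff'.
  by apply/measurable_funU; [exact: measurableI|exact: measurableI|split].
have N0 : lambda [set 0%R; T] = 0 by apply: lebesgue_finite0.
have mN : measurable ([set 0%R; T] : set R) by exact: measurableU.
transitivity (\int[lambda]_(t in J) f' t).
  apply: ae_eq_integral => //; first exact: measurable_funTS.
  exists [set 0%R; T]; split=> // t /= /not_implyP[Jt ft]; apply: contrapT => nt; apply: ft.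
  apply: ff' => //; move: (Jt); rewrite {1}split_J => -[[]//|[[_ e]|[_ e]]]; exfalso; apply: nt.
    by left.
  by right.
rewrite integral_finrestr//; last exact: measurable_funTS.
rewrite [LHS](ge0_negligible_integral (mu := @lebesgue_measure R) (N := [set 0%R; T]))//; last exact: measurable_funTS.
congr (integral _ _ _); apply/seteqP; split=> t.
  move=> [Jt nt]; split=> //; move: (Jt); rewrite {1}split_J => -[[]//|[[_ e]|[_ e]]]; exfalso; apply: nt.
    by left.
  by right.
by move=> [Jt]; rewrite /= in_itv/= => /andP[t0 tT]; split=> // -[] e; move: t0 tT; rewrite e ltxx.
Qed.

Lemma time_measure_ball (x rr : R) : (0 < rr)%R ->
  time_measure [set y | `|x - y| <= rr]%R <= (2 * rr ^+ 1)%:E.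
Proof.
move=> r0; apply: (@le_trans _ _ (lambda `[(x - rr)%R, (x + rr)%R])).
  apply: le_measure; rewrite ?inE.
  - apply: measurableI => //; rewrite (_ : [set y | _] = `[(x - rr)%R, (x + rr)%R]%classic)//.
    by apply/seteqP; split=> y /=; rewrite in_itv/= ler_distlC.
  - exact: measurable_itv.
  - by move=> y [/=]; rewrite ler_distlC in_itv.
rewrite lebesgue_measure_itv/=; case: ifP => _; last by rewrite lee_fin mulr_ge0// exprn_ge0// ltW.
rewrite -EFinB lee_fin expr1; lra.
Qed.

End time_interval.

Lemma restrict_indic_mule {T : Type} {R : realType} (D : set T) (f : T -> R) x :
  ((fun y => (f y)%:E) \_ D) x = (\1_D x * f x)%:E.
Proof. by rewrite patchE indicE; case: ifP => _; rewrite ?mul1r ?mul0r. Qed.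

(** * The norms of the anisotropic spaces as integrals of sliced seminorms *)

Section translation.
Local Open Scope ereal_scope.
Context {R : realType} (m : nat) (Gamma : set (borel_rV R m.+2)).
Hypothesis mGamma : measurable Gamma.
Hypothesis finGamma : @surface_measure R m.+2 Gamma < +oo.
Variable T : R.
Hypothesis T0 : (0 < T)%R.

Local Notation X := (borel_rV R m.+2).
Local Notation sigma := (@surface_measure R m.+2).
Local Notation lambda := (@lebesgue_measure R).
Local Notation I := (`]0%R, T[%classic : set R).

Definition space_measure := finrestr (mu := @surface_measure R m.+2) mGamma finGamma.

Local Notation mX := space_measure.
Local Notation mI := (time_measure T0).

Definition space_dist (x y : X) : R := enorm (x - y : 'rV[R]_m.+2).
Definition time_dist (t s : R) : R := `|t - s|%R.

Local Notation semiX mu := (seminorm2 mX space_dist m.+1 mu).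
Local Notation semiI nu := (seminorm2 mI time_dist 1 nu).

Lemma L2_norm2_finrestr omega (w : X -> R) : omega `<=` Gamma ->
  L2_norm2 omega w = \int[mX]_(x in omega) (w x ^+ 2)%:E.
Proof. by move=> oG; exact: (esym (integral_finrestr_sub mGamma finGamma _ oG)). Qed.

Lemma Hmu_seminorm2_finrestr mu omega (w : X -> R) : omega `<=` Gamma ->
  Hmu_seminorm2 mu omega w = semiX mu omega w.
Proof.
move=> oG.
transitivity (\int[mX]_(x in omega) \int[sigma]_(y in omega)
    (difference_quotient space_dist m.+1 mu w (x, y))%:E).
  exact: (esym (integral_finrestr_sub mGamma finGamma _ oG)).
apply: eq_integral => x _.
exact: (esym (integral_finrestr_sub mGamma finGamma _ oG)).
Qed.

Lemma eq_seminorm2 d (U : measurableType d) (mU : {sigma_finite_measure set U -> \bar R}) dist s mu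
    A (w w' : U -> R) : (forall x, A x -> w x = w' x) ->
  seminorm2 mU dist s mu A w = seminorm2 mU dist s mu A w'.
Proof.
move=> ww'; apply: eq_integral => x /set_mem Ax; apply: eq_integral => y /set_mem Ay.
by rewrite /difference_quotient/= !ww'.
Qed.

Variable v : R -> X -> R.
Hypothesis mv : measurable_fun (I `*` Gamma) (fun z : R * X => v z.1 z.2).

(** Extension by zero yields joint measurability on the whole product, as Tonelli requires; the
    restricted measures do not see the complement of (0,T) x Gamma. *)
Definition extend0 t x : R := ((fun z : R * X => v z.1 z.2) \_ (I `*` Gamma)) (t, x).

Local Notation v' := extend0.

Lemma extend0E t x : I t -> Gamma x -> v' t x = v t x.
Proof. by move=> It Gx; rewrite /extend0 patchE mem_set. Qed.

Lemma measurable_extend0 : measurable_fun setT (fun z : R * X => v' z.1 z.2).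
Proof.
have mIG : measurable (I `*` Gamma) by apply: measurableX.
rewrite (_ : (fun z => _) = (fun z : R * X => v z.1 z.2) \_ (I `*` Gamma)).
  by apply/(measurable_restrictT _ mIG).
by apply/funext => -[].
Qed.

Let mvs t : measurable_fun setT (v' t).
Proof. exact: (measurableT_comp measurable_extend0 (pair1_measurable t)). Qed.

Lemma measurable_space_dist : measurable_fun setT (fun z : X * X => space_dist z.1 z.2).
Proof. exact: measurable_enorm_dist. Qed.

Lemma measurable_time_dist : measurable_fun setT (fun z : R * R => time_dist z.1 z.2).
Proof. exact: measurable_real_dist. Qed.

Variables (J : set R) (omega : set X).
Hypothesis mJ : measurable J.
Hypothesis JT : J `<=` `[0%R, T]%classic.
Hypothesis momega : measurable omega.
Hypothesis omegaG : omega `<=` Gamma.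

Lemma L2J_Hmu_seminorm2E mu :
  L2J_norm2 J (Hmu_seminorm2 mu omega) v = \int[mI]_(t in J) semiX mu omega (v' t).
Proof.
apply: integral_time; [exact: mJ|exact: JT| | |].
- move=> t Jt It; rewrite (Hmu_seminorm2_finrestr _ _ omegaG).
  by apply: eq_seminorm2 => x ox; rewrite extend0E//; exact: omegaG.
- exact: (measurable_seminorm2_slice mX m.+1 mu measurable_space_dist measurable_extend0).
- by move=> t; exact: seminorm2_ge0.
Qed.

Let mL2 : measurable_fun setT (fun t => \int[mX]_(x in omega) (v' t x ^+ 2)%:E).
Proof.
under eq_fun do rewrite integral_mkcond.
pose F (z : R * X) : \bar R := (\1_omega z.2 * v' z.1 z.2 ^+ 2)%:E.
rewrite (_ : (fun t => _) = fubini_F mX F).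
  apply: measurable_fun_fubini_tonelli_F.
    apply/measurable_EFinP; apply: measurable_funM.
      by apply: (measurableT_comp _ measurable_snd); exact: measurable_indic.
    by apply: measurable_funX; exact: measurable_extend0.
  by move=> z; rewrite lee_fin mulr_ge0// sqr_ge0.
by apply/funext => t; apply: eq_integral => x _; rewrite restrict_indic_mule.
Qed.

Lemma L2J_L2_norm2E :
  L2J_norm2 J (L2_norm2 omega) v = \int[mI]_(t in J) \int[mX]_(x in omega) (v' t x ^+ 2)%:E.
Proof.
apply: integral_time; [exact: mJ|exact: JT| |exact: mL2|].
- move=> t Jt It; rewrite (L2_norm2_finrestr _ omegaG); apply: eq_integral => x /set_mem ox.
  by rewrite extend0E//; exact: omegaG.
- by move=> t; apply: integral_ge0 => x _; rewrite lee_fin sqr_ge0.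
Qed.

Lemma L2J_Hmu_norm2E mu : L2J_norm2 J (Hmu_norm2 mu omega) v =
  L2J_norm2 J (L2_norm2 omega) v + L2J_norm2 J (Hmu_seminorm2 mu omega) v.
Proof.
have msemi : measurable_fun setT (fun t => semiX mu omega (v' t)).
  exact: (measurable_seminorm2_slice mX m.+1 mu measurable_space_dist measurable_extend0).
have L20 t : 0 <= \int[mX]_(x in omega) (v' t x ^+ 2)%:E.
  by apply: integral_ge0 => x _; rewrite lee_fin sqr_ge0.
rewrite L2J_L2_norm2E L2J_Hmu_seminorm2E -(ge0_integralD mI mJ); last 4 first.
- by move=> t _; exact: L20.
- exact: (measurable_funTS mL2).
- by move=> t _; exact: seminorm2_ge0.
- exact: (measurable_funTS msemi).
apply: (integral_time T0); [exact: mJ|exact: JT| |exact: (emeasurable_funD mL2 msemi)|].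
- move=> t Jt It; rewrite /Hmu_norm2 (L2_norm2_finrestr _ omegaG) (Hmu_seminorm2_finrestr _ _ omegaG).
  have vv' x : omega x -> v t x = v' t x by move=> ox; rewrite extend0E//; exact: omegaG.
  rewrite (eq_seminorm2 _ _ _ _ (w := v t) vv').
  by rewrite (eq_integral (fun x => (v' t x ^+ 2)%:E))// => x /set_mem ox; rewrite vv'.
- by move=> t; rewrite adde_ge0 ?L20//; exact: seminorm2_ge0.
Qed.

Let H nu (z : R * R * X) : R := ((v' z.1.1 z.2 - v' z.1.2 z.2) ^+ 2 *
  (time_dist z.1.1 z.1.2 `^ kernel_exponent 1 nu)^-1)%R.

Let H0 nu z : (0 <= H nu z)%R.
Proof. by apply: mulr_ge0; rewrite ?sqr_ge0// invr_ge0 powR_ge0. Qed.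

Let mH nu : measurable_fun setT (H nu).
Proof.
apply: measurable_funM.
  apply: measurable_funX; apply: measurable_funB.
    apply: (measurableT_comp measurable_extend0 (measurable_fun_pair _ _)) => //.
    exact: (measurableT_comp measurable_fst measurable_fst).
  apply: (measurableT_comp measurable_extend0 (measurable_fun_pair _ _)) => //.
  exact: (measurableT_comp measurable_snd measurable_fst).
exact: (measurableT_comp (measurable_kernel 1 nu measurable_time_dist) measurable_fst).
Qed.

Let G nu t s : \bar R := \int[mX]_(x in omega) (H nu (t, s, x))%:E.

Let GE nu t s : G nu t s = \int[mX]_x (\1_omega x * H nu (t, s, x))%:E.
Proof. by rewrite /G integral_mkcond; apply: eq_integral => x _; rewrite restrict_indic_mule. Qed.

Let G0 nu t s : 0 <= G nu t s.
Proof. by apply: integral_ge0 => x _; rewrite lee_fin. Qed.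

Let momega2 : measurable_fun setT (fun z : R * R * X => \1_omega z.2 : R).
Proof. by apply: (measurableT_comp _ measurable_snd); exact: measurable_indic. Qed.

Let mG nu : measurable_fun setT (fun z : R * R => G nu z.1 z.2).
Proof.
under eq_fun do rewrite GE.
rewrite (_ : (fun z => _) = fubini_F mX (fun z => (\1_omega z.2 * H nu z)%:E)).
  apply: measurable_fun_fubini_tonelli_F.
    by apply/measurable_EFinP; apply: measurable_funM.
  by move=> z; rewrite lee_fin mulr_ge0.
by apply/funext => -[t s].
Qed.

Let mGs nu t : measurable_fun setT (G nu t).
Proof. exact: (measurableT_comp (mG nu) (pair1_measurable t)). Qed.

Let F nu (z : R * R * X) : R :=
  (\1_J z.1.1 * (\1_J z.1.2 * (\1_omega z.2 * H nu z)))%R.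

Let F0 nu z : (0 <= F nu z)%R.
Proof. by do 3 (apply: mulr_ge0 => //). Qed.

Let mF nu : measurable_fun setT (F nu).
Proof.
have mIJ : measurable_fun setT (\1_J : R -> R) by exact: measurable_indic.
apply: measurable_funM.
  exact: (measurableT_comp mIJ (measurableT_comp measurable_fst measurable_fst)).
apply: measurable_funM.
  exact: (measurableT_comp mIJ (measurableT_comp measurable_snd measurable_fst)).
exact: measurable_funM.
Qed.

(** The time kernel does not depend on x and moves under the space integral of the inner [L_2] norm;
    Tonelli then brings the space integral outermost, leaving a scalar time seminorm for each x. *)
Lemma HnuJ_seminorm2E nu :
  HnuJ_seminorm2 nu J (L2_norm2 omega) v = \int[mX]_(x in omega) semiI nu J (v' ^~ x).
Proof.
have inner_timeE t : I t ->
  \int[lambda]_(s in J) (L2_norm2 omega (fun x => (v t x - v s x)%R) *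
      (`|t - s| `^ (1 + 2 * nu))^-1%:E) = \int[mI]_(s in J) G nu t s.
  move=> It; apply: integral_time; [exact: mJ|exact: JT| |exact: mGs|exact: G0] => s Js Is.
  rewrite (L2_norm2_finrestr _ omegaG).
  rewrite (eq_integral (fun x => ((v' t x - v' s x) ^+ 2)%:E)); last first.
    by move=> x /set_mem ox; rewrite !extend0E//; exact: omegaG.
  rewrite /G /H/= -ge0_integralZr//.
  - apply: measurable_funTS; apply/measurable_EFinP; apply: measurable_funX.
    exact: measurable_funB.
  - by move=> x _; rewrite lee_fin sqr_ge0.
have mGJ : measurable_fun setT (fun t => \int[mI]_(s in J) G nu t s).
  under eq_fun do rewrite integral_mkcond.
  rewrite (_ : (fun t => _) = fubini_F mI (fun z => (\1_J z.2)%:E * G nu z.1 z.2)).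
    apply: measurable_fun_fubini_tonelli_F.
      apply: emeasurable_funM; last exact: mG.
      apply/measurable_EFinP.
      by apply: (measurableT_comp _ measurable_snd); exact: measurable_indic.
    by move=> z; rewrite mule_ge0.
  apply/funext => t; apply: eq_integral => s _.
  by rewrite patchE indicE; case: ifP => _; rewrite ?mul1e ?mul0e.
transitivity (\int[mI]_(t in J) \int[mI]_(s in J) G nu t s).
  apply: integral_time; [exact: mJ|exact: JT| |exact: mGJ|].
    by move=> t Jt It; exact: inner_timeE.
  by move=> t; apply: integral_ge0 => s _; exact: G0.
transitivity (\int[mI]_t \int[mI]_s \int[mX]_x (F nu (t, s, x))%:E).
  rewrite integral_mkcond; apply: eq_integral => t _; rewrite patchE; case: ifPn => tJ; last first.
    rewrite integral0_eq// => s _; rewrite integral0_eq// => x _.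
    by rewrite /F/= indicE (negbTE tJ) mul0r.
  rewrite integral_mkcond; apply: eq_integral => s _; rewrite patchE; case: ifPn => sJ; last first.
    rewrite integral0_eq// => x _.
    by rewrite /F/= [\1_J s]indicE (negbTE sJ) mul0r mulr0.
  rewrite GE; apply: eq_integral => x _.
  by rewrite /F/= [\1_J s]indicE [\1_J t]indicE tJ sJ !mul1r.
rewrite (tonelli3 mI mI mX (mF nu) (F0 nu)) [RHS]integral_mkcond; apply: eq_integral => x _.
rewrite patchE seminorm2_dint; case: ifPn => xo; last first.
  rewrite integral0_eq// => t _; rewrite integral0_eq// => s _.
  by rewrite /F/= [\1_omega x]indicE (negbTE xo) mul0r !mulr0.
apply: eq_integral => t _; apply: eq_integral => s _.
by rewrite /F/= [\1_omega x]indicE xo mul1r mulrA.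
Qed.

End translation.

(** * Prismatic meshes *)

Section mesh_basics.
Context {R : realType} (m : nat) (T : R) (Gamma : set 'rV[R]_m.+2).
Variable P : set (prism R m.+2).
Hypothesis T0 : 0 < T.
Hypothesis hP : prismatic_mesh T Gamma P.

Local Notation X := (borel_rV R m.+2).
Local Notation sigma := (@surface_measure R m.+2).
Local Notation lambda := (@lebesgue_measure R).

Definition mesh_seq : seq (prism R m.+2) := enum_fset (fset_set P).

Lemma mesh_seqP p : p \in mesh_seq <-> P p.
Proof.
have [finP _ _ _] := hP.
split=> [|Pp].
  by rewrite /mesh_seq => pin; apply: set_mem; rewrite -in_fset_set.
by have : p \in fset_set P by rewrite in_fset_set// mem_set.
Qed.

Lemma mesh_seq_uniq : uniq mesh_seq. Proof. exact: fset_uniq. Qed.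

Lemma mesh_patch p : P p -> lipschitz_patch p.2.
Proof.
have [_ prP _ _] := hP; move=> /prP[_ [Khat [phi [cK bK pE _]]]].
by exists Khat, phi.
Qed.

Lemma mesh_subset p : P p -> p.2 `<=` Gamma.
Proof. by have [_ prP _ _] := hP; move=> /prP[_ [Khat [phi []]]]. Qed.

Lemma mesh_measurable2 p : P p -> measurable (p.2 : set X).
Proof. by move=> /mesh_patch; exact: lipschitz_patch_measurable. Qed.

Lemma mesh_endpoints : exists lo hi : prism R m.+2 -> R, forall p, P p ->
  [/\ 0 <= lo p, lo p <= hi p, hi p <= T & p.1 = `[lo p, hi p]%classic].
Proof.
have [_ prP _ _] := hP.
have /choice[f Hf] : forall p, exists ab : R * R, P p ->
    [/\ 0 <= ab.1, ab.1 <= ab.2, ab.2 <= T & p.1 = `[ab.1, ab.2]%classic].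
  move=> p; have [/prP[[a [b ?]] _]|nP] := pselect (P p); first by exists (a, b).
  by exists (0, 0).
by exists (fst \o f), (snd \o f).
Qed.

Lemma mesh_measurable1 p : P p -> measurable p.1.
Proof.
have [lo [hi H]] := mesh_endpoints; move=> /H[_ _ _ ->]; exact: measurable_itv.
Qed.

Lemma mesh_time_subset p : P p -> p.1 `<=` `[0, T]%classic.
Proof.
have [lo [hi H]] := mesh_endpoints; move=> /H[l0 _ hT ->] t /=.
by rewrite !in_itv/= => /andP[? ?]; apply/andP; split; lra.
Qed.

Lemma mesh_cover t x : 0 < t < T -> Gamma x -> exists2 p, P p & p.1 t /\ p.2 x.
Proof.
have [_ _ _ cov] := hP; move=> tT Gx.
have : (`]0, T[%classic `*` Gamma) (t, x) by split=> //=; rewrite in_itv.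
by rewrite -cov => -[[p Pp [? ?]] _]; exists p.
Qed.

Lemma mesh_bigcup : Gamma = \bigcup_(p in P) p.2.
Proof.
apply/seteqP; split=> [x Gx|x [p Pp px]]; last exact: mesh_subset px.
(* The cells at any single interior time already cover Gamma. *)
have [|p Pp [_ px]] := mesh_cover (t := T / 2) (x := x) _ Gx; last by exists p.
by rewrite divr_gt0//= ltr_pdivrMr// ltr_pMr// ltr1n.
Qed.

Lemma mesh_Gamma_measurable : measurable (Gamma : set X).
Proof.
have [finP _ _ _] := hP; rewrite mesh_bigcup.
by apply: fin_bigcup_measurable => // p Pp; exact: mesh_measurable2.
Qed.

Lemma measurable_enorm_ball (x : X) (rr : R) :
  measurable ([set y : X | enorm (x - y : 'rV[R]_m.+2) <= rr] : set X).
Proof.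
rewrite -[X in measurable X]setTI.
apply: (measurable_fun_ler _ (measurable_cst rr)) => //.
exact: (measurableT_comp (@measurable_space_dist R m) (pair1_measurable x)).
Qed.

(** The constants of the finitely many cells add up. The resulting bound concerns Gamma alone, so a
    constant obtained from one mesh serves all others. *)
Lemma mesh_ahlfors : exists2 C : R, 0 <= C & forall (x : X) (rr : R), 0 < rr ->
  (sigma (Gamma `&` [set y : X | enorm (x - y : 'rV[R]_m.+2) <= rr]%R) <= (C * rr ^+ m.+1)%:E)%E.
Proof.
have [finP _ _ _] := hP.
have /choice[C HC] : forall p : prism R m.+2, exists C : R, 0 <= C /\ (P p ->
    forall (x : 'rV[R]_m.+2) rr, 0 <= rr ->
    (sigma (p.2 `&` [set y | enorm (x - y) <= rr]%R) <= (C * rr ^+ m.+1)%:E)%E).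
  move=> p; have [/mesh_patch/lipschitz_patch_ahlfors[C C0 CP]|nP] := pselect (P p).
    by exists C.
  by exists 0.
exists (\sum_(p <- mesh_seq) C p); first by apply: sumr_ge0 => p _; have [] := HC p.
move=> x rr rr0.
have mb (p : prism R m.+2) : P p ->
    measurable ((p.2 : set X) `&` [set y : X | enorm (x - y : 'rV[R]_m.+2) <= rr]).
  by move=> Pp; apply: measurableI; [exact: mesh_measurable2|exact: measurable_enorm_ball].
apply: (@le_trans _ _ (\sum_(p \in P) sigma ((p.2 : set X) `&`
    [set y : X | enorm (x - y : 'rV[R]_m.+2) <= rr]%R))%E).
  apply: (content_sub_fsum (@surface_measure R m.+2)) => //.
    apply: measurableI; [exact: mesh_Gamma_measurable|exact: measurable_enorm_ball].
  by rewrite mesh_bigcup setI_bigcupl.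
rewrite fsbig_finite//= mulr_suml -sumEFin big_seq [leRHS]big_seq.
apply: lee_sum => p /mesh_seqP Pp; have [_ H] := HC p.
by apply: H => //; exact: ltW.
Qed.

(** A nonempty patch lies in the ball of radius its diameter about any of its points, so the growth
    bound makes its measure finite. *)
Lemma mesh_Gamma_lty : (sigma Gamma < +oo)%E.
Proof.
have [finP _ _ _] := hP.
apply: (@le_lt_trans _ _ (\sum_(p \in P) sigma (p.2 : set X))%E).
  apply: (content_sub_fsum (@surface_measure R m.+2)) => //.
  - by move=> p /mesh_measurable2.
  - exact: mesh_Gamma_measurable.
  - by rewrite mesh_bigcup.
rewrite fsbig_finite//= big_seq; apply: lte_sum_pinfty => p /mesh_seqP Pp.
have [K0|/set0P[x Kx]] := eqVneq p.2 set0; first by rewrite K0 measure0.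
have [C C0 HC] := lipschitz_patch_ahlfors (mesh_patch Pp).
have d0 : 0 <= diam p.2 by apply: fine_ge0; exact: ediam_ge0.
apply: le_lt_trans (ltry (C * diam p.2 ^+ m.+1)).
apply: le_trans (HC x _ d0); rewrite setIidl// => y Ky.
exact: enorm_le_diam (mesh_patch Pp) Kx Ky.
Qed.

(** Evaluated by sections, straight from the definition, because the surface measure on all of R^n
    is not sigma-finite. *)
Lemma product_measure_rectangle (A : set R) (B : set X) : measurable A -> measurable B ->
  ((lambda \x sigma) (A `*` B) = lambda A * sigma B)%E.
Proof.
move=> mA mB.
transitivity (\int[lambda]_t ((\1_A t)%:E * sigma B))%E.
  apply: eq_integral => t _ /=; rewrite indicE; have [tA|tA] := boolP (t \in A).
    by rewrite in_xsectionX// mul1e.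
  by rewrite notin_xsectionX// measure0 mul0e.
rewrite ge0_integralZr//; last by apply/measurable_EFinP; exact: measurable_indic.
by rewrite integral_indic// setIT.
Qed.

Lemma mesh_overlap p q : P p -> P q -> p <> q ->
  (lambda (p.1 `&` q.1) = 0 \/ sigma (p.2 `&` q.2) = 0)%E.
Proof.
have [_ _ dis _] := hP; move=> Pp Pq pq; have := dis _ _ Pp Pq pq.
have -> : prism_set p `&` prism_set q = (p.1 `&` q.1) `*` (p.2 `&` q.2).
  by apply/seteqP; split=> -[t x] /=; rewrite /prism_set/=; tauto.
rewrite product_measure_rectangle.
- by move=> /eqP; rewrite mule_eq0 => /orP[/eqP|/eqP]; [left|right].
- by apply: measurableI; exact: mesh_measurable1.
- by apply: measurableI; exact: mesh_measurable2.
Qed.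

End mesh_basics.

Section mesh_slices.
Context {R : realType} (m : nat) (T : R) (Gamma : set 'rV[R]_m.+2).
Variable P : set (prism R m.+2).
Hypothesis T0 : 0 < T.
Hypothesis m1 : (m <= 1)%N.
Hypothesis hP : prismatic_mesh T Gamma P.
Hypothesis mGamma : measurable (Gamma : set (borel_rV R m.+2)).
Hypothesis finGamma : (@surface_measure R m.+2 Gamma < +oo)%E.

Local Notation X := (borel_rV R m.+2).
Local Notation sigma := (@surface_measure R m.+2).
Local Notation lambda := (@lebesgue_measure R).
Local Notation mX := (space_measure mGamma finGamma).
Local Notation mI := (time_measure T0).
Local Notation ms := (mesh_seq P).
Local Notation msP := (mesh_seqP hP).

Let ae_spaceS (Q1 Q2 : X -> Prop) : (forall x, Q1 x -> Q2 x) ->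
  {ae mX, forall x, Q1 x} -> {ae mX, forall x, Q2 x}.
Proof. exact: (@filterS _ _ (ae_filter_ringOfSetsType mX)). Qed.

Let ae_timeS (Q1 Q2 : R -> Prop) : (forall t, Q1 t -> Q2 t) ->
  {ae mI, forall t, Q1 t} -> {ae mI, forall t, Q2 t}.
Proof. exact: (@filterS _ _ (ae_filter_ringOfSetsType mI)). Qed.

(* The factors of a prism, replaced by the empty set outside the mesh so that
   they are measurable for every index. *)
Definition time_factor (p : prism R m.+2) : set R := if p \in ms then p.1 else set0.
Definition space_factor (p : prism R m.+2) : set X := if p \in ms then p.2 else set0.

Definition time_touch (p q : prism R m.+2) : bool := `[< p.1 `&` q.1 !=set0 >].
Definition space_touch (p q : prism R m.+2) : bool := `[< p.2 `&` q.2 !=set0 >].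

Lemma time_touchC : symmetric time_touch.
Proof. by move=> p q; rewrite /time_touch setIC. Qed.

Lemma space_touchC : symmetric space_touch.
Proof. by move=> p q; rewrite /space_touch setIC. Qed.

Lemma time_factorE p : P p -> time_factor p = p.1.
Proof. by move=> /msP pm; rewrite /time_factor pm. Qed.

Lemma space_factorE p : P p -> space_factor p = p.2.
Proof. by move=> /msP pm; rewrite /space_factor pm. Qed.

Lemma measurable_time_factor p : measurable (time_factor p).
Proof. by rewrite /time_factor; case: ifP => // /msP /(mesh_measurable1 hP). Qed.

Lemma measurable_space_factor p : measurable (space_factor p).
Proof. by rewrite /space_factor; case: ifP => // /msP /(mesh_measurable2 hP). Qed.

Lemma active_timeP t p : p \in active ms time_factor t <-> P p /\ p.1 t.
Proof.
rewrite mem_filter; split=> [/andP[/set_mem + /msP Pp]|[Pp pt]].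
  by rewrite time_factorE.
by rewrite time_factorE// mem_set//; exact/msP.
Qed.

Lemma active_spaceP x p : p \in active ms space_factor x <-> P p /\ p.2 x.
Proof.
rewrite mem_filter; split=> [/andP[/set_mem + /msP Pp]|[Pp px]].
  by rewrite space_factorE.
by rewrite space_factorE// mem_set//; exact/msP.
Qed.

Lemma mesh_patch_gt0 p : P p -> (0 < sigma p.2)%E.
Proof. by move=> /(mesh_patch hP) /(lipschitz_patch_measure_gt0 m1). Qed.

(** A cell of diameter 0 would lie in a ball of radius 0, which the growth bound makes null. *)
Lemma mesh_diam_gt0 p : P p -> 0 < diam p.2.
Proof.
move=> Pp; have d0 : 0 <= diam p.2 by apply: fine_ge0; exact: ediam_ge0.
rewrite lt_neqAle d0 andbT; apply/eqP => d00.
have [C C0 HC] := lipschitz_patch_ahlfors (mesh_patch hP Pp).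
have [K0|/set0P[x Kx]] := eqVneq p.2 set0.
  by have := mesh_patch_gt0 Pp; rewrite K0 measure0 ltxx.
have := mesh_patch_gt0 Pp; rewrite ltNge => /negP; apply.
have := HC x 0 (lexx _); rewrite expr0n/= mulr0 setIidl// => y Ky.
by rewrite /= d00; exact: enorm_le_diam (mesh_patch hP Pp) Kx Ky.
Qed.

Variables lo hi : prism R m.+2 -> R.
Hypothesis lohiP : forall p, P p ->
  [/\ 0 <= lo p, lo p <= hi p, hi p <= T & p.1 = `[lo p, hi p]%classic].

Lemma mesh_time_lebesgue p : P p -> lambda p.1 = (hi p - lo p)%:E.
Proof.
move=> Pp; have [_ lh _ ->] := lohiP Pp.
rewrite lebesgue_measure_itv/= lte_fin; case: ltP => [_|hl]; first by rewrite -EFinB.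
by congr EFin; apply/esym/eqP; rewrite subr_eq0 eq_le hl lh.
Qed.

Lemma mesh_timeI p q : P p -> P q ->
  p.1 `&` q.1 = `[Num.max (lo p) (lo q), Num.min (hi p) (hi q)]%classic.
Proof.
move=> Pp Pq; have [_ _ _ ->] := lohiP Pp; have [_ _ _ ->] := lohiP Pq.
apply/seteqP; split=> t /=; rewrite !in_itv/= ge_max le_min.
  by move=> [/andP[-> ->] /andP[-> ->]].
by move=> /andP[/andP[-> ->] /andP[-> ->]].
Qed.

Lemma mesh_timeI_gt0 p q : P p -> P q ->
  (0 < lambda (p.1 `&` q.1))%E = (Num.max (lo p) (lo q) < Num.min (hi p) (hi q)).
Proof.
move=> Pp Pq; rewrite mesh_timeI// lebesgue_measure_itv/= lte_fin.
by case: ifP => [h|_]; rewrite ?ltxx// -EFinB lte_fin subr_gt0 h.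
Qed.

Lemma time_touchE p q : P p -> P q -> time_touch p q = touching lo hi p q.
Proof.
move=> Pp Pq; have [_ lp _ _] := lohiP Pp; have [_ lq _ _] := lohiP Pq.
apply/asboolP/andP.
  rewrite mesh_timeI// => -[t] /=; rewrite in_itv/= ge_max le_min.
  by move=> /andP[/andP[a b] /andP[c d]]; split; lra.
move=> [a b]; rewrite mesh_timeI//; exists (Num.max (lo p) (lo q)).
by rewrite /= in_itv/= lexx le_min !ge_max lp lq a b.
Qed.

(** Away from the finitely many endpoints, t is interior to every interval containing it, so two
    such intervals overlap in positive length. Disjointness of prisms then forces their cells to
    overlap in a null set. *)
Lemma generic_time : {ae mI, forall t, 0 < t < T /\
  forall p q, P p -> P q -> p.1 t -> q.1 t -> (0 < lambda (p.1 `&` q.1))%E}.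
Proof.
pose E : set R := [set` ([seq lo p | p <- ms] ++ [seq hi p | p <- ms])].
have E0 : lambda E = 0%E by apply: lebesgue_finite0; exact: finite_seq.
have mE : measurable E.
  apply: countable_measurable => [x|]; first exact: measurable_set1.
  by apply: finite_set_countable; exact: finite_seq.
have H1 := ae_notin (finrestr_negligible (mu := @lebesgue_measure R) (measurable_itv `]0%R, T[) (lebesgue_open_interval_lty T0) mE E0).
have H2 : {ae mI, forall t, t \in `]0, T[} :=
  finrestr_ae (mu := @lebesgue_measure R) (measurable_itv `]0%R, T[) (lebesgue_open_interval_lty T0).
apply: filterS2 H1 H2 => t nE tI; split; first by move: tI; rewrite in_itv.
have interior p : P p -> p.1 t -> lo p < t < hi p.
  move=> Pp; have [_ _ _ ->] := lohiP Pp; rewrite /= in_itv/= => /andP[t1 t2].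
  rewrite !lt_neqAle t1 t2 !andbT; apply/andP; split; apply/eqP => e; apply: nE;
    rewrite /E/= mem_cat; apply/orP.
    by left; rewrite -e; apply: map_f; exact/msP.
  by right; rewrite e; apply: map_f; exact/msP.
move=> p q Pp Pq /(interior _ Pp)/andP[? ?] /(interior _ Pq)/andP[? ?].
by rewrite mesh_timeI_gt0// gt_max !lt_min; do !(apply/andP; split); lra.
Qed.

(** There are finitely many pairs of cells; the null ones among their intersections are discarded.
    Elsewhere cells sharing a point overlap in positive measure, so distinct prisms over it have
    time intervals with null overlap. *)
Lemma generic_space : {ae mX, forall x, Gamma x /\
  forall p q, P p -> P q -> p.2 x -> q.2 x -> (0 < sigma (p.2 `&` q.2))%E}.
Proof.
have H2 : {ae mX, forall x, Gamma x} :=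
  finrestr_ae (mu := @surface_measure R m.+2) mGamma finGamma.
have H1 : {ae mX, forall x, forall p, p \in ms -> forall q, q \in ms ->
    p.2 x -> q.2 x -> (0 < sigma (p.2 `&` q.2))%E}.
  apply: filter_forall_in => p pms; apply: filter_forall_in => q qms.
  have [s0|s0] := boolP (0 < sigma (p.2 `&` q.2))%E; first by apply: aeW.
  have mpq : measurable ((p.2 `&` q.2) : set X).
    by apply: measurableI; apply: (mesh_measurable2 hP); exact/msP.
  have /(finrestr_negligible (mu := @surface_measure R m.+2) mGamma finGamma mpq)/ae_notin : sigma (p.2 `&` q.2) = 0%E.
    by apply/eqP; rewrite eq_le measure_ge0 andbT leNgt.
  by apply: filterS => x npq px qx; exfalso; apply: npq.
apply: filterS2 H1 H2 => x H Gx; split=> // p q Pp Pq.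
by apply: H; exact/msP.
Qed.

Lemma mesh_space_null p q : P p -> P q -> p <> q ->
  (0 < lambda (p.1 `&` q.1))%E -> sigma (p.2 `&` q.2) = 0%E.
Proof. by move=> Pp Pq pq; have [->|//] := mesh_overlap hP Pp Pq pq; rewrite ltxx. Qed.

(** * The cells of the mesh at a generic time *)

Section time_slices.
Variables (Cnei Cdist : R).
Hypothesis Cdist1 : 1 <= Cdist.
Variable t : R.
Hypothesis tT : 0 < t < T.
Hypothesis gen : forall p q, P p -> P q -> p.1 t -> q.1 t -> (0 < lambda (p.1 `&` q.1))%E.

Let act := active ms time_factor t.

Lemma mesh_time_slice p : P p -> p.1 t -> time_slice Gamma P t p.2.
Proof.
move=> Pp pt; exists p.1; split; first by case: p Pp pt.
have [K0|/set0P[x px]] := eqVneq p.2 set0.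
  by have := mesh_patch_gt0 Pp; rewrite K0 measure0 ltxx.
exists (t, x); split=> //; split=> //; exact: (mesh_subset hP Pp).
Qed.

Lemma active_null p q : p \in act -> q \in act -> p != q -> sigma (p.2 `&` q.2) = 0%E.
Proof.
move=> /active_timeP[Pp pt] /active_timeP[Pq qt] /eqP pq.
exact: (mesh_space_null Pp Pq pq (gen Pp Pq pt qt)).
Qed.

Lemma space_touch_count p : p \in act ->
  (forall K, time_slice Gamma P t K ->
    #|` fset_set [set K' | time_slice Gamma P t K' /\ K `&` K' !=set0]|%:R <= Cnei) ->
  \sum_(q <- act | space_touch p q) (1 : R) <= Cnei.
Proof.
move=> pact; have /active_timeP[Pp pt] := pact.
move=> /(_ _ (mesh_time_slice Pp pt)); apply: le_trans.
rewrite big_const_seq iter_addr_0 ler_nat -size_filter.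
set s := seq.filter _ _.
(* mesh_nei counts cells, not prisms: two prisms over the same cell active at
   the same time would overlap, as a cell has positive surface measure. *)
have us : uniq [seq q.2 | q <- s].
  rewrite map_inj_in_uniq; first by rewrite filter_uniq// filter_uniq// mesh_seq_uniq.
  move=> q q'; rewrite /s mem_filter => /andP[_ qa]; rewrite mem_filter => /andP[_ qa'] qq'.
  apply/eqP/negPn/negP => nqq'; have := active_null qa qa' nqq'.
  have /active_timeP[Pq _] := qa; have := mesh_patch_gt0 Pq.
  by rewrite qq' setIid => /[swap] ->; rewrite ltxx.
rewrite -(size_map (fun q : prism R m.+2 => q.2)); apply: uniq_leq_size => // K /mapP[q + ->].
rewrite mem_filter => /andP[/asboolP pq /active_timeP[Pq qt]].
rewrite in_fset_set; first by rewrite mem_set//; split=> //; exact: mesh_time_slice.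
have [finP _ _ _] := hP.
apply: sub_finite_set (finite_image snd finP) => K' [[J [PJ _]] _].
by exists (J, K').
Qed.

Lemma space_indicator_sum :
  (forall K, time_slice Gamma P t K ->
    #|` fset_set [set K' | time_slice Gamma P t K' /\ K `&` K' !=set0]|%:R <= Cnei) ->
  {ae mX, forall x, \sum_(p <- act) \sum_(q <- act | space_touch p q)
     \1_(space_factor p `|` space_factor q) x <= Cnei + Cnei}.
Proof.
move=> nei; have := generic_space; apply: ae_spaceS => x [Gx genx].
have [p0 Pp0 [p0t p0x]] := mesh_cover hP tT Gx.
have p0act : p0 \in act by apply/active_timeP.
(* A second active cell containing x would overlap that of [p0] in positive surface measure, by the
   choice of x, while the choice of t makes their overlap null. *)
have only p : p \in act -> p.2 x -> p = p0.
  move=> pact px; apply/eqP/negPn/negP => /(active_null pact p0act).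
  have /active_timeP[Pp _] := pact; have := genx _ _ Pp Pp0 px p0x.
  by move=> /[swap] ->; rewrite ltxx.
apply: (double_count_le (p := p0)) => //.
- by rewrite filter_uniq// mesh_seq_uniq.
- exact: space_touchC.
- move=> p q pact qact.
  have /active_timeP[Pp _] := pact; have /active_timeP[Pq _] := qact.
  rewrite !space_factorE// indicE; case: (boolP (x \in _)) => [/set_mem[px|qx]|_] /=.
  + by rewrite (only _ pact px) eqxx lerDl.
  + by rewrite (only _ qact qx) eqxx lerDr.
  + by rewrite addr_ge0.
- exact: space_touch_count.
Qed.

Lemma space_separation :
  (forall K K', time_slice Gamma P t K -> time_slice Gamma P t K' ->
      K `&` K' = set0 -> diam K <= Cdist * set_dist K K') ->
  forall p q (x y : X), p \in act -> q \in act -> ~~ space_touch p q ->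
    space_factor p x -> space_factor q y ->
    diam p.2 / Cdist <= space_dist x y /\ diam q.2 / Cdist <= space_dist x y.
Proof.
move=> dist p q x y /active_timeP[Pp pt] /active_timeP[Pq qt] /asboolPn npq.
rewrite !space_factorE// => px qy.
have Cd0 : 0 < Cdist by rewrite (lt_le_trans _ Cdist1).
have key (K K' : set 'rV[R]_m.+2) (a b : 'rV[R]_m.+2) : K a -> K' b -> set_dist K K' <= enorm (a - b).
  move=> Ka Kb; apply: ge_inf; last by exists (a, b).
  by exists 0 => _ [ab _ <-]; exact: enorm_ge0.
have e0 : p.2 `&` q.2 = set0 by apply/seteqP; split=> // z pqz; apply: npq; exists z.
rewrite !ler_pdivrMr// ![_ * Cdist]mulrC; split.
  apply: (le_trans (dist _ _ (mesh_time_slice Pp pt) (mesh_time_slice Pq qt) e0)).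
  by rewrite ler_pM2l// key.
rewrite setIC in e0.
apply: (le_trans (dist _ _ (mesh_time_slice Pq qt) (mesh_time_slice Pp pt) e0)).
by rewrite ler_pM2l// /space_dist enorm_distC key.
Qed.

Lemma space_cover : {ae mX, forall x, exists2 p, p \in act & space_factor p x}.
Proof.
have := generic_space; apply: ae_spaceS => x [Gx _].
have [p Pp [pt px]] := mesh_cover hP tT Gx.
by exists p; [apply/active_timeP|rewrite space_factorE].
Qed.

End time_slices.

(** * The time intervals above a generic boundary point *)

Section space_slices.
Variable Clqu : R.
Hypothesis Clqu1 : 1 <= Clqu.
Variable x : X.
Hypothesis Gx : Gamma x.
Hypothesis gen : forall p q, P p -> P q -> p.2 x -> q.2 x -> (0 < sigma (p.2 `&` q.2))%E.
Hypothesis hlqu : forall J J', space_slice T P x J -> space_slice T P x J' ->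
  J `&` J' !=set0 -> (lambda J <= Clqu%:E * lambda J')%E.

Let act := active ms space_factor x.

Let C0 : 0 < Clqu. Proof. exact: lt_le_trans Clqu1. Qed.
Let uact : uniq act. Proof. by rewrite filter_uniq// mesh_seq_uniq. Qed.

Let act_lohi p : p \in act -> [/\ 0 <= lo p, lo p <= hi p & hi p <= T].
Proof. by move=> /active_spaceP[/lohiP[]]. Qed.

Let act_overlap p q : p \in act -> q \in act -> p != q -> lambda (p.1 `&` q.1) = 0%E.
Proof.
move=> /active_spaceP[Pp px] /active_spaceP[Pq qx] /eqP pq.
by have := gen Pp Pq px qx; have [//|->] := mesh_overlap hP Pp Pq pq; rewrite ltxx.
Qed.

Let act_nonoverlap p q : p \in act -> q \in act -> p != q ->
  Num.min (hi p) (hi q) <= Num.max (lo p) (lo q).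
Proof.
move=> pa qa pq; have := act_overlap pa qa pq.
move: pa qa => /active_spaceP[Pp px] /active_spaceP[Pq qx] l0.
by rewrite leNgt -mesh_timeI_gt0// l0 ltxx.
Qed.

Let act_cover t : 0 < t < T -> exists2 p, p \in act & lo p <= t <= hi p.
Proof.
move=> tT; have [p Pp [pt px]] := mesh_cover hP tT Gx.
exists p; first exact/active_spaceP.
by move: pt; have [_ _ _ ->] := lohiP Pp; rewrite /= in_itv.
Qed.

Let mesh_space_slice p : P p -> p.2 x -> space_slice T P x p.1.
Proof.
move=> Pp px; exists p.2; split; first by case: p Pp px.
have [l0 lh hT pE] := lohiP Pp.
exists (lo p, x); split; split=> //=; first by rewrite in_itv/= l0 (le_trans lh).
by rewrite pE/= in_itv/= lexx.
Qed.

Let act_lqu p q : p \in act -> q \in act -> touching lo hi p q ->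
  hi p - lo p <= Clqu * (hi q - lo q).
Proof.
move=> /active_spaceP[Pp px] /active_spaceP[Pq qx]; rewrite -time_touchE// => /asboolP pq.
have := hlqu (mesh_space_slice Pp px) (mesh_space_slice Pq qx) pq.
by rewrite !mesh_time_lebesgue// -EFinM lee_fin.
Qed.

Lemma time_factor_gt0 p : p \in act -> 0 < fine (lambda p.1) / Clqu.
Proof.
move=> pa; have /active_spaceP[Pp _] := pa; rewrite mesh_time_lebesgue//= divr_gt0//.
by rewrite subr_gt0; exact: (partition_nondegenerate T0 act_lohi act_cover act_lqu).
Qed.

Lemma time_separation p q t s : p \in act -> q \in act -> ~~ time_touch p q ->
  time_factor p t -> time_factor q s ->
  fine (lambda p.1) / Clqu <= time_dist t s /\ fine (lambda q.1) / Clqu <= time_dist t s.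
Proof.
move=> pa qa; have /active_spaceP[Pp _] := pa; have /active_spaceP[Pq _] := qa.
rewrite time_touchE// => npq; rewrite !time_factorE// => pt qs.
rewrite !mesh_time_lebesgue//=.
apply: (partition_separation T0 C0 act_lohi act_nonoverlap act_cover act_lqu) => //.
  by move: pt; have [_ _ _ ->] := lohiP Pp; rewrite /= in_itv.
by move: qs; have [_ _ _ ->] := lohiP Pq; rewrite /= in_itv.
Qed.

Lemma time_cover : {ae mI, forall t, exists2 p, p \in act & time_factor p t}.
Proof.
have := generic_time; apply: ae_timeS => t [tT _].
have [p Pp [pt px]] := mesh_cover hP tT Gx.
by exists p; [apply/active_spaceP|rewrite time_factorE].
Qed.

Lemma time_indicator_sum :
  {ae mI, forall t, \sum_(p <- act) \sum_(q <- act | time_touch p q)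
     \1_(time_factor p `|` time_factor q) t <= 3 + 3 :> R}.
Proof.
have := generic_time; apply: ae_timeS => t [tT gent].
have [p0 Pp0 [p0t p0x]] := mesh_cover hP tT Gx.
have p0act : p0 \in act by apply/active_spaceP.
have only p : p \in act -> p.1 t -> p = p0.
  move=> pact pt; apply/eqP/negPn/negP => /(act_overlap pact p0act).
  have /active_spaceP[Pp _] := pact; have := gent _ _ Pp Pp0 pt p0t.
  by move=> /[swap] ->; rewrite ltxx.
apply: (double_count_le (p := p0)) => //.
- exact: time_touchC.
- move=> p q pact qact.
  have /active_spaceP[Pp _] := pact; have /active_spaceP[Pq _] := qact.
  rewrite !time_factorE// indicE; case: (boolP (t \in _)) => [/set_mem[pt|qt]|_] /=.
  + by rewrite (only _ pact pt) eqxx lerDl.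
  + by rewrite (only _ qact qt) eqxx lerDr.
  + by rewrite addr_ge0.
- rewrite big_seq_cond (eq_bigl (fun q => (q \in act) && touching lo hi p0 q)).
    rewrite -big_seq_cond.
    exact: (partition_touching_count uact T0 act_lohi act_nonoverlap act_cover act_lqu).
  move=> q; case: (boolP (q \in act)) => //= /active_spaceP[Pq _].
  by rewrite time_touchE.
Qed.

End space_slices.

End mesh_slices.

(** * Estimates for a fixed mesh *)

Section restricted_integrals.
Local Open Scope ereal_scope.
Context d (U : measurableType d) (R : realType) (m : {sigma_finite_measure set U -> \bar R}).

Lemma integral_ae_setT (D : set U) (f : U -> \bar R) : measurable D -> m (~` D) = 0 ->
  measurable_fun setT f -> (forall x, 0 <= f x) ->
  \int[m]_(x in D) f x = \int[m]_x f x.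
Proof.
move=> mD D0 mf f0; rewrite [RHS](ge0_negligible_integral (mu := m) (N := ~` D))//.
  by rewrite setDE setTI setCK.
exact: measurableC.
Qed.

Lemma seminorm2_ae_setT dist s mu (D : set U) (w : U -> R) :
  measurable_fun setT (fun z : U * U => dist z.1 z.2) ->
  measurable D -> m (~` D) = 0 -> measurable_fun setT w ->
  seminorm2 m dist s mu D w = seminorm2 m dist s mu setT w.
Proof.
move=> mdist mD D0 mw; have mdq := measurable_difference_quotient s mu mdist mw.
have dq0 := difference_quotient_ge0 dist s mu w.
have mD1 x : measurable_fun setT (fun y => (difference_quotient dist s mu w (x, y))%:E).
  exact: measurable_slice.
rewrite /seminorm2 [RHS](_ : _ = \int[m]_x \int[m]_(y in D)
    (difference_quotient dist s mu w (x, y))%:E).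
  apply: integral_ae_setT => //.
    rewrite (_ : (fun x => _) =
        (fun x => \int[m]_y (difference_quotient dist s mu w (x, y))%:E)).
      exact: measurable_dint_inner.
    apply/funext => x; apply: integral_ae_setT => // y.
    by rewrite lee_fin.
  by move=> x; apply: integral_ge0 => y _; rewrite lee_fin.
apply: eq_integral => x _; apply/esym; apply: integral_ae_setT => // y.
by rewrite lee_fin.
Qed.

Lemma integral_le_cover (I : eqType) (r : seq I) (V : I -> set U) (g : U -> \bar R) :
  (forall i, measurable (V i)) -> measurable_fun setT g -> (forall x, 0 <= g x) ->
  {ae m, forall x, exists2 i, i \in r & V i x} ->
  \int[m]_x g x <= \sum_(i <- r) \int[m]_(x in V i) g x.
Proof.
move=> mV mg g0 cov.
have mgi i : measurable_fun setT (g \_ (V i)).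
  by apply/(measurable_restrictT _ (mV i)) => //; exact: measurable_funTS.
have gi0 i x : 0 <= (g \_ (V i)) x by rewrite patchE; case: ifP.
under eq_bigr do rewrite integral_mkcond.
rewrite -ge0_integral_sum//; apply: ae_ge0_le_integral => //.
- by move=> x _; exact: sume_ge0.
- exact: emeasurable_sum.
apply: filterS cov => x [i ir Vx] _.
rewrite (big_rem i)//= [X in X + _]patchE mem_set//.
by rewrite leeDl// sume_ge0.
Qed.

End restricted_integrals.

Section swap.
Local Open Scope ereal_scope.
Context dA dB (A : measurableType dA) (B : measurableType dB) (R : realType).
Variables (mA : {sigma_finite_measure set A -> \bar R})
  (mB : {sigma_finite_measure set B -> \bar R}).

Lemma tonelli_rectangle (D : set A) (E : set B) (f : A * B -> R) :
  measurable D -> measurable E -> measurable_fun setT f -> (forall z, 0 <= f z)%R ->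
  \int[mA]_(a in D) \int[mB]_(b in E) (f (a, b))%:E =
  \int[mB]_(b in E) \int[mA]_(a in D) (f (a, b))%:E.
Proof.
move=> mD mE mf f0.
pose F (z : A * B) : \bar R := (\1_D z.1 * (\1_E z.2 * f z))%:E.
have lhs : \int[mA]_(a in D) \int[mB]_(b in E) (f (a, b))%:E = \int[mA]_a \int[mB]_b F (a, b).
  rewrite integral_mkcond; apply: eq_integral => a _; rewrite patchE; case: ifPn => aD.
    rewrite integral_mkcond; apply: eq_integral => b _.
    by rewrite restrict_indic_mule /F/= [\1_D a]indicE aD mul1r.
  by rewrite integral0_eq// => b _; rewrite /F/= indicE (negbTE aD) mul0r.
have rhs : \int[mB]_(b in E) \int[mA]_(a in D) (f (a, b))%:E = \int[mB]_b \int[mA]_a F (a, b).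
  rewrite integral_mkcond; apply: eq_integral => b _; rewrite patchE; case: ifPn => bE.
    rewrite integral_mkcond; apply: eq_integral => a _.
    by rewrite (restrict_indic_mule D (fun a => f (a, b))) /F/= [\1_E b]indicE bE mul1r.
  by rewrite integral0_eq// => a _; rewrite /F/= [\1_E b]indicE (negbTE bE) mul0r mulr0.
rewrite lhs rhs; apply: fubini_tonelli.
  apply/measurable_EFinP; apply: measurable_funM.
    by apply: (measurableT_comp _ measurable_fst); exact: measurable_indic.
  apply: measurable_funM; last exact: mf.
  by apply: (measurableT_comp _ measurable_snd); exact: measurable_indic.
by move=> z; rewrite lee_fin !mulr_ge0.
Qed.

End swap.

Lemma powR_div_opp {R : realType} (a C e : R) : 0 <= a -> 0 < C ->
  (a / C) `^ (- e) = C `^ e * a `^ (- e).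
Proof.
move=> a0 C0; rewrite powRM// ?invr_ge0 ?ltW// mulrC; congr (_ * _).
by rewrite -powR_inv1 ?ltW// -powRrM mulN1r opprK.
Qed.

Section mesh_estimates.
Local Open Scope ereal_scope.
Context {R : realType} (m : nat) (T : R) (Gamma : set 'rV[R]_m.+2).
Variables (mu nu Cdist Clqu Cb : R).
Hypothesis m1 : (m <= 1)%N.
Hypothesis mu0 : (0 < mu)%R.
Hypothesis nu0 : (0 < nu)%R.
Hypothesis T0 : (0 < T)%R.
Hypothesis Cdist1 : (1 <= Cdist)%R.
Hypothesis Clqu1 : (1 <= Clqu)%R.
Hypothesis mGamma : measurable (Gamma : set (borel_rV R m.+2)).
Hypothesis finGamma : @surface_measure R m.+2 Gamma < +oo.
Hypothesis Cb0 : (0 <= Cb)%R.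

Local Notation X := (borel_rV R m.+2).
Local Notation sigma := (@surface_measure R m.+2).
Local Notation lambda := (@lebesgue_measure R).
Local Notation mX := (space_measure mGamma finGamma).
Local Notation mI := (time_measure T0).
Local Notation I := (`]0%R, T[%classic : set R).

Hypothesis ahlfors : forall (x : X) (rr : R), (0 < rr)%R ->
  sigma (Gamma `&` [set y : X | enorm (x - y : 'rV[R]_m.+2) <= rr]%R) <= (Cb * rr ^+ m.+1)%:E.

Variables (P : set (prism R m.+2)) (Cnei : R).
Hypothesis hP : prismatic_mesh T Gamma P.
Hypothesis Cnei1 : (1 <= Cnei)%R.
Hypothesis hnei : mesh_nei T Gamma P Cnei.
Hypothesis hdist : mesh_dist T Gamma P Cdist.
Hypothesis hlqu : mesh_lqu T Gamma P Clqu.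
Variable v : R -> X -> R.
Hypothesis mv : measurable_fun (I `*` (Gamma : set X)) (fun z : R * X => v z.1 z.2).

Local Notation ms := (mesh_seq P).
Local Notation msP := (mesh_seqP hP).
Local Notation v' := (extend0 Gamma T v).
Local Notation semiX := (seminorm2 mX (@space_dist R m) m.+1 mu).
Local Notation semiI := (seminorm2 mI (@time_dist R) 1 nu).
Local Notation J_ := (time_factor P).
Local Notation K_ := (space_factor P).

Let Cdist0 : (0 < Cdist)%R. Proof. exact: lt_le_trans Cdist1. Qed.
Let Clqu0 : (0 < Clqu)%R. Proof. exact: lt_le_trans Clqu1. Qed.

Let mv' : measurable_fun setT (fun z : R * X => v' z.1 z.2).
Proof. exact: measurable_extend0. Qed.

Let mv'T : measurable_fun setT (fun z : X * R => v' z.2 z.1).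
Proof. exact: (measurableT_comp mv' (measurable_fun_pair measurable_snd measurable_fst)). Qed.

Definition space_energy : \bar R := \int[mI]_t semiX setT (v' t).
Definition time_energy : \bar R := \int[mX]_x semiI setT (v' ^~ x).
Definition mass : \bar R := \int[mI]_t \int[mX]_x (v' t x ^+ 2)%:E.
Definition mass_on p : \bar R := \int[mI]_(t in J_ p) \int[mX]_(x in K_ p) (v' t x ^+ 2)%:E.

Definition space_pair (p q : prism R m.+2) : bool :=
  `[< (0 < lambda (p.1 `&` q.1)) /\ p.2 `&` q.2 !=set0 >].
Definition time_pair (p q : prism R m.+2) : bool :=
  `[< p.1 `&` q.1 !=set0 /\ (0 < sigma (p.2 `&` q.2)) >].

Definition space_sum : \bar R := \sum_(p <- ms) \sum_(q <- ms | space_pair p q)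
  \int[mI]_(t in J_ p `&` J_ q) semiX (K_ p `|` K_ q) (v' t).
Definition time_sum : \bar R := \sum_(p <- ms) \sum_(q <- ms | time_pair p q)
  \int[mX]_(x in K_ p `&` K_ q) semiI (J_ p `|` J_ q) (v' ^~ x).

Let mJ p : measurable (J_ p). Proof. exact: measurable_time_factor hP p. Qed.
Let mK p : measurable (K_ p). Proof. exact: measurable_space_factor hP p. Qed.

Let ballX (x : X) rr : (0 < rr)%R -> mX [set y | space_dist x y <= rr]%R <= (Cb * rr ^+ m.+1)%:E.
Proof. by move=> /(ahlfors x); rewrite setIC. Qed.

Let ballI (x : R) rr : (0 < rr)%R -> mI [set y | time_dist x y <= rr]%R <= (2 * rr ^+ 1)%:E.
Proof. exact: time_measure_ball. Qed.

Let ae_mI (Q : R -> Prop) : {ae lambda, forall t, `[0%R, T]%classic t -> Q t} ->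
  {ae mI, forall t, (0 < t < T)%R -> Q t}.
Proof.
move=> H; have := ae_finrestr (mu := @lebesgue_measure R) (measurable_itv `]0%R, T[)
  (lebesgue_open_interval_lty T0) H.
apply: (@filterS _ _ (ae_filter_ringOfSetsType mI)) => t Qt /andP[t0 tT].
by apply: Qt; rewrite /= in_itv/= !ltW.
Qed.

Let ae_mX (Q : X -> Prop) : {ae sigma, forall x, Gamma x -> Q x} ->
  {ae mX, forall x, Gamma x -> Q x}.
Proof. exact: (ae_finrestr (mu := @surface_measure R m.+2) mGamma finGamma). Qed.

Let space_pair_touch p q : space_pair p q -> space_touch p q.
Proof. by move=> /asboolP[_ pq]; apply/asboolP. Qed.

Let time_pair_touch p q : time_pair p q -> time_touch p q.
Proof. by move=> /asboolP[pq _]; apply/asboolP. Qed.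

Let space_pair_null p q : p \in ms -> q \in ms -> space_touch p q -> ~~ space_pair p q ->
  mI (J_ p `&` J_ q) = 0.
Proof.
move=> /msP Pp /msP Pq /asboolP pq /asboolPn npq; rewrite !(time_factorE hP)//.
apply/eqP; rewrite eq_le measure_ge0 andbT; apply: (@le_trans _ _ (lambda (p.1 `&` q.1))).
  have mpq : measurable (p.1 `&` q.1) by apply: measurableI; exact: (mesh_measurable1 hP).
  apply: le_measure; [|exact/mem_set|exact: subIsetl].
  by apply/mem_set; apply: measurableI.
by rewrite leNgt; apply/negP => l0; exact: npq.
Qed.

Let time_pair_null p q : p \in ms -> q \in ms -> time_touch p q -> ~~ time_pair p q ->
  mX (K_ p `&` K_ q) = 0.
Proof.
move=> /msP Pp /msP Pq /asboolP pq /asboolPn npq; rewrite !(space_factorE hP)//.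
apply/eqP; rewrite eq_le measure_ge0 andbT; apply: (@le_trans _ _ (sigma (p.2 `&` q.2))).
  have mpq : measurable ((p.2 : set X) `&` q.2) by apply: measurableI; exact: (mesh_measurable2 hP).
  apply: (le_measure (@surface_measure R m.+2)); [|exact/mem_set|exact: subIsetl].
  by apply/mem_set; apply: measurableI.
by rewrite leNgt; apply/negP => l0; exact: npq.
Qed.

Lemma space_sum_le : space_sum <= (Cnei + Cnei)%:E * space_energy.
Proof.
have [lo [hi lohiP]] := mesh_endpoints hP.
apply: (slice_sum_le (mA := mI) (m := mX) m.+1 mu (@measurable_space_dist R m) mv' mJ mK space_pair_touch
  space_pair_null).
  by rewrite addr_ge0// (le_trans _ Cnei1).
have := generic_time T0 hP lohiP; have := ae_mI hnei.
apply: (@filterS2 _ _ (ae_filter_ringOfSetsType mI)) => t nei [tT gen].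
exact: (space_indicator_sum m1 hP mGamma finGamma tT gen (nei tT)).
Qed.

Lemma time_sum_le : time_sum <= (3 + 3)%:E * time_energy.
Proof.
have [lo [hi lohiP]] := mesh_endpoints hP.
apply: (slice_sum_le (mA := mX) (m := mI) (u := fun x t => v' t x) 1 nu (@measurable_time_dist R) mv'T mK mJ time_pair_touch
  time_pair_null).
  by rewrite addr_ge0.
have := generic_space hP mGamma finGamma; have := ae_mX hlqu.
apply: (@filterS2 _ _ (ae_filter_ringOfSetsType mX)) => x lqu [Gx gen].
exact: (time_indicator_sum T0 hP lohiP Gx gen (lqu Gx)).
Qed.

(** [4 * tail_const] is the factor of the localization; [Cdist^(2 mu)] appears because the pieces
    are separated by [diam K / Cdist] while the weight is a power of [diam K]. *)
Definition space_const : R := (4 * tail_const m.+1 mu Cb * Cdist `^ (2 * mu))%R.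
(** On the line a ball of radius r has length 2 r: growth exponent 1 and growth constant 2. *)
Definition time_const : R := (4 * tail_const 1 nu 2 * Clqu `^ (2 * nu))%R.

Lemma space_const_ge0 : (0 <= space_const)%R.
Proof. by rewrite mulr_ge0 ?powR_ge0// mulr_ge0// tail_const_ge0. Qed.

Lemma time_const_ge0 : (0 <= time_const)%R.
Proof. by rewrite mulr_ge0 ?powR_ge0// mulr_ge0// tail_const_ge0. Qed.

Let mass_on_ge0 p : 0 <= mass_on p.
Proof.
by apply: integral_ge0 => t _; apply: integral_ge0 => x _; rewrite lee_fin sqr_ge0.
Qed.

Let mass_on_swap p : mass_on p = \int[mX]_(x in K_ p) \int[mI]_(t in J_ p) (v' t x ^+ 2)%:E.
Proof.
apply: (tonelli_rectangle mI mX (f := fun z => v' z.1 z.2 ^+ 2)%R); [exact: mJ|exact: mK| |].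
  exact: measurable_funX.
by move=> z; exact: sqr_ge0.
Qed.

Lemma space_energy_le : space_energy <= space_sum +
  space_const%:E * \sum_(p <- ms) (diam p.2 `^ (- (2 * mu)))%:E * mass_on p.
Proof.
have [lo [hi lohiP]] := mesh_endpoints hP.
have := slice_le_sum (mA := mI) (m := mX) (@measurable_space_dist R m)
  (fun x y => enorm_distC (x : 'rV[R]_m.+2) y) mu0 Cb0 ballX mv' mJ mK space_pair_touch
  space_pair_null (h := fun p => (diam p.2 / Cdist)%R).
move=> H; apply: le_trans (H _) _; last first.
  apply: leeD => //; rewrite le_eqVlt; apply/orP; left; apply/eqP.
  rewrite ge0_sume_distrr; last by move=> p _; rewrite mule_ge0// lee_fin powR_ge0.
  apply: eq_bigr => p _; rewrite muleA -EFinM; congr (_%:E * _).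
  rewrite powR_div_opp//; last by apply: fine_ge0; exact: ediam_ge0.
  by rewrite /space_const !mulrA.
have := generic_time T0 hP lohiP; have := ae_mI hdist.
apply: (@filterS2 _ _ (ae_filter_ringOfSetsType mI)) => t dist [tT gen]; split.
- exact: (space_cover hP mGamma finGamma tT).
- move=> p /(active_timeP hP)[Pp _]; rewrite divr_gt0//.
  exact: (mesh_diam_gt0 m1 hP Pp).
- move=> p q x y pa qa pq px qy.
  exact: (space_separation m1 hP Cdist1 (dist tT) pa qa pq px qy).
Qed.

Lemma time_energy_le : time_energy <= time_sum +
  time_const%:E * \sum_(p <- ms) (fine (lambda p.1) `^ (- (2 * nu)))%:E * mass_on p.
Proof.
have [lo [hi lohiP]] := mesh_endpoints hP.
have := slice_le_sum (mA := mX) (m := mI) (u := fun x t => v' t x) (@measurable_time_dist R)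
  (fun t s => distrC t s) nu0 (ler0n R 2) ballI mv'T mK mJ time_pair_touch
  time_pair_null (h := fun p => (fine (lambda p.1) / Clqu)%R).
move=> H; apply: le_trans (H _) _; last first.
  apply: leeD => //; rewrite le_eqVlt; apply/orP; left; apply/eqP.
  rewrite ge0_sume_distrr; last by move=> p _; rewrite mule_ge0// lee_fin powR_ge0.
  apply: eq_bigr => p _; rewrite -mass_on_swap muleA -EFinM; congr (_%:E * _).
  rewrite powR_div_opp//; last by apply: fine_ge0; exact: measure_ge0.
  by rewrite /time_const !mulrA.
have := generic_space hP mGamma finGamma; have := ae_mX hlqu.
apply: (@filterS2 _ _ (ae_filter_ringOfSetsType mX)) => x lqu [Gx gen]; split.
- exact: (time_cover T0 hP lohiP Gx).
- exact: (time_factor_gt0 T0 hP lohiP Clqu1 Gx (lqu Gx)).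
- move=> p q t s pa qa pq pt qs.
  exact: (time_separation T0 hP lohiP Clqu1 Gx gen (lqu Gx) pa qa pq pt qs).
Qed.

Let mv's t : measurable_fun setT (fun x => (v' t x ^+ 2)%:E).
Proof.
apply/measurable_EFinP; apply: measurable_funX.
exact: (measurableT_comp mv' (pair1_measurable t)).
Qed.

Let mmass A : measurable A -> measurable_fun setT (fun t => \int[mX]_(x in A) (v' t x ^+ 2)%:E).
Proof.
move=> mA; under eq_fun do rewrite integral_mkcond.
rewrite (_ : (fun t => _) =
    fubini_F mX (fun z : R * X => (\1_A z.2 * v' z.1 z.2 ^+ 2)%:E)).
  apply: measurable_fun_fubini_tonelli_F.
    apply/measurable_EFinP; apply: measurable_funM; last exact: measurable_funX.
    by apply: (measurableT_comp _ measurable_snd); exact: measurable_indic.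
  by move=> z; rewrite lee_fin mulr_ge0// sqr_ge0.
by apply/funext => t; apply: eq_integral => x _; rewrite restrict_indic_mule.
Qed.

(** Every time interval satisfies [|J| <= T], so [T^(2 nu) |J|^(-2 nu)] is at least 1 when J is
    nondegenerate. *)
Lemma mass_le : mass <= (T `^ (2 * nu))%:E *
  \sum_(p <- ms) (fine (lambda p.1) `^ (- (2 * nu)))%:E * mass_on p.
Proof.
have [lo [hi lohiP]] := mesh_endpoints hP.
have g0 t x : 0 <= (v' t x ^+ 2)%:E by rewrite lee_fin sqr_ge0.
have G0 p t : 0 <= \int[mX]_(x in K_ p) (v' t x ^+ 2)%:E by apply: integral_ge0.
have mGp p : measurable_fun setT ((fun t => \int[mX]_(x in K_ p) (v' t x ^+ 2)%:E) \_ (J_ p)).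
  apply/(measurable_restrictT _ (mJ p)) => //; apply: measurable_funTS.
  exact: mmass.
have Gp0 p t : 0 <= ((fun t => \int[mX]_(x in K_ p) (v' t x ^+ 2)%:E) \_ (J_ p)) t.
  by rewrite patchE; case: ifP.
apply: (@le_trans _ _ (\sum_(p <- ms) mass_on p)).
  rewrite /mass_on; under eq_bigr do rewrite integral_mkcond.
  rewrite -ge0_integral_sum//.
  apply: ae_ge0_le_integral => //.
  - by move=> t _; apply: integral_ge0.
  - exact: mmass.
  - by move=> t _; apply: sume_ge0.
  - exact: emeasurable_sum.
  have := generic_time T0 hP lohiP.
  apply: (@filterS _ _ (ae_filter_ringOfSetsType mI)) => t [tT gen] _.
  apply: (le_trans (integral_le_cover mK (mv's t) (g0 t) (space_cover hP mGamma finGamma tT))).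
  rewrite big_filter big_mkcond; apply: lee_sum => p _.
  by rewrite patchE; case: ifP.
rewrite ge0_sume_distrr; last by move=> p _; rewrite mule_ge0// lee_fin powR_ge0.
rewrite big_seq [leRHS]big_seq; apply: lee_sum => p /msP Pp.
rewrite (mesh_time_lebesgue lohiP Pp)/=; have [l0 lh hT pE] := lohiP p Pp.
(* For a degenerate interval the weight gives no lower bound, but the prism carries no mass. *)
have [e|lh'] := eqVneq (lo p) (hi p).
  suff -> : mass_on p = 0 by rewrite !mule0.
  rewrite /mass_on [LHS](ge0_negligible_integral (mu := mI) (N := J_ p)).
  - by rewrite setDv integral_set0.
  - exact: mJ.
  - exact: mJ.
  - by apply: measurable_funTS; exact: mmass.
  - by move=> t _; exact: G0.
  - apply/eqP; rewrite eq_le measure_ge0 andbT.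
    apply: (@le_trans _ _ (lambda p.1)).
      rewrite (time_factorE hP Pp); apply: le_measure; rewrite ?inE//.
        by apply: measurableI => //; exact: (mesh_measurable1 hP).
      exact: (mesh_measurable1 hP).
    by rewrite (mesh_time_lebesgue lohiP Pp) e subrr.
have d0 : (0 < hi p - lo p)%R by rewrite subr_gt0 lt_neqAle lh' lh.
rewrite muleA -EFinM -[leLHS]mul1e lee_wpmul2r// lee_fin powRN ler_pdivlMr ?powR_gt0// mul1r.
apply: ge0_ler_powR; first by rewrite mulr_ge0// ltW.
- by rewrite nnegrE ltW.
- by rewrite nnegrE ltW.
- lra.
Qed.

End mesh_estimates.

Lemma mesh_fsum {R : realType} m (T : R) Gamma (P : set (prism R m.+2))
    (hP : prismatic_mesh T Gamma P) (Q : set (prism R m.+2)) (c : pred (prism R m.+2))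
    (F : prism R m.+2 -> \bar R) : (forall q, Q q <-> P q /\ c q) ->
  (\sum_(q \in Q) F q = \sum_(q <- mesh_seq P | c q) F q)%E.
Proof.
have [finP _ _ _] := hP; move=> QP.
have -> : Q = P `&` [set q | c q] by apply/seteqP; split=> q /=; rewrite QP.
rewrite fsbig_mkcondr fsbig_finite//= [RHS]big_mkcond /mesh_seq.
by apply: eq_bigr => q _; rewrite mem_setE.
Qed.

(** * The quantities of the theorem in terms of energies and masses *)

Section mesh_norms.
Local Open Scope ereal_scope.
Context {R : realType} (m : nat) (T : R) (Gamma : set 'rV[R]_m.+2).
Variables (mu nu : R).
Hypothesis T0 : (0 < T)%R.
Hypothesis mGamma : measurable (Gamma : set (borel_rV R m.+2)).
Hypothesis finGamma : @surface_measure R m.+2 Gamma < +oo.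

Local Notation X := (borel_rV R m.+2).
Local Notation sigma := (@surface_measure R m.+2).
Local Notation lambda := (@lebesgue_measure R).
Local Notation mX := (space_measure mGamma finGamma).
Local Notation mI := (time_measure T0).
Local Notation I := (`]0%R, T[%classic : set R).

Variable v : R -> X -> R.
Hypothesis mv : measurable_fun (I `*` (Gamma : set X)) (fun z : R * X => v z.1 z.2).

Local Notation A := (space_energy mu T0 mGamma finGamma v).
Local Notation B := (time_energy nu T0 mGamma finGamma v).
Local Notation N := (mass T0 mGamma finGamma v).

Let mv' : measurable_fun setT (fun z : R * X => extend0 Gamma T v z.1 z.2).
Proof. exact: measurable_extend0. Qed.

Let IT : I `<=` `[0%R, T]%classic.
Proof. by move=> t /=; rewrite !in_itv/= => /andP[/ltW-> /ltW->]. Qed.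

Let mI_I : mI (~` I) = 0.
Proof. by rewrite /= /time_measure /finrestr /mrestr setICl measure0. Qed.

Let mX_Gamma : mX (~` (Gamma : set X)) = 0.
Proof. by rewrite /= /space_measure /finrestr /mrestr setICl measure0. Qed.

(** Both summands of the anisotropic norm contain the full [L_2] norm, so the mass enters twice. *)
Lemma Hmunu_norm2E : Hmunu_norm2 mu nu I Gamma v = N + A + (N + B).
Proof.
have mvt t : measurable_fun setT (extend0 Gamma T v t).
  exact: (measurableT_comp mv' (pair1_measurable t)).
have mvx x : measurable_fun setT (extend0 Gamma T v ^~ x).
  exact: (measurableT_comp mv' (pair2_measurable x)).
have L2E : L2J_norm2 I (L2_norm2 (Gamma : set X)) v = N.
  rewrite (L2J_L2_norm2E mGamma finGamma T0 mv (measurable_itv _) IT mGamma (@subset_refl _ _)).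
  have inner t : \int[mX]_(x in (Gamma : set X)) (extend0 Gamma T v t x ^+ 2)%:E =
      \int[mX]_x (extend0 Gamma T v t x ^+ 2)%:E.
    apply: integral_ae_setT; [exact: mGamma|exact: mX_Gamma| |].
      by apply/measurable_EFinP; exact: measurable_funX.
    by move=> x; rewrite lee_fin sqr_ge0.
  under eq_integral do rewrite inner.
  apply: integral_ae_setT; [exact: measurable_itv|exact: mI_I| |].
    apply: (measurable_fun_fubini_tonelli_F
      (fun z : R * X => (extend0 Gamma T v z.1 z.2 ^+ 2)%:E)).
      by apply/measurable_EFinP; exact: measurable_funX.
    by move=> z; rewrite lee_fin sqr_ge0.
  by move=> t; apply: integral_ge0 => x _; rewrite lee_fin sqr_ge0.
rewrite /Hmunu_norm2 /HnuJ_norm2.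
rewrite (L2J_Hmu_norm2E mGamma finGamma T0 mv (measurable_itv _) IT mGamma (@subset_refl _ _)).
rewrite L2E.
have -> : L2J_norm2 I (Hmu_seminorm2 mu (Gamma : set X)) v = A.
  rewrite (L2J_Hmu_seminorm2E mGamma finGamma T0 mv (measurable_itv _) IT mGamma (@subset_refl _ _)).
  have inner t : seminorm2 mX (@space_dist R m) m.+1 mu (Gamma : set X) (extend0 Gamma T v t) =
      seminorm2 mX (@space_dist R m) m.+1 mu setT (extend0 Gamma T v t).
    apply: seminorm2_ae_setT; [exact: measurable_space_dist|exact: mGamma|exact: mX_Gamma|].
    exact: mvt.
  under eq_integral do rewrite inner.
  apply: integral_ae_setT; [exact: measurable_itv|exact: mI_I| |].
    exact: (measurable_seminorm2_slice mX m.+1 mu (@measurable_space_dist R m) mv').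
  by move=> t; exact: seminorm2_ge0.
congr (_ + (_ + _)).
rewrite (HnuJ_seminorm2E mGamma finGamma T0 mv (measurable_itv _) IT mGamma (@subset_refl _ _)).
have inner x : seminorm2 mI (@time_dist R) 1 nu I (extend0 Gamma T v ^~ x) =
    seminorm2 mI (@time_dist R) 1 nu setT (extend0 Gamma T v ^~ x).
  apply: seminorm2_ae_setT; [exact: measurable_time_dist|exact: measurable_itv|exact: mI_I|].
  exact: mvx.
under eq_integral do rewrite inner.
apply: integral_ae_setT; [exact: mGamma|exact: mX_Gamma| |].
  apply: (measurable_seminorm2_slice mI 1 nu (@measurable_time_dist R)
    (u := fun x t => extend0 Gamma T v t x)); last exact: measurableT.
  exact: (measurableT_comp mv' (measurable_fun_pair measurable_snd measurable_fst)).
by move=> x; exact: seminorm2_ge0.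
Qed.

Variable P : set (prism R m.+2).
Hypothesis hP : prismatic_mesh T Gamma P.

Local Notation ms := (mesh_seq P).
Local Notation msP := (mesh_seqP hP).

Let space_part p : P p ->
  \sum_(q \in [set q | [/\ P q, 0 < lambda (p.1 `&` q.1) & p.2 `&` q.2 !=set0]])
    L2J_norm2 (p.1 `&` q.1) (Hmu_seminorm2 mu (p.2 `|` q.2)) v =
  \sum_(q <- ms | space_pair p q) \int[mI]_(t in time_factor P p `&` time_factor P q)
    seminorm2 mX (@space_dist R m) m.+1 mu (space_factor P p `|` space_factor P q)
      (extend0 Gamma T v t).
Proof.
move=> Pp; transitivity (\sum_(q <- ms | space_pair p q)
    L2J_norm2 (p.1 `&` q.1) (Hmu_seminorm2 mu (p.2 `|` q.2)) v).
  apply: (mesh_fsum hP) => q; split=> [[Pq pq1 pq2]|[Pq /asboolP[pq1 pq2]]].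
    by split=> //; apply/asboolP.
  by split.
rewrite big_seq_cond [RHS]big_seq_cond; apply: eq_bigr => q /andP[/msP Pq _].
rewrite (time_factorE hP Pp) (time_factorE hP Pq) (space_factorE hP Pp) (space_factorE hP Pq).
apply: (L2J_Hmu_seminorm2E mGamma finGamma T0 mv).
- exact: measurableI (mesh_measurable1 hP Pp) (mesh_measurable1 hP Pq).
- by move=> t [pt _]; exact: (mesh_time_subset hP Pp).
- exact: measurableU (mesh_measurable2 hP Pp) (mesh_measurable2 hP Pq).
- by move=> x [|]; [exact: (mesh_subset hP Pp)|exact: (mesh_subset hP Pq)].
Qed.

Let time_part p : P p ->
  \sum_(q \in [set q | [/\ P q, p.1 `&` q.1 !=set0 & 0 < sigma (p.2 `&` q.2)]])
    HnuJ_seminorm2 nu (p.1 `|` q.1) (L2_norm2 (p.2 `&` q.2)) v =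
  \sum_(q <- ms | time_pair p q) \int[mX]_(x in space_factor P p `&` space_factor P q)
    seminorm2 mI (@time_dist R) 1 nu (time_factor P p `|` time_factor P q)
      (extend0 Gamma T v ^~ x).
Proof.
move=> Pp; transitivity (\sum_(q <- ms | time_pair p q)
    HnuJ_seminorm2 nu (p.1 `|` q.1) (L2_norm2 (p.2 `&` q.2)) v).
  apply: (mesh_fsum hP) => q; split=> [[Pq pq1 pq2]|[Pq /asboolP[pq1 pq2]]].
    by split=> //; apply/asboolP.
  by split.
rewrite big_seq_cond [RHS]big_seq_cond; apply: eq_bigr => q /andP[/msP Pq _].
rewrite (time_factorE hP Pp) (time_factorE hP Pq) (space_factorE hP Pp) (space_factorE hP Pq).
apply: (HnuJ_seminorm2E mGamma finGamma T0 mv).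
- exact: measurableU (mesh_measurable1 hP Pp) (mesh_measurable1 hP Pq).
- by move=> t [|]; [exact: (mesh_time_subset hP Pp)|exact: (mesh_time_subset hP Pq)].
- exact: measurableI (mesh_measurable2 hP Pp) (mesh_measurable2 hP Pq).
- by move=> x [px _]; exact: (mesh_subset hP Pp).
Qed.

Lemma mesh_seminormsE : mesh_seminorms mu nu P v =
  space_sum mu T0 mGamma finGamma P v + time_sum nu T0 mGamma finGamma P v.
Proof.
have [finP _ _ _] := hP.
rewrite /mesh_seminorms (fsbig_finite _ _ finP)/= /space_sum /time_sum -big_split/=.
rewrite big_seq [RHS]big_seq; apply: eq_bigr => p /msP Pp.
exact: (f_equal2 adde (space_part Pp) (time_part Pp)).
Qed.

Lemma mesh_weighted_L2E : mesh_weighted_L2 mu nu P v =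
  \sum_(p <- ms) (diam p.2 `^ (- (2 * mu)))%:E * mass_on T0 mGamma finGamma P v p +
  \sum_(p <- ms) (fine (lambda p.1) `^ (- (2 * nu)))%:E * mass_on T0 mGamma finGamma P v p.
Proof.
have [finP _ _ _] := hP.
rewrite /mesh_weighted_L2 (fsbig_finite _ _ finP)/= -big_split/=.
rewrite big_seq [RHS]big_seq; apply: eq_bigr => p /msP Pp.
have LE : L2J_norm2 p.1 (L2_norm2 p.2) v = mass_on T0 mGamma finGamma P v p.
  rewrite /mass_on (time_factorE hP Pp) (space_factorE hP Pp).
  exact: (L2J_L2_norm2E mGamma finGamma T0 mv (mesh_measurable1 hP Pp)
    (mesh_time_subset hP Pp) (mesh_measurable2 hP Pp) (mesh_subset hP Pp)).
by rewrite LE -ge0_muleDl ?lee_fin ?powR_ge0// -EFinD.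
Qed.

End mesh_norms.

Lemma localized_norm_equivalence (R : realType) (m : nat) (m1 : (m <= 1)%N)
    (mu nu T Cdist Clqu : R) (hmu : 0 < mu) (hnu : 0 < nu) (T0 : 0 < T)
    (hCdist : 1 <= Cdist) (hClqu : 1 <= Clqu) (Gamma : set 'rV[R]_m.+2) :
  exists Crel : R, 0 < Crel /\
    forall (P : set (prism R m.+2)) (Cnei : R),
      prismatic_mesh T Gamma P ->
      1 <= Cnei ->
      mesh_nei T Gamma P Cnei ->
      mesh_dist T Gamma P Cdist ->
      mesh_lqu T Gamma P Clqu ->
      let I : set R := `]0, T[%classic in
      let Ceff : R := Num.max (2 * (Cnei + 1) ^+ 2) 32 in
      forall v : R -> 'rV[R]_m.+2 -> R,
        in_Hmunu mu nu I Gamma v ->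
        (mesh_seminorms mu nu P v <=
           (Ceff ^+ 2)%:E * Hmunu_norm2 mu nu I Gamma v)%E /\
        ((Crel ^- 2)%:E * Hmunu_norm2 mu nu I Gamma v <=
           mesh_seminorms mu nu P v + mesh_weighted_L2 mu nu P v)%E.
Proof.
(* Surface measure of balls is controlled through any one mesh; without a mesh
   there is nothing to prove, so the constant depends only on Gamma. *)
have [[P0 hP0]|nP] := pselect (exists P, prismatic_mesh T Gamma P); last first.
  by exists 1; split=> // P Cnei hP; exfalso; apply: nP; exists P.
have mGamma := mesh_Gamma_measurable T0 hP0.
have finGamma := mesh_Gamma_lty T0 hP0.
have [Cb Cb0 ahlfors] := mesh_ahlfors T0 hP0.
pose KX := space_const m mu Cdist Cb; pose KI := time_const nu Clqu.
pose TT := T `^ (2 * nu).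
have KX0 : 0 <= KX by exact: space_const_ge0.
have KI0 : 0 <= KI by exact: time_const_ge0.
have TT0 : 0 <= TT by exact: powR_ge0.
(* [1] pays for the local seminorms, [KX] and [KI] for the far pairs in space and in time, and [TT]
   once for each copy of the mass. The squared norm is thus at most [Crel] times the right-hand
   side, and [Crel >= 1] allows passing to [Crel ^- 2]. *)
pose Crel := 1 + KX + KI + (TT + TT).
have Crel1 : 1 <= Crel by rewrite /Crel; lra.
have Crel0 : 0 < Crel by exact: lt_le_trans Crel1.
exists Crel; split=> // P Cnei hP Cnei1 hnei hdist hlqu I Ceff v [mv _].
have [lo [hi lohiP]] := mesh_endpoints hP.
rewrite (Hmunu_norm2E mu nu T0 mGamma finGamma mv).
rewrite (mesh_seminormsE mu nu T0 mGamma finGamma mv hP).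
rewrite (mesh_weighted_L2E mu nu T0 mGamma finGamma mv hP).
have SX := space_sum_le mu m1 T0 mGamma finGamma hP Cnei1 hnei mv.
have SI := time_sum_le nu T0 mGamma finGamma hP hlqu mv.
have AX := space_energy_le m1 hmu T0 hCdist mGamma finGamma Cb0 ahlfors hP hdist mv.
have AI := time_energy_le hnu T0 hClqu mGamma finGamma hP hlqu mv.
have MM := mass_le hnu T0 mGamma finGamma hP mv.
move: SX SI AX AI MM; rewrite -/KX -/KI -/TT.
set N := mass _ _ _ _; set A := space_energy _ _ _ _ _; set B := time_energy _ _ _ _ _.
set S1 := space_sum _ _ _ _ _ _; set S2 := time_sum _ _ _ _ _ _.
set W1 := (\sum_(p <- _) (diam _ `^ _)%:E * _)%E.
set W2 := (\sum_(p <- _) (fine _ `^ _)%:E * _)%E.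
have N0 : (0 <= N)%E.
  by apply: integral_ge0 => t _; apply: integral_ge0 => x _; rewrite lee_fin sqr_ge0.
have A0 : (0 <= A)%E by apply: integral_ge0 => t _; exact: seminorm2_ge0.
have B0 : (0 <= B)%E by apply: integral_ge0 => x _; exact: seminorm2_ge0.
have S10 : (0 <= S1)%E.
  apply: sume_ge0 => p _; apply: sume_ge0 => q _.
  by apply: integral_ge0 => t _; exact: seminorm2_ge0.
have S20 : (0 <= S2)%E.
  apply: sume_ge0 => p _; apply: sume_ge0 => q _.
  by apply: integral_ge0 => t _; exact: seminorm2_ge0.
have mass0 p : (0 <= mass_on T0 mGamma finGamma P v p)%E.
  by apply: integral_ge0 => t _; apply: integral_ge0 => x _; rewrite lee_fin sqr_ge0.
have W10 : (0 <= W1)%E by apply: sume_ge0 => p _; apply: mule_ge0; [rewrite lee_fin powR_ge0|exact: mass0].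
have W20 : (0 <= W2)%E by apply: sume_ge0 => p _; apply: mule_ge0; [rewrite lee_fin powR_ge0|exact: mass0].
clearbody N A B S1 S2 W1 W2 KX KI TT => SX SI AX AI MM; split.
  (* The slicing gives the factors [2 * Cnei] in space and 6 in time; both are at most [Ceff], which
     is at most its square. *)
  have C32 : 32 <= Ceff by rewrite /Ceff le_max lexx orbT.
  have Cn : 2 * (Cnei + 1) ^+ 2 <= Ceff by rewrite /Ceff le_max lexx.
  have Cnn : Cnei + Cnei <= Ceff by apply: le_trans Cn; nra.
  have CC : Ceff <= Ceff ^+ 2 by nra.
  apply: (le_trans (leeD SX SI)).
  apply: (@le_trans _ _ ((Ceff ^+ 2)%:E * A + (Ceff ^+ 2)%:E * B)%E).
    by apply: leeD; rewrite lee_wpmul2r// lee_fin; lra.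
  rewrite -ge0_muleDr//; apply: lee_wpmul2l; first by rewrite lee_fin sqr_ge0.
  by apply: leeD; rewrite leeDr.
pose Z := (S1 + S2 + (W1 + W2))%E.
have Z0 : (0 <= Z)%E by rewrite !adde_ge0.
have W1Z : (W1 <= Z)%E.
  by apply: (@le_trans _ _ (W1 + W2)%E); [rewrite leeDl|rewrite /Z leeDr// adde_ge0].
have W2Z : (W2 <= Z)%E.
  by apply: (@le_trans _ _ (W1 + W2)%E); [rewrite leeDr|rewrite /Z leeDr// adde_ge0].
have SZ : (S1 + S2 <= Z)%E by rewrite /Z leeDl// adde_ge0.
have key : (N + A + (N + B) <= Crel%:E * Z)%E.
  rewrite addeACA addeC.
  rewrite /Crel EFinD ge0_muleDl ?lee_fin ?addr_ge0//; apply: leeD.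
    apply: (le_trans (leeD AX AI)); rewrite addeACA.
    rewrite -(addrA 1 KX KI) EFinD ge0_muleDl ?lee_fin ?addr_ge0//.
    rewrite mul1e; apply: leeD => //.
    by rewrite EFinD ge0_muleDl ?lee_fin//; apply: leeD; apply: lee_wpmul2l; rewrite ?lee_fin.
  rewrite EFinD ge0_muleDl ?lee_fin//.
  by apply: leeD; apply: (le_trans MM); apply: lee_wpmul2l; rewrite ?lee_fin.
apply: (@le_trans _ _ ((Crel ^- 2)%:E * (Crel%:E * Z))%E).
  by apply: lee_wpmul2l => //; rewrite lee_fin invr_ge0 exprn_ge0// ltW.
rewrite muleA -EFinM -[leRHS]mul1e; apply: lee_wpmul2r => //.
by rewrite lee_fin expr2 invfM mulfVK ?gt_eqF// invf_le1.
Qed.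
Unset Implicit Arguments.

Theorem theorem3p3 (R : realType) (n : nat) (hn : n = 2%N \/ n = 3%N)
    (mu nu T Cdist Clqu : R)
    (hmu : 0 < mu < 1) (hnu : 0 < nu < 1) (hT : 0 < T)
    (hCdist : 1 <= Cdist) (hClqu : 1 <= Clqu)
    (Gamma : set 'rV[R]_n)
    (hGamma : exists Omega : set 'rV[R]_n,
       lipschitz_domain Omega /\ Gamma = boundary Omega) :
  exists Crel : R, 0 < Crel /\
    forall (P : set (prism R n)) (Cnei : R),
      prismatic_mesh T Gamma P ->
      1 <= Cnei ->
      mesh_nei T Gamma P Cnei ->
      mesh_dist T Gamma P Cdist ->
      mesh_lqu T Gamma P Clqu ->
      let I : set R := `]0, T[%classic in
      let Ceff : R := Num.max (2 * (Cnei + 1) ^+ 2) 32 in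
      forall v : R -> 'rV[R]_n -> R,
        in_Hmunu mu nu I Gamma v ->
        (mesh_seminorms mu nu P v <=
           (Ceff ^+ 2)%:E * Hmunu_norm2 mu nu I Gamma v)%E /\
        ((Crel ^- 2)%:E * Hmunu_norm2 mu nu I Gamma v <=
           mesh_seminorms mu nu P v + mesh_weighted_L2 mu nu P v)%E.
Proof.
case: hn => hn; subst n.
  by apply: (localized_norm_equivalence (m := 0)) => //; [case/andP: hmu|case/andP: hnu].
by apply: (localized_norm_equivalence (m := 1)) => //; [case/andP: hmu|case/andP: hnu].
Qed.
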